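(* Let $G=\mathrm{Aut}(\mathbb{Q},<)$. For $f\in G$ consider the properties: (1) for all orbitals $O_1,O_2\in\mathcal{O}^*_f$ with $O_1<O_2$ and either $s_f(O_1)=s_f(O_2)=1$ or $s_f(O_1)=s_f(O_2)=-1$, there exists an orbital $O_3\in\mathcal{O}^*_f$ with $O_1<O_3<O_2$ and $s_f(O_3)\neq s_f(O_1)$; (2) $f$ has only finitely many fixed points. Then almost every element of $G$ has properties (1) and (2). Moreover, a conjugacy class of $G$ is non-Haar null if and only if one (equivalently, each) of its elements has properties (1) and (2). Furthermore, every non-Haar null conjugacy class is compact biter, and every non-Haar null conjugacy class whose elements have no rational fixed points is compact catcher.
   Context: $\mathrm{Aut}(\mathbb{Q},<)$ is the group of order-preserving bijections of $\mathbb{Q}$ with the topology of pointwise convergence (a Polish group). For $f\in G$, the set of orbitals is $\mathcal{O}^*_f=\{\mathrm{conv}(\{f^n(r):n\in\mathbb{Z}\}): r\in\mathbb{Q}\}$, where convex hulls are taken relative to $\mathbb{Q}$; orbitals partition $\mathbb{Q}$, and for distinct orbitals $O_1<O_2$ means $p_1<p_2$ for some (equivalently all) $p_1\in O_1,p_2\in O_2$. The parity function $s_f:\mathcal{O}^*_f\to\{-1,0,1\}$ is $s_f(O)=0$ if $O$ is a singleton fixed point, $s_f(O)=1$ if $f(p)>p$ for $p\in O$, and $s_f(O)=-1$ if $f(p)<p$ for $p\in O$. For a Polish group $G$, a Borel set $B\subseteq G$ is Haar null if there is a Borel probability measure $\mu$ on $G$ with $\mu(gBh)=0$ for all $g,h\in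 G$; an arbitrary set is Haar null if it is contained in a Borel Haar null set; ''almost every element has property $P$'' means the set of elements without $P$ is Haar null. A set $A\subseteq G$ is compact catcher if for every compact $K\subseteq G$ there exist $g,h\in G$ with $gKh\subseteq A$; it is compact biter if for every non-empty compact $K\subseteq G$ there exist an open $U$ and $g,h\in G$ with $U\cap K\neq\emptyset$ and $g(U\cap K)h\subseteq A$. *)

(* Defs.v *)
From HB Require Import structures.
From mathcomp Require Import all_boot all_order all_algebra.
From mathcomp Require Import all_classical all_reals all_analysis.

Set Implicit Arguments.
Unset Strict Implicit.
Unset Printing Implicit Defensive.

Import Order.TTheory GRing.Theory Num.Theory.
Local Open Scope classical_set_scope.
Local Open Scope group_scope.

HB.mixin Record isTopologicalGroup G of Group G & PointedTopological G := {
  mulg_continuous : continuous (fun xy : G * G => xy.1 * xy.2 : G) ;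
  invg_continuous : continuous (fun x : G => x^-1 : G) }.

#[short(type="topologicalGroupType")]
HB.structure Definition TopologicalGroup :=
  {G of isTopologicalGroup G & Group G & PointedTopological G}.

Section group_notions.
Context {G : topologicalGroupType}.
Implicit Types A B C K U : set G.

Definition translate (g : G) B (h : G) : set G := [set g * x * h | x in B].

Definition conjugacy_class C :=
  exists f : G, C = [set f ^ g | g in [set: G]].

Definition borel : set (set G) := <<s @open G >>.

Definition borel_haar_null (R : realType) B :=
  borel B /\
  exists mu : probability (g_sigma_algebraType (@open G)) R,
    forall g h : G, mu (translate g B h) = 0%E.

Definition haar_null (R : realType) A :=
  exists2 B, borel_haar_null R B & A `<=` B.

Definition almost_every (R : realType) (P : G -> Prop) :=
  haar_null R [set f | ~ P f].

Definition compact_catcher A :=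
  forall K, compact K -> exists g h : G, translate g K h `<=` A.

Definition compact_biter A :=
  forall K, compact K -> K !=set0 ->
    exists U, exists g h : G,
      [/\ open U, U `&` K !=set0 & translate g (U `&` K) h `<=` A].

End group_notions.

Record autQ := AutQ {
  autQ_fun :> rat -> rat ;
  autQ_bij : bijective autQ_fun ;
  autQ_mono : {mono autQ_fun : x y / (x < y)%R} }.

HB.instance Definition _ := gen_eqMixin autQ.
HB.instance Definition _ := gen_choiceMixin autQ.

Lemma autQ_ext (f g : autQ) : f =1 g -> f = g.
Proof.
case: f g => [f fb fm] [g gb gm] /= /funext fg; case: _ / fg gb gm => gb gm.
by congr AutQ; exact: Prop_irrelevance.
Qed.

Section autQ_group.

Lemma autQ_id_mono : {mono @idfun rat : x y / (x < y)%R}.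
Proof. by []. Qed.

Definition autQ_one := AutQ (inv_bij (fun=> erefl)) autQ_id_mono.

Lemma autQ_comp_mono (f g : autQ) : {mono f \o g : x y / (x < y)%R}.
Proof. by move=> x y; rewrite /= !autQ_mono. Qed.

Definition autQ_mul (f g : autQ) :=
  AutQ (bij_comp (autQ_bij f) (autQ_bij g)) (@autQ_comp_mono f g).

Lemma autQ_inv_subproof (f : autQ) :
  exists g : autQ, cancel f g /\ cancel g f.
Proof.
have [g fg gf] := autQ_bij f.
have gb : bijective g by exists f.
have gm : {mono g : x y / (x < y)%R}.
  by move=> x y; rewrite -[in RHS](gf x) -[in RHS](gf y) autQ_mono.
by exists (AutQ gb gm).
Qed.

Definition autQ_inv (f : autQ) : autQ := sval (cid (autQ_inv_subproof f)).

Lemma autQ_invK (f : autQ) : cancel f (autQ_inv f) /\ cancel (autQ_inv f) f.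
Proof. exact: svalP (cid (autQ_inv_subproof f)). Qed.

Lemma autQ_mulA : associative autQ_mul.
Proof. by move=> f g h; exact: autQ_ext. Qed.

Lemma autQ_mul1 : left_id autQ_one autQ_mul.
Proof. by move=> f; exact: autQ_ext. Qed.

Lemma autQ_mulr1 : right_id autQ_one autQ_mul.
Proof. by move=> f; exact: autQ_ext. Qed.

Lemma autQ_mulV : left_inverse autQ_one autQ_inv autQ_mul.
Proof. by move=> f; apply: autQ_ext => x; exact: (autQ_invK f).1. Qed.

Lemma autQ_mulrV : right_inverse autQ_one autQ_inv autQ_mul.
Proof. by move=> f; apply: autQ_ext => x; exact: (autQ_invK f).2. Qed.

HB.instance Definition _ := isGroup.Build autQ
  autQ_mulA autQ_mul1 autQ_mulr1 autQ_mulV autQ_mulrV.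

End autQ_group.

HB.instance Definition _ := isPointed.Build autQ 1.

(* Pointwise convergence with rat carrying the discrete topology, not the
   order topology of the rationals. *)
HB.instance Definition _ := Topological.copy autQ
  (initial_topology (autQ_fun : autQ -> {ptws rat -> discrete_topology rat})).

Lemma autQ_nbhs1 (f : autQ) (x : rat) : nbhs f [set g : autQ | g x = f x].
Proof.
have c := @initial_continuous _ _
  (autQ_fun : autQ -> {ptws rat -> discrete_topology rat}) f.
have /c := @proj_continuous rat (fun=> discrete_topology rat) x f [set f x]
  (discrete_set1 (f x : discrete_topology rat)).
by [].
Qed.

Lemma autQ_cvg (F : set_system autQ) (f : autQ) : Filter F ->
  (forall x, F [set g : autQ | g x = f x]) -> F --> f.
Proof.
move=> FF Ff A [_ [[C Cop <-] Cf CA]]; apply: filterS CA _.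
pose F' : set_system {ptws rat -> discrete_topology rat} := fmap autQ_fun F.
suff : F' --> (autQ_fun f : {ptws rat -> discrete_topology rat}).
  by apply; exact: open_nbhs_nbhs.
apply/cvg_sup => x B [_ [[D Dop <-] Df DB]].
apply: (@filterS _ F _ _ (autQ_fun @^-1` B)) (Ff x) => g gx; apply: DB.
by rewrite /= [autQ_fun g x]gx.
Qed.

Lemma autQ_mul_continuous :
  continuous (fun fg : autQ * autQ => fg.1 * fg.2 : autQ).
Proof.
move=> [f g]; apply: autQ_cvg => x /=.
exists ([set h : autQ | h (g x) = f (g x)], [set h : autQ | h x = g x]).
  by split; exact: autQ_nbhs1.
by move=> [h k] [/= hg kg]; rewrite /= kg.
Qed.

Lemma autQ_inv_continuous : continuous (fun f : autQ => f^-1 : autQ).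
Proof.
move=> f; have FF := @nbhs_filter autQ f.
apply: autQ_cvg => x /=.
apply: (@filterS _ (nbhs f) _ _ [set g : autQ | autQ_inv g x = autQ_inv f x])
  (autQ_nbhs1 f (autQ_inv f x)) => g /= gf.
by rewrite -[in LHS]((autQ_invK f).2 x) -gf (autQ_invK g).1.
Qed.

HB.instance Definition _ := isTopologicalGroup.Build autQ
  autQ_mul_continuous autQ_inv_continuous.

Definition expgz (G : groupType) (f : G) (n : int) : G :=
  match n with Posz k => f ^+ k | Negz k => f ^- k.+1 end.

Definition convQ (A : set rat) : set rat :=
  [set q | exists a b, [/\ A a, A b & (a <= q <= b)%R]].

Section orbitals.
Variable f : autQ.
Implicit Types O : set rat.

Definition orbital (r : rat) : set rat :=
  convQ [set expgz f n r | n in [set: int]].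

Definition orbitals : set (set rat) := range orbital.

Definition orbital_lt O1 O2 :=
  O1 <> O2 /\ exists p1 p2, [/\ O1 p1, O2 p2 & (p1 < p2)%R].

(* Only meaningful for O in orbitals: the sign of f p - p is then the same for
   all p in O, and the last case is that of a singleton fixed point. *)
Definition parity O : int :=
  if `[< forall p, O p -> (p < f p)%R >] then 1%R
  else if `[< forall p, O p -> (f p < p)%R >] then (-1)%R
  else 0%R.

Definition alternating_orbitals :=
  forall O1 O2, orbitals O1 -> orbitals O2 -> orbital_lt O1 O2 ->
    (parity O1 = 1%R /\ parity O2 = 1%R) \/
    (parity O1 = (-1)%R /\ parity O2 = (-1)%R) ->
    exists O3, [/\ orbitals O3, orbital_lt O1 O3, orbital_lt O3 O2 &
                   parity O3 <> parity O1].

Definition fixed_points : set rat := [set q | f q = q].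

Definition finitely_many_fixed_points := finite_set fixed_points.

End orbitals.

(* Main.v *)
Require Import Defs.
From HB Require Import structures.
From mathcomp Require Import all_boot all_order all_algebra.
From mathcomp Require Import all_classical all_reals all_analysis.
From mathcomp Require Import ring lra zify.

(** A conjugacy class of Aut(Q,<) is determined by the ordered set of orbitals
    with their parities.

    Classes with (1) and (2) are large.  Let K be a family of automorphisms with
    finite sets {k x | k in K} and {k^-1 x | k in K}, which fix the fixed points
    of f.  A back-and-forth construction yields one g such that every g k has the
    orbital structure of f: it produces a staircase of points (y, g y), every k
    in K labels the points by orbitals of f, and a label only changes on a step
    at which g crosses the graph of k^-1.  Condition (1) provides the crossings
    needed to visit a prescribed orbital, and prevents two orbitals of the same
    sign from being confused.  Compact sets are such families, which gives the
    compact biter and catcher properties; as every Borel probability measure is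
    tight, the classes are not Haar null.

    Conversely, f_t for t uniform in [0,1] is a random automorphism such that
    t |-> f_t is increasing, f_t' exceeds f_t for t < t' by a locally uniform gap
    off a finite set, and P(f_t x = y) is at most 2^-(min of the indices of x and
    y).  For fixed k, two adjacent orbitals of f_t k with the same sign mean that
    f_t touches k^-1 at an irrational point, which happens for at most one t per
    pair of rational bounds; and f_t k has almost surely finitely many fixed
    points by Borel-Cantelli. *)

Set Implicit Arguments.
Unset Strict Implicit.
Unset Printing Implicit Defensive.

Import Order.TTheory GRing.Theory Num.Theory numFieldNormedType.Exports.
Local Open Scope classical_set_scope.
Local Open Scope ring_scope.

(** * Orbitals *)

(** One [g] has to serve infinitely many [k] at once. This is possible because finitely many values
    turn infinitely many strict inequalities into a single one with a margin. Fixed points of [f]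
    cannot be produced in this way: all [k] must first be made to agree on them by a translation.
    Agreement at finitely many points is an open condition and cuts a set into countably many
    pieces, so (2) costs a restriction to an open set or to one piece of positive measure; without
    fixed points nothing is lost, whence the catcher property. In the converse the obstacle is the
    incompleteness of the rationals: two orbitals of equal sign may meet at an irrational cut, where
    no rational witnesses the contact. Pointwise inequalities are too weak there, and gaps uniform
    on rational intervals are carried along. The random family is built from shrinking bands of
    functions because every rational must get its image and its preimage at a finite stage, while
    the gaps have to survive these decisions. *)

Lemma autQ_lt (f : autQ) x y : (f x < f y) = (x < y).
Proof. exact: autQ_mono. Qed.

Lemma autQ_le (f : autQ) x y : (f x <= f y) = (x <= y).
Proof. by rewrite !leNgt autQ_lt. Qed.

Lemma autQ_inj (f : autQ) : injective f.
Proof. exact: bij_inj (autQ_bij f). Qed.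

Lemma autQ_mulE (f g : autQ) x : (f * g)%g x = f (g x).
Proof. by []. Qed.

Lemma autQ_invl (f : autQ) x : (f^-1)%g (f x) = x.
Proof. exact: (autQ_invK f).1. Qed.

Lemma autQ_invr (f : autQ) x : f ((f^-1)%g x) = x.
Proof. exact: (autQ_invK f).2. Qed.

Lemma autQ_invlt (f : autQ) x y : ((f^-1)%g x < y) = (x < f y).
Proof. by rewrite -(autQ_lt f) autQ_invr. Qed.

Lemma autQ_ltinv (f : autQ) x y : (x < (f^-1)%g y) = (f x < y).
Proof. by rewrite -(autQ_lt f) autQ_invr. Qed.

Lemma autQ_invle (f : autQ) x y : ((f^-1)%g x <= y) = (x <= f y).
Proof. by rewrite -(autQ_le f) autQ_invr. Qed.

Lemma autQ_leinv (f : autQ) x y : (x <= (f^-1)%g y) = (f x <= y).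
Proof. by rewrite -(autQ_le f) autQ_invr. Qed.

Lemma autQ_conjE (f g : autQ) x : (f ^ g)%g x = (g^-1)%g (f (g x)).
Proof. by []. Qed.

Lemma autQ_of_incr_surj (F : rat -> rat) :
  {homo F : x y / x < y} -> (forall y, exists x, F x = y) ->
  exists f : autQ, f =1 F.
Proof.
move=> Fh Fs; have Fm := le_mono Fh.
have Finj : injective F by exact: inc_inj.
have [G GK] := choice Fs.
have Fb : bijective F by exists G => // x; apply: Finj; rewrite GK.
by exists (AutQ Fb (leW_mono Fm)).
Qed.

Section integer_powers.
Implicit Types (f : autQ) (m n : int) (x y : rat).

Lemma expgzS f n x : expgz f (n + 1) x = f (expgz f n x).
Proof.
case: n => [n|[|n]].
- by rewrite -PoszD addn1 /= expgS.
- by rewrite /= expg1 autQ_invr.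
- have -> : Negz n.+1 + 1 = Negz n by lia.
  rewrite /= (expgSr _ n.+1) invgM autQ_mulE.
  by rewrite autQ_invr.
Qed.

Lemma expgzD f m n x : expgz f (m + n) x = expgz f m (expgz f n x).
Proof.
elim: m => [|m IH|m IH]; first by rewrite add0r.
  by rewrite -addn1 PoszD addrAC !expgzS IH.
apply: (@autQ_inj f); rewrite -!expgzS.
have -> : - m.+1%:Z + n + 1 = - m%:Z + n by lia.
by have -> : - m.+1%:Z + 1 = - m%:Z by lia.
Qed.

Lemma expgz0 f x : expgz f 0 x = x. Proof. by []. Qed.

Lemma expgz1 f x : expgz f 1 x = f x. Proof. by rewrite -[1]add0r expgzS. Qed.

Lemma expgzN f n x : expgz f (- n) (expgz f n x) = x.
Proof. by rewrite -expgzD addNr. Qed.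

Lemma expgzNr f n x : expgz f n (expgz f (- n) x) = x.
Proof. by rewrite -expgzD addrN. Qed.

Lemma expgzV f n x : expgz (f^-1)%g n x = expgz f (- n) x.
Proof.
elim: n => [//|n IH|n IH].
  rewrite -addn1 PoszD expgzS IH; apply: (@autQ_inj f).
  by rewrite autQ_invr -expgzS; congr (expgz f _ x); lia.
apply: (@autQ_inj (f^-1)%g); rewrite -expgzS.
have -> : - n.+1%:Z + 1 = - n%:Z by lia.
rewrite IH; apply: (@autQ_inj f).
by rewrite autQ_invr -expgzS; congr (expgz f _ x); lia.
Qed.

Lemma expgz_lt f n x y : (expgz f n x < expgz f n y) = (x < y).
Proof. exact: autQ_lt. Qed.

Lemma expgz_le f n x y : (expgz f n x <= expgz f n y) = (x <= y).
Proof. exact: autQ_le. Qed.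

Lemma expgz_incr f x : x < f x ->
  {mono (fun n => expgz f n x) : m n / m < n}.
Proof.
move=> xf.
have lt1 n : expgz f n x < expgz f (n + 1) x by rewrite expgzD expgz_lt expgz1.
have ltS n (d : nat) : expgz f n x < expgz f (n + d.+1%:Z) x.
  elim: d => [|d IH]; first exact: lt1.
  apply: lt_trans IH _.
  have -> : n + d.+2%:Z = n + d.+1%:Z + 1 by lia.
  exact: lt1.
apply: leW_mono; apply: le_mono => m n mn.
have -> : n = m + (`|n - m|.-1).+1%:Z by lia.
exact: ltS.
Qed.

Lemma expgz_conj f (g : autQ) n x :
  expgz (f ^ g)%g n x = (g^-1)%g (expgz f n (g x)).
Proof.
elim: n => [|n IH|n IH]; first by rewrite /= autQ_invl.
  by rewrite -addn1 PoszD !expgzS IH autQ_conjE autQ_invr.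
apply: (@autQ_inj (f ^ g)%g); rewrite -expgzS.
have -> : - n.+1%:Z + 1 = - n%:Z by lia.
rewrite IH autQ_conjE autQ_invr -expgzS.
by congr (_ (expgz f _ _)); lia.
Qed.

End integer_powers.

Section orbital_theory.
Implicit Types (f : autQ) (m n : int) (x y z : rat).

Lemma orbitalP f x y :
  orbital f x y <-> exists m n, expgz f m x <= y <= expgz f n x.
Proof.
split=> [[_ [_ [[m _ <-] [n _ <-] h]]]|[m [n h]]]; first by exists m, n.
by exists (expgz f m x), (expgz f n x).
Qed.

Lemma orbital_refl f x : orbital f x x.
Proof. by apply/orbitalP; exists 0, 0; rewrite expgz0 lexx. Qed.

Lemma orbital_sym f x y : orbital f x y -> orbital f y x.
Proof.
move=> /orbitalP[m [n /andP[h1 h2]]]; apply/orbitalP; exists (- n), (- m).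
by rewrite -(expgz_le f n) expgzNr h2 -(expgz_le f m x) expgzNr h1.
Qed.

Lemma orbital_trans f x y z : orbital f x y -> orbital f y z -> orbital f x z.
Proof.
move=> /orbitalP[m [n /andP[h1 h2]]] /orbitalP[m' [n' /andP[h3 h4]]].
apply/orbitalP; exists (m' + m), (n' + n); rewrite !expgzD.
by rewrite (le_trans _ h3) ?expgz_le // (le_trans h4) ?expgz_le.
Qed.

Lemma orbital_convex f x y z : orbital f x y -> x <= z <= y -> orbital f x z.
Proof.
move=> /orbitalP[m [n /andP[h1 h2]]] /andP[h3 h4].
by apply/orbitalP; exists 0, n; rewrite expgz0 h3 (le_trans h4).
Qed.

Lemma orbital_step f x : orbital f x (f x).
Proof. by apply/orbitalP; exists 1, 1; rewrite expgz1 lexx. Qed.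

Lemma orbital_expgz f n x : orbital f x (expgz f n x).
Proof. by apply/orbitalP; exists n, n; rewrite lexx. Qed.

Lemma orbital_eq f x y : orbital f x y -> orbital f x = orbital f y.
Proof.
move=> xy; apply/seteqP; split=> z; last exact: orbital_trans.
by apply: orbital_trans; exact: orbital_sym.
Qed.

Lemma orbitalV f x : orbital (f^-1)%g x = orbital f x.
Proof.
apply/seteqP; split=> y /orbitalP[m [n h]]; apply/orbitalP;
  exists (- m), (- n); first by rewrite -!expgzV.
by rewrite !expgzV !opprK.
Qed.

Lemma orbital_conj f (g : autQ) x y :
  orbital (f ^ g)%g x y <-> orbital f (g x) (g y).
Proof.
by split=> /orbitalP[m [n h]]; apply/orbitalP; exists m, n; move: h;
  rewrite !expgz_conj autQ_invle autQ_leinv.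
Qed.

Lemma orbital_period f x y : x < f x -> orbital f x y ->
  exists n, expgz f n x <= y < expgz f (n + 1) x.
Proof.
move=> xf /orbitalP[m [n /andP[h1 h2]]].
have h3 : y < expgz f (n + 1) x.
  by apply: le_lt_trans h2 _; rewrite (expgz_incr xf); lia.
have mn : m < n + 1 by rewrite -(expgz_incr xf) (le_lt_trans h1).
have [d dE] : exists d : nat, n + 1 = m + d%:Z by exists (absz (n + 1 - m)%R); lia.
rewrite {}dE in h3; elim: d => [|d IH] in m h1 h3 {mn} *.
  by move: h3; rewrite addr0 ltNge h1.
have [h|h] := ltP y (expgz f (m + 1) x); first by exists m; rewrite h1.
by apply: (IH (m + 1)) => //; move: h3; congr (_ < expgz f _ x); lia.
Qed.

Definition sgQ f x : rat := Num.sg (f x - x).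

Lemma sgQ1 f x : (sgQ f x == 1) = (x < f x).
Proof. by rewrite /sgQ sgr_cp0 subr_gt0. Qed.

Lemma sgQN1 f x : (sgQ f x == -1) = (f x < x).
Proof. by rewrite /sgQ sgr_cp0 subr_lt0. Qed.

Lemma sgQ0 f x : (sgQ f x == 0) = (f x == x).
Proof. by rewrite /sgQ sgr_eq0 subr_eq0. Qed.

Lemma sgQ_cases f x : [\/ sgQ f x = 1, sgQ f x = -1 | sgQ f x = 0].
Proof.
have [h|h|h] := ltgtP x (f x).
- by apply: Or31; apply/eqP; rewrite sgQ1.
- by apply: Or32; apply/eqP; rewrite sgQN1.
- by apply: Or33; apply/eqP; rewrite sgQ0 -h.
Qed.

Lemma sgQV f x : sgQ (f^-1)%g x = - sgQ f x.
Proof.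
case: (sgQ_cases f x) => h; rewrite h; move/eqP: h => h; apply/eqP.
- by rewrite sgQN1 autQ_invlt -sgQ1.
- by rewrite opprK sgQ1 autQ_ltinv -sgQN1.
- rewrite oppr0 sgQ0; move: h; rewrite sgQ0 => /eqP h.
  by rewrite -{1}h autQ_invl.
Qed.

Lemma orbital_gt f x y : x < f x -> orbital f x y -> y < f y.
Proof.
move=> xf /(orbital_period xf)[n /andP[h1 h2]].
by rewrite (lt_le_trans h2) // expgzS autQ_le.
Qed.

Lemma sgQ_orbital f x y : orbital f x y -> sgQ f x = sgQ f y.
Proof.
have gt g u v : orbital g u v -> sgQ g u = 1 -> sgQ g v = 1.
  by move=> uv /eqP; rewrite sgQ1 => h; apply/eqP; rewrite sgQ1 (orbital_gt h).
have lt g u v : orbital g u v -> sgQ g u = -1 -> sgQ g v = -1.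
  rewrite -orbitalV => uv h.
  by apply: oppr_inj; rewrite opprK -sgQV (gt _ _ _ uv) // sgQV h opprK.
move=> xy; have yx := orbital_sym xy.
case: (sgQ_cases f x) => hx; first by rewrite hx (gt _ _ _ xy hx).
  by rewrite hx (lt _ _ _ xy hx).
case: (sgQ_cases f y) => hy; last by rewrite hx hy.
- by have := gt _ _ _ yx hy; rewrite hx; lra.
- by have := lt _ _ _ yx hy; rewrite hx; lra.
Qed.

Lemma orbital_fix f x y : f x = x -> orbital f x y -> y = x.
Proof.
move=> fx; have e n : expgz f n x = x.
  elim: n => [//|n IH|n IH]; first by rewrite -addn1 PoszD expgzS IH.
  apply: (@autQ_inj f); rewrite -expgzS fx.
  by have -> : - n.+1%:Z + 1 = - n%:Z by lia.
by move=> /orbitalP[m [n]]; rewrite !e -eq_le => /eqP.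
Qed.

Lemma sgQ_conj f (g : autQ) x : sgQ (f ^ g)%g x = sgQ f (g x).
Proof.
case: (sgQ_cases f (g x)) => h; rewrite h; apply/eqP; move/eqP: h.
- by rewrite !sgQ1 autQ_conjE autQ_ltinv.
- by rewrite !sgQN1 autQ_conjE autQ_invlt.
- by rewrite !sgQ0 autQ_conjE => /eqP ->; rewrite autQ_invl.
Qed.

(* Two orbitals of equal nonzero parity are separated by a point of another
   parity; points replace orbitals because signs are constant on orbitals. *)
Definition alternatingQ f := forall x y, x < y -> ~ orbital f x y ->
  sgQ f x = sgQ f y -> sgQ f x <> 0 ->
  exists z, x < z < y /\ sgQ f z <> sgQ f x.

Lemma parity_orbital f x : (parity f (orbital f x))%:~R = sgQ f x.
Proof.
rewrite /parity; case: (sgQ_cases f x) => h; rewrite h.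
- rewrite asboolT // => p xp; rewrite -sgQ1 -(sgQ_orbital xp).
  by apply/eqP.
- rewrite asboolF; last first.
    move=> /(_ _ (orbital_refl f x)); rewrite -sgQ1 h.
    by move/eqP; lra.
  by rewrite asboolT // => p xp; rewrite -sgQN1 -(sgQ_orbital xp); apply/eqP.
- move/eqP: h; rewrite sgQ0 => /eqP h.
  by rewrite !asboolF // => /(_ _ (orbital_refl f x)); rewrite h ltxx.
Qed.

Lemma orbital_ltP f x y :
  orbital_lt (orbital f x) (orbital f y) <-> x < y /\ ~ orbital f x y.
Proof.
split=> [[ne [p [q [xp yq pq]]]]|[xy nxy]].
  have nxy : ~ orbital f x y by move/orbital_eq.
  split=> //; rewrite ltNge; apply/negP => yx; apply: nxy.
  have [py|yp] := leP p y.
    by apply: (orbital_trans xp); apply: (orbital_convex (orbital_sym xp)); rewrite py.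
  apply: (orbital_trans xp); apply: orbital_sym.
  by apply: (orbital_convex yq); rewrite !ltW.
split; last by exists x, y; split=> //; exact: orbital_refl.
by move=> e; apply: nxy; rewrite e; exact: orbital_refl.
Qed.

Lemma alternatingQP f : alternating_orbitals f <-> alternatingQ f.
Proof.
have par u v : parity f (orbital f u) = parity f (orbital f v) <->
    sgQ f u = sgQ f v.
  by rewrite -!parity_orbital; split=> [->//|/intr_inj].
split=> [H x y xy nxy e ne|H _ _ [x _ <-] [y _ <-] /orbital_ltP[xy nxy] par2].
  have [||||_ [[z _ <-] /orbital_ltP[xz _] /orbital_ltP[zy _] pz]] :=
    H (orbital f x) (orbital f y).
  - by exists x.
  - by exists y.
  - exact/orbital_ltP.
  - case: (sgQ_cases f x) => h; [left|right|by []];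
      by split; apply: (@intr_inj rat); rewrite parity_orbital -?e h.
  - by exists z; rewrite xz zy; split=> // /par.
have [e ne] : sgQ f x = sgQ f y /\ sgQ f x <> 0.
  by rewrite -!parity_orbital; case: par2 => -[-> ->]; split=> //; lra.
have [z [/andP[xz zy] ze]] := H _ _ xy nxy e ne.
exists (orbital f z); split; first by exists z.
- apply/orbital_ltP; split=> // /sgQ_orbital h; exact: ze.
- by apply/orbital_ltP; split=> // /sgQ_orbital h; apply: ze; rewrite h e.
- by move/par.
Qed.

Lemma alternatingQ_conj f (g : autQ) : alternatingQ f -> alternatingQ (f ^ g)%g.
Proof.
move=> H x y xy nxy; rewrite !sgQ_conj => e ne.
have [||z [/andP[h1 h2] h3]] := H (g x) (g y) _ _ e ne.
- by rewrite autQ_lt.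
- by move=> /orbital_conj.
exists ((g^-1)%g z).
by rewrite autQ_ltinv autQ_invlt h1 h2 sgQ_conj autQ_invr.
Qed.

Lemma finite_fixed_conj f (g : autQ) :
  finitely_many_fixed_points f -> finitely_many_fixed_points (f ^ g)%g.
Proof.
move=> /(finite_image (g^-1)%g); apply: sub_finite_set => x /= h.
exists (g x); last exact: autQ_invl.
by rewrite /fixed_points /= -[in RHS]h autQ_conjE autQ_invr.
Qed.

(** The choice is made from the set [orbital f x], so equal orbitals yield the same rational.
    Orbitals thereby get names that are compared by the order of the rationals. *)
Definition repQ f x : rat := xget 0 (orbital f x).

Lemma repQ_orbital f x : orbital f x (repQ f x).
Proof. by apply: xgetPex; exists x; exact: orbital_refl. Qed.

Lemma repQ_eq f x y : orbital f x y -> repQ f x = repQ f y.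
Proof. by rewrite /repQ => /orbital_eq ->. Qed.

Lemma repQK f x : repQ f (repQ f x) = repQ f x.
Proof. by rewrite -(repQ_eq (repQ_orbital f x)). Qed.

Lemma orbital_ltW f x y x' y' : ~ orbital f x y -> x < y ->
  orbital f x x' -> orbital f y y' -> x' < y'.
Proof.
move=> nxy xy xx' yy'; rewrite (orbital_eq xx') in nxy.
have : orbital_lt (orbital f x') (orbital f y').
  rewrite -(orbital_eq xx') -(orbital_eq yy'); apply/orbital_ltP; split=> //.
  by rewrite (orbital_eq xx').
by move=> /orbital_ltP[].
Qed.

End orbital_theory.

(** * Conjugacy criterion *)

Section conjugacy_criterion.

(* On a positive orbital the conjugating map is affine from one fundamental
   domain [b, h b[ to the other and is extended by equivariance. *)
Lemma conj_orbital_pos (h f : autQ) (b c : rat) : b < h b -> c < f c ->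
  exists phi : rat -> rat,
  [/\ forall x, orbital h b x -> orbital f c (phi x),
      forall x y, orbital h b x -> orbital h b y -> x < y -> phi x < phi y,
      forall z, orbital f c z -> exists2 x, orbital h b x & phi x = z
    & forall x, orbital h b x -> phi (h x) = f (phi x)].
Proof.
move=> hb fc.
have /choice[N NP] x : exists n, orbital h b x ->
    expgz h n b <= x < expgz h (n + 1) b.
  have [/(orbital_period hb)[n ?]|nx] := pselect (orbital h b x).
    by exists n.
  by exists 0.
have Nuniq x n : expgz h n b <= x < expgz h (n + 1) b -> N x = n.
  move=> /andP[h1 h2].
  have /NP/andP[h3 h4] : orbital h b x.
    by apply/orbitalP; exists n, (n + 1); rewrite h1 ltW.
  have a1 : n < N x + 1 by rewrite -(expgz_incr hb); exact: le_lt_trans h1 h4.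
  have a2 : N x < n + 1 by rewrite -(expgz_incr hb); exact: le_lt_trans h3 h2.
  lia.
pose r := (f c - c) / (h b - b).
have r_gt0 : 0 < r by rewrite divr_gt0 // subr_gt0.
pose A u := c + (u - b) * r.
have A_lt u v : u < v -> A u < A v.
  by move=> uv; rewrite ltrD2l ltr_pM2r // ltrD2r.
have Ab : A b = c by rewrite /A subrr mul0r addr0.
have Ahb : A (h b) = f c.
  rewrite /A /r mulrC divfK ?subr_eq0 ?gt_eqF //; lra.
pose phi x := expgz f (N x) (A (expgz h (- N x) x)).
have phi_bnd x : orbital h b x ->
    expgz f (N x) c <= phi x < expgz f (N x + 1) c.
  move=> /NP/andP[h1 h2].
  rewrite expgzD expgz_le expgz_lt expgz1 -Ahb -{1}Ab.
  have k1 : b <= expgz h (- N x) x by rewrite -(expgz_le h (N x)) expgzNr.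
  have k2 : expgz h (- N x) x < h b.
    by rewrite -(expgz_lt h (N x)) expgzNr -[h b]expgz1 -expgzD.
  rewrite A_lt // andbT; move: k1; rewrite le_eqVlt => /predU1P[<-//|k1].
  by rewrite ltW // A_lt.
exists phi; split.
- move=> x /phi_bnd /andP[h1 h2]; apply/orbitalP.
  by exists (N x), (N x + 1); rewrite h1 ltW.
- move=> x y bx by_ xy.
  have /andP[h1 h2] := NP _ bx; have /andP[h3 h4] := NP _ by_.
  have le_N : N x <= N y.
    have : N x < N y + 1.
      by rewrite -(expgz_incr hb); apply: le_lt_trans h1 (lt_trans xy h4).
    lia.
  have [e|ne] := eqVneq (N x) (N y).
    by rewrite /phi e expgz_lt A_lt // expgz_lt.
  have /andP[_ k1] := phi_bnd _ bx; have /andP[k2 _] := phi_bnd _ by_.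
  apply: lt_le_trans k1 (le_trans _ k2).
  have : N x + 1 <= N y by lia.
  rewrite le_eqVlt => /predU1P[->//|lt]; apply: ltW.
  by rewrite (expgz_incr fc).
- move=> z /(orbital_period fc)[n /andP[h1 h2]].
  pose u := b + (expgz f (- n) z - c) / r.
  have Au : A u = expgz f (- n) z.
    rewrite /A /u addrAC subrr add0r divfK ?gt_eqF //; lra.
  have k1 : c <= expgz f (- n) z by rewrite -(expgz_le f n) expgzNr.
  have k2 : expgz f (- n) z < f c.
    by rewrite -(expgz_lt f n) expgzNr -[f c]expgz1 -expgzD.
  have bu : b <= u by rewrite lerDl; apply: divr_ge0; rewrite ?subr_ge0 ?(ltW r_gt0).
  have uhb : u < h b.
    rewrite ltNge; apply/negP => hbu; move: k2; rewrite -Au -Ahb ltNge.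
    by move: hbu; rewrite le_eqVlt => /predU1P[->|/A_lt/ltW->]; rewrite ?lexx.
  have Nx : N (expgz h n u) = n.
    by apply: Nuniq; rewrite expgzD expgz_le expgz_lt expgz1 bu.
  exists (expgz h n u); last by rewrite /phi Nx expgzN Au expgzNr.
  apply/orbitalP; exists n, (n + 1).
  by rewrite expgzD !expgz_le expgz1 bu ltW.
- move=> x /NP/andP[h1 h2].
  have NS : N (h x) = N x + 1.
    by apply: Nuniq; rewrite expgzS autQ_le h1 expgzS autQ_lt.
  rewrite /phi NS [in expgz f _ _]addrC expgzD expgz1; congr (f (expgz f _ (A _))).
  by rewrite -[h x]expgz1 -expgzD; congr (expgz h _ x); lia.
Qed.

(** A negative orbital is a positive orbital of the inverse, with the same points, and an orbital of
    sign 0 is a single point. *)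
Lemma conj_orbital (h f : autQ) (b c : rat) : sgQ h b = sgQ f c ->
  exists phi : rat -> rat,
  [/\ forall x, orbital h b x -> orbital f c (phi x),
      forall x y, orbital h b x -> orbital h b y -> x < y -> phi x < phi y,
      forall z, orbital f c z -> exists2 x, orbital h b x & phi x = z
    & forall x, orbital h b x -> phi (h x) = f (phi x)].
Proof.
case: (sgQ_cases h b) => e; rewrite e => /esym/eqP; move/eqP: e.
- by rewrite !sgQ1; exact: conj_orbital_pos.
- rewrite !sgQN1 -autQ_ltinv => hb; rewrite -autQ_ltinv => fc.
  have [phi []] := conj_orbital_pos hb fc; rewrite !orbitalV => p1 p2 p3 p4.
  exists phi; split=> // x bx; apply: (@autQ_inj (f^-1)%g).
  rewrite -p4 ?autQ_invl //; apply: orbital_trans bx _; exact: orbital_step.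
- rewrite !sgQ0 => /eqP hb /eqP fc; exists (fun=> c); split.
  + by move=> x _; exact: orbital_refl.
  + by move=> x y /(orbital_fix hb)-> /(orbital_fix hb)->; rewrite ltxx.
  + move=> z /(orbital_fix fc)->; exists b => //; exact: orbital_refl.
  + by [].
Qed.

Variables (h f : autQ) (psi : rat -> rat).
Hypothesis alt_f : alternatingQ f.
Hypothesis psi_homo : forall x y, x <= y -> psi x <= psi y.
Hypothesis psi_rep : forall x, repQ f (psi x) = psi x.
Hypothesis psi_sg : forall x, sgQ h x = sgQ f (psi x).
Hypothesis psi_surj : forall z, exists x, psi x = repQ f z.
Hypothesis psi_orb : forall x y, psi x = psi y -> orbital h x y.

Let psi_lt x y : psi x < psi y -> x < y.
Proof. by rewrite !ltNge; apply: contra; exact: psi_homo. Qed.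

(** The labelling is not assumed constant on orbitals of [h]; alternation of [f] forces it. If the
    label rose inside one orbital, a label of another sign would lie in between and, by
    surjectivity, belong to a point squeezed between [x] and [y], that is, to a point of the same
    orbital with a different sign. *)
Let psi_const_lt x y : x < y -> orbital h x y -> psi x = psi y.
Proof.
move=> xy oxy; have := psi_homo (ltW xy); rewrite le_eqVlt.
move=> /predU1P[//|lt_psi].
have n_orb : ~ orbital f (psi x) (psi y).
  by move=> /repQ_eq; rewrite !psi_rep => e; rewrite e ltxx in lt_psi.
have esg : sgQ f (psi x) = sgQ f (psi y) by rewrite -!psi_sg (sgQ_orbital oxy).
have nsg : sgQ f (psi x) <> 0.
  rewrite -psi_sg => /eqP; rewrite sgQ0 => /eqP hx.
  by move: xy; rewrite (orbital_fix hx oxy) ltxx.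
have [z [/andP[h1 h2] h3]] := alt_f lt_psi n_orb esg nsg.
have [w wz] := psi_surj z.
have k1 : psi x < psi w.
  rewrite wz; apply: (orbital_ltW (f := f) _ h1 (orbital_refl _ _) (repQ_orbital _ _)).
  by move=> /sgQ_orbital e; exact: h3.
have k2 : psi w < psi y.
  rewrite wz; apply: (orbital_ltW (f := f) _ h2 (repQ_orbital _ _) (orbital_refl _ _)).
  by move=> /sgQ_orbital e; apply: h3; rewrite e esg.
have xw : orbital h x w.
  by apply: (orbital_convex oxy); rewrite !ltW //; exact: psi_lt.
exfalso; apply: h3; rewrite (sgQ_orbital (repQ_orbital f z)) -wz -!psi_sg.
by rewrite (sgQ_orbital xw).
Qed.

Let psi_const x y : orbital h x y -> psi x = psi y.
Proof.
have [xy|yx|->//] := ltgtP x y; first exact: psi_const_lt.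
by move=> /orbital_sym/(psi_const_lt yx)->.
Qed.

(** The labelling induces a sign-preserving order isomorphism from the orbitals of [h] to those of
    [f], and the conjugations of single orbitals are glued along it. Each is attached to the
    representative of its orbital, so that all points of an orbital use the same one. *)
Lemma conjugate_of_labelling : exists g : autQ, h = (f ^ g)%g.
Proof.
have /choice[phi phiP] b := @conj_orbital h f b (psi b) (psi_sg b).
pose G x := phi (repQ h x) x.
have psi_base x : psi (repQ h x) = psi x.
  by apply/esym/psi_const; exact: repQ_orbital.
have obase x : orbital h (repQ h x) x by apply: orbital_sym; exact: repQ_orbital.
have G_orb x : orbital f (psi x) (G x).
  by have [p1 _ _ _] := phiP (repQ h x); rewrite -psi_base; exact: p1.
have G_homo : {homo G : x y / x < y}.
  move=> x y xy; have [oxy|nxy] := pselect (orbital h x y).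
    rewrite /G -(repQ_eq oxy); have [_ p2 _ _] := phiP (repQ h x).
    by apply: p2 => //; exact: orbital_trans (obase x) oxy.
  have psi_ne : psi x <> psi y by move/psi_orb.
  apply: (orbital_ltW (f := f) (x := psi x) (y := psi y)) => //.
    by move=> /repQ_eq; rewrite !psi_rep.
  by rewrite lt_neqAle psi_homo ?ltW // andbT; apply/eqP.
have G_surj z : exists x, G x = z.
  have [x xz] := psi_surj z; have [_ _ p3 _] := phiP (repQ h x).
  have [|x' ox' <-] := p3 z.
    by rewrite psi_base xz; apply: orbital_sym; exact: repQ_orbital.
  exists x'; rewrite /G; congr (phi _ _).
  by rewrite -(repQ_eq ox') repQK.
have [g gE] := autQ_of_incr_surj G_homo G_surj.
exists g; apply: autQ_ext => x; apply: (@autQ_inj g).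
rewrite autQ_conjE autQ_invr !gE /G.
rewrite -(repQ_eq (orbital_step h x)).
by have [_ _ _ p4] := phiP (repQ h x); rewrite p4.
Qed.

End conjugacy_criterion.

(** * Staircases *)

(** This makes choices uniform in [k]: when [S] collects the values of all [k] at a point, the
    single [c] replaces a margin that would depend on [k]. *)
Lemma finite_pick_below (S : set rat) (u m : rat) : finite_set S -> u < m ->
  exists c, [/\ u < c, c < m & forall x, S x -> x < m -> x < c].
Proof.
move=> /finite_seqP[s ->]; elim: s u => [|x s IH] u um.
  by exists ((u + m) / 2); split=> //; lra.
have [xm|mx] := ltP x m.
  have [c [h1 h2 h3]] := IH (Num.max u x) ltac:(by rewrite gt_max um xm).
  move: h1; rewrite gt_max => /andP[h1 h1'].
  exists c; split=> // z /=; rewrite inE => /predU1P[->//|]; exact: h3.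
have [c [h1 h2 h3]] := IH u um; exists c; split=> // z /=.
rewrite inE => /predU1P[->|]; last exact: h3.
by rewrite ltNge mx.
Qed.

Lemma finite_pick_above (S : set rat) (m u : rat) : finite_set S -> m < u ->
  exists c, [/\ m < c, c < u & forall x, S x -> m < x -> c < x].
Proof.
move=> fS mu.
have [||c [h1 h2 h3]] := @finite_pick_below (-%R @` S) (- u) (- m).
- exact: finite_image.
- by rewrite ltrN2.
exists (- c); split; [lra|lra|] => x Sx mx.
have : - x < c by apply: h3; [exists x|rewrite ltrN2].
lra.
Qed.

Lemma seq_has_max (zs : seq rat) x0 : x0 \in zs ->
  exists2 M, M \in zs & forall x, x \in zs -> x <= M.
Proof.
elim: zs x0 => [//|z zs IH] x0 _.
case: zs IH => [_|z' zs IH].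
  by exists z; rewrite ?mem_head // => x; rewrite inE => /eqP->.
have [M M1 M2] := IH z' (mem_head _ _).
exists (Num.max z M).
  by rewrite /Num.max; case: ifP => _; rewrite inE ?M1 ?eqxx ?orbT.
by move=> x; rewrite inE le_max => /predU1P[->|/M2->]; rewrite ?lexx ?orbT.
Qed.

Lemma finite_pickle_lt M : finite_set [set y : rat | (pickle y < M)%N].
Proof.
apply: sub_finite_set (finite_image (odflt 0 \o unpickle) (finite_II M)).
by move=> y yM; exists (pickle y) => //=; rewrite pickleK.
Qed.

Section chains.
Variables (T : Type) (R : T -> T -> Prop).

Fixpoint chain x s := if s is y :: s' then R x y /\ chain y s' else True.

Lemma chain_cat x s1 s2 :
  chain x (s1 ++ s2) <-> chain x s1 /\ chain (last x s1) s2.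
Proof.
elim: s1 x => [|y s1 IH] x /=; first by split=> // -[].
by split=> [[h /IH[]]|[[h1 h2] h3]]; [|split=> //; apply/IH].
Qed.

Lemma chain_rcons x s y : chain x (rcons s y) <-> chain x s /\ R (last x s) y.
Proof.
by rewrite -cats1; split=> [/chain_cat[h1 [h2 _]]|[h1 h2]] //; apply/chain_cat.
Qed.

End chains.

Record gpoint (X : Type) := GPoint {
  gx : rat ;
  gy : rat ;
  glab : X -> rat }.
HB.instance Definition _ X := gen_eqMixin (gpoint X).

Section staircase_defs.
Variables (X : Type) (a : X -> rat -> rat) (s : rat -> bool).
Implicit Types (t : gpoint X) (K E : set X).

(* A point [t] prescribes g (gx t) = gy t, and [a k] is a permutation of the
   rationals.  The interval between gy t and its preimage under the map
   g o a k is contained in one orbital of that map; [linked] says that the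
   intervals of t and t' overlap, [glab t k] names the orbital, and [s] gives
   its direction. *)
Definition linked k t t' := gx t' <= a k (gy t) \/ a k (gy t') <= gx t.

Definition gsign k t :=
  if s (glab t k) then gx t < a k (gy t) else a k (gy t) < gx t.

Definition ggood (P : set rat) K t :=
  forall k, K k -> P (glab t k) /\ gsign k t.

(** The pair [A], [B] is chosen before [k]: all labels that change on a step make the same change.
    The indices not linked there then carry constant labels at both ends, which reduces the
    refinement of a step to the case of two [gconst] points. *)
Definition gstep K t t' :=
  [/\ gx t < gx t', gy t < gy t' &
      exists A B, forall k, K k ->
        (glab t k = glab t' k /\ linked k t t') \/
        [/\ glab t k = A, glab t' k = B, A < B & s A != s B]].

End staircase_defs.

Arguments GPoint {X}.

Section staircase.
Variables (X : Type) (a b : X -> rat -> rat) (s : rat -> bool) (P : set rat).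
Hypothesis a_lt : forall k x y, (a k x < a k y) = (x < y).
Hypothesis ab : forall k x, a k (b k x) = x.
Implicit Types (t : gpoint X) (E : set X).

Lemma perm_le k x y : (a k x <= a k y) = (x <= y).
Proof. by rewrite !leNgt a_lt. Qed.

Local Notation gstep := (gstep a s).
Local Notation ggood := (ggood a s P).
Local Notation linked := (linked a).

Lemma gstep_between K t l t' : chain (gstep K) t (rcons l t') ->
  [/\ gx t < gx t', gy t < gy t' & forall p, p \in l ->
      [/\ gx t < gx p, gx p < gx t', gy t < gy p & gy p < gy t']].
Proof.
elim: l t => [|q l IH] t /=; first by move=> [[h1 h2 _] _]; split.
move=> [[h1 h2 _] /IH[h3 h4 h5]]; split.
- exact: lt_trans h3.
- exact: lt_trans h4.
move=> p; rewrite inE => /predU1P[->//|/h5[k1 k2 k3 k4]].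
by split=> //; [exact: lt_trans k1|exact: lt_trans k3].
Qed.

(* Inserting points between t and t' only matters for the indices E which are
   not yet linked there. *)
Lemma chain_extend_labels (K E : set X) t t' t0 t0' l : E `<=` K ->
  (gx t = gx t0 /\ gy t = gy t0 /\ forall k, E k -> glab t k = glab t0 k) ->
  (gx t' = gx t0' /\ gy t' = gy t0' /\ forall k, E k -> glab t' k = glab t0' k) ->
  (forall k, K k -> ~ E k -> glab t k = glab t' k /\ linked k t t') ->
  ggood K t ->
  chain (gstep E) t0 (rcons l t0') -> (forall p, p \in l -> ggood E p) ->
  exists f : gpoint X -> gpoint X,
  [/\ chain (gstep K) t (rcons (map f l) t'),
      forall p, p \in l -> ggood K (f p),
      forall p, gx (f p) = gx p,
      forall p, gy (f p) = gy p &
      forall p k, E k -> glab (f p) k = glab p k].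
Proof.
move=> EK [xt [yt lt]] [xt' [yt' lt']] notE gt ch gl.
pose f p := GPoint (gx p) (gy p)
  (fun k => if `[< E k >] then glab p k else glab t k).
have fE p k : E k -> glab (f p) k = glab p k by move=> Ek; rewrite /f /= asboolT.
have fN p k : ~ E k -> glab (f p) k = glab t k.
  by move=> Ek; rewrite /f /= asboolF.
have [xx yy btw] := gstep_between ch.
exists f; split=> // [|p pl k Kk].
  have step p p' q q' : gx p' = gx p -> gy p' = gy p ->
      (forall k, E k -> glab p' k = glab p k) ->
      (forall k, K k -> ~ E k -> glab p' k = glab t k) ->
      gx q' = gx q -> gy q' = gy q ->
      (forall k, E k -> glab q' k = glab q k) ->
      (forall k, K k -> ~ E k -> glab q' k = glab t k) ->
      gy t <= gy p -> gx t <= gx p -> gx q <= gx t' -> gy q <= gy t' ->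
      gstep E p q -> gstep K p' q'.
    move=> px py pE pN qx qy qE qN h1 h2 h3 h4 [k1 k2 [A [B AB]]].
    split; [by rewrite px qx|by rewrite py qy|exists A, B => k Kk].
    have [Ek|nEk] := pselect (E k).
      by rewrite pE // qE // /linked px py qx qy; exact: AB.
    left; rewrite pN // qN //; split=> //.
    have [_] := notE k Kk nEk; rewrite /linked px py qx qy => -[h|h].
      by left; apply: le_trans h3 (le_trans h _); rewrite perm_le.
    by right; apply: le_trans (le_trans h h2); rewrite perm_le.
  have gen l' u0 u : gx u = gx u0 -> gy u = gy u0 ->
      (forall k, E k -> glab u k = glab u0 k) ->
      (forall k, K k -> ~ E k -> glab u k = glab t k) ->
      gx t <= gx u0 -> gy t <= gy u0 ->
      (forall p, p \in l' -> [/\ gx t <= gx p, gx p <= gx t', gy t <= gy p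
                               & gy p <= gy t']) ->
      chain (gstep E) u0 (rcons l' t0') ->
      chain (gstep K) u (rcons (map f l') t').
    elim: l' u0 u => [|q l' IH] u0 u xu yu lu uN gxt gyt btw' /=.
      move=> [h _]; split=> //; apply: (step u0 u t0' t') => //.
      - by move=> k Kk nEk; have [-> _] := notE k Kk nEk.
      - by rewrite xt'.
      - by rewrite yt'.
    move=> [h ch'].
    have [b1 b2 b3 b4] := btw' q (mem_head _ _).
    split.
      by apply: (step u0 u q (f q)) => //; [exact: fE|move=> k _; exact: fN].
    apply: (IH q (f q)) => //; [exact: fE|by move=> k _; exact: fN|].
    by move=> p pl; apply: btw'; rewrite inE pl orbT.
  apply: (gen l t0 t) => //; rewrite ?xt ?yt //.
  by move=> p /btw[? ? ? ?]; rewrite xt' yt' !ltW.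
have [Ek|nEk] := pselect (E k).
  by have [h1 h2] := gl p pl k Ek; rewrite /gsign fE.
have [e lk] := notE k Kk nEk; have [h1 h2] := gt k Kk.
(* The link fixes the sign all along the step: a link in the direction of the sign at [t] passes to
   [p] by monotonicity, and a link in the other direction contradicts that sign. *)
rewrite /gsign fN //; split=> //; move: h2; rewrite /gsign.
have [b1 b2 b3 b4] := btw p pl.
case: (s _) => h2; case: lk => lk /=.
- apply: lt_trans b2 _; rewrite -xt'; apply: le_lt_trans lk _.
  by rewrite a_lt yt.
- have := le_lt_trans lk h2; rewrite a_lt yt yt'.
  by rewrite ltNge ltW // (lt_trans b3).
- by have := le_lt_trans lk h2; rewrite xt xt' ltNge ltW.
- apply: lt_trans b1; rewrite -xt; apply: lt_le_trans lk.
  by rewrite a_lt yt'.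
Qed.


Variable K : set X.
Hypothesis finA : forall x, finite_set [set a k x | k in K].
Hypothesis finB : forall x, finite_set [set b k x | k in K].

Let invlt k x y : (b k x < y) = (x < a k y).
Proof. by rewrite -(a_lt k) ab. Qed.

Let ltinv k x y : (x < b k y) = (a k x < y).
Proof. by rewrite -(a_lt k) ab. Qed.

Lemma pickA_below v u m : u < m ->
  exists c, [/\ u < c, c < m & forall k, K k -> a k v < m -> a k v < c].
Proof.
move=> /(finite_pick_below (finA v))[c [h1 h2 h3]].
by exists c; split=> // k Kk; apply: h3; exists k.
Qed.

Lemma pickA_above v m u : m < u ->
  exists c, [/\ m < c, c < u & forall k, K k -> m < a k v -> c < a k v].
Proof.
move=> /(finite_pick_above (finA v))[c [h1 h2 h3]].
by exists c; split=> // k Kk; apply: h3; exists k.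
Qed.

Lemma pickB_below y u m : u < m ->
  exists c, [/\ u < c, c < m & forall k, K k -> y < a k m -> y < a k c].
Proof.
move=> /(finite_pick_below (finB y))[c [h1 h2 h3]].
by exists c; split=> // k Kk; rewrite -!invlt; apply: h3; exists k.
Qed.

Lemma pickB_above y m u : m < u ->
  exists c, [/\ m < c, c < u & forall k, K k -> a k m < y -> a k c < y].
Proof.
move=> /(finite_pick_above (finB y))[c [h1 h2 h3]].
by exists c; split=> // k Kk; rewrite -!ltinv; apply: h3; exists k.
Qed.

Lemma midpointQ (x y : rat) : x < y -> exists z, x < z /\ z < y.
Proof. by move=> xy; exists ((x + y) / 2); lra. Qed.

Definition gconst (y v c : rat) : gpoint X := GPoint y v (fun=> c).

(** Points with equal labels need not be linked, and one intermediate point repairs this. For a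
    positive label it is taken near the corner (y, v'): barely to the right of [y] it stays below
    all [a k v], and barely below [v'] it keeps all [a k v1] above [y']. For a negative label it is
    taken near (y', v). *)
Lemma link_mid E A y v y' v' : E `<=` K -> P A -> y < y' -> v < v' ->
  ggood E (gconst y v A) -> ggood E (gconst y' v' A) ->
  exists y1 v1, [/\ y < y1 < y' /\ v < v1 < v', ggood E (gconst y1 v1 A),
    gstep E (gconst y v A) (gconst y1 v1 A) &
    gstep E (gconst y1 v1 A) (gconst y' v' A)].
Proof.
move=> EK PA yy vv g1 g2.
have [sA|sA] := boolP (s A).
  have [y1 [h1 h2 h3]] := pickA_above v yy.
  have [v1 [h4 h5 h6]] := pickB_below y' vv.
  have k1 k : E k -> y1 < a k v.
    move=> Ek; apply: h3; first exact: EK.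
    by have [_] := g1 k Ek; rewrite /gsign /= sA.
  have k2 k : E k -> y' < a k v1.
    move=> Ek; apply: h6; first exact: EK.
    by have [_] := g2 k Ek; rewrite /gsign /= sA.
  exists y1, v1; split; first by rewrite h1 h2 h4 h5.
  - move=> k Ek; split=> //; rewrite /gsign /= sA.
    exact: lt_trans h2 (k2 k Ek).
  - split=> //; exists A, A => k Ek; left; split=> //; left => /=.
    by rewrite ltW // k1.
  - split=> //; exists A, A => k Ek; left; split=> //; left => /=.
    by rewrite ltW // k2.
have [v1 [h4 h5 h6]] := pickB_above y vv.
have [y1 [h1 h2 h3]] := pickA_below v' yy.
have k1 k : E k -> a k v1 < y.
  move=> Ek; apply: h6; first exact: EK.
  by have [_] := g1 k Ek; rewrite /gsign /= (negbTE sA).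
have k2 k : E k -> a k v' < y1.
  move=> Ek; apply: h3; first exact: EK.
  by have [_] := g2 k Ek; rewrite /gsign /= (negbTE sA).
exists y1, v1; split; first by rewrite h1 h2 h4 h5.
- move=> k Ek; split=> //; rewrite /gsign /= (negbTE sA).
  exact: lt_trans (k1 k Ek) h1.
- split=> //; exists A, A => k Ek; left; split=> //; right => /=.
  by rewrite ltW // k1.
- split=> //; exists A, A => k Ek; left; split=> //; right => /=.
  by rewrite ltW // k2.
Qed.

Section downward_crossing.
Variables (E : set X) (A B : rat).
Hypotheses (EK : E `<=` K) (PA : P A) (PB : P B) (AB : A < B).
Hypotheses (sA : s A) (sB : s B = false).
Variables (y v y' v' : rat).
Hypotheses (yy : y < y') (vv : v < v').
Hypothesis lo : forall k, E k -> y < a k v.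
Hypothesis hi : forall k, E k -> a k v' < y'.

Let goodA D x z : (forall k, D k -> x < a k z) -> ggood D (gconst x z A).
Proof. by move=> h k Ek; split=> //; rewrite /gsign /= sA; exact: h. Qed.

Let goodB D x z : (forall k, D k -> a k z < x) -> ggood D (gconst x z B).
Proof. by move=> h k Ek; split=> //; rewrite /gsign /= sB; exact: h. Qed.

(** Constructions between the two ends first move them inwards, to gain room or to put an end at a
    prescribed height; [link_mid] ties the new ends to the old ones. The new ends are kept in the
    list because they may be the requested points. *)
Lemma down_bracket y1 v1 y2 v2 l : y < y1 -> v < v1 -> y2 < y' -> v2 < v' ->
  (forall k, E k -> y1 < a k v1) -> (forall k, E k -> a k v2 < y2) ->
  chain (gstep E) (gconst y1 v1 A) (rcons l (gconst y2 v2 B)) ->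
  (forall p, p \in l -> ggood E p) ->
  exists l', [/\ chain (gstep E) (gconst y v A) (rcons l' (gconst y' v' B)),
    forall p, p \in l' -> ggood E p,
    {subset l <= l'}, gconst y1 v1 A \in l' & gconst y2 v2 B \in l'].
Proof.
move=> y01 v01 y02 v02 h1 h2 ch gl.
have [x1 [z1 [_ m1 m2 m3]]] := link_mid EK PA y01 v01 (goodA lo) (goodA h1).
have [x2 [z2 [_ n1 n2 n3]]] := link_mid EK PB y02 v02 (goodB h2) (goodB hi).
exists (gconst x1 z1 A :: gconst y1 v1 A ::
  rcons (rcons l (gconst y2 v2 B)) (gconst x2 z2 B)); split.
- by do 2!(split=> //); apply/chain_rcons; rewrite last_rcons; split=> //;
    apply/chain_rcons; rewrite last_rcons; split.
- move=> p; rewrite !(inE, mem_rcons).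
  by move=> /predU1P[->|/predU1P[->|/predU1P[->|/predU1P[->|/gl]]]] //;
    [exact: goodA|exact: goodB].
- by move=> p pl; rewrite !(inE, mem_rcons) pl !orbT.
- by rewrite !inE eqxx orbT.
- by rewrite !(inE, mem_rcons) eqxx !orbT.
Qed.

Lemma down_insert Y V : y < Y < y' -> v < V < v' ->
  (forall k, E k -> a k V != Y) ->
  exists l, [/\ chain (gstep E) (gconst y v A) (rcons l (gconst y' v' B)),
    forall p, p \in l -> ggood E p,
    exists2 p, p \in l & gx p = Y & exists2 p, p \in l & gy p = V].
Proof.
move=> /andP[yY Yy] /andP[vV Vv] nYV.
have loV k : E k -> y < a k V.
  by move=> Ek; apply: lt_trans (lo Ek) _; rewrite a_lt.
have [c0 [c01 c02 c03]] := pickA_above V yY.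
have [vs [vs1 vs2 vs3]] := pickB_above Y Vv.
have hivs k : E k -> a k vs < y'.
  by move=> Ek; apply: lt_trans (hi Ek); rewrite a_lt.
have [c1 [c11 c12 c13]] := pickA_below vs Yy.
have [u [u1 u2]] := midpointQ vs1.
(* Each index changes from [A] to [B] once, before or after [Y] according to the side of [Y] on
   which [a k V] lies. The height [u] is kept below [vs], so that an index below [Y] at height [V]
   is still below it at height [u]. The height [V] itself is that of the left inner end. *)
pose p := GPoint Y u (fun k => if a k V < Y then B else A).
have c0V k : E k -> c0 < a k V by move=> Ek; apply: c03 (loV _ Ek); exact: EK.
have c1v k : E k -> a k vs < c1 by move=> Ek; apply: c13 (hivs _ Ek); exact: EK.
have [||||||||l [l1 l2 l3 l4 l5]] := @down_bracket c0 V c1 vs [:: p] => //.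
- rewrite /=; split; [split=> //|split=> //; split=> //].
  + exists A, B => k Ek /=; case: ltP => kV; [right|left]; rewrite ?sA ?sB //.
    by split=> //; left.
  + exists A, B => k Ek /=; case: ltP => kV; [left|right]; rewrite ?sA ?sB //.
    by split=> //; right; rewrite /= ltW // vs3 //; exact: EK.
- move=> q; rewrite inE => /eqP-> k Ek; split; first by rewrite /p /=; case: ifP.
  rewrite /gsign /p /=; case: ltP => kV; rewrite ?sA ?sB.
    apply: lt_trans (_ : a k vs < Y); first by rewrite a_lt.
    by rewrite vs3 //; exact: EK.
  by apply: le_lt_trans kV _; rewrite a_lt.
exists l; split=> //; last by exists (gconst c0 V A).
by exists p => //; rewrite l3 // mem_head.
Qed.

Variables O1 O2 : rat.
Hypotheses (P1 : P O1) (P2 : P O2) (AO1 : A < O1) (O12 : O1 < O2) (O2B : O2 < B).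
Hypotheses (sO1 : s O1 = false) (sO2 : s O2).

(* The indices are grouped by their value at height V.  The rightmost group is
   served first, with the heights closest to V left for the other groups. *)
Lemma down_visit_groups V n (F : set X) (c0 d vs : rat) (ys : seq rat) :
  F `<=` K -> (size ys <= n)%N -> (forall k, F k -> a k V \in ys) ->
  V < vs -> c0 < d -> (forall k, F k -> c0 < a k V) ->
  (forall k, F k -> a k V < d) ->
  exists u w l, [/\ V < u /\ w < vs, forall k, F k -> a k w < d,
    chain (gstep F) (gconst c0 u A) (rcons l (gconst d w B)),
    forall p, p \in l -> ggood F p &
    forall k, F k -> (exists2 p, p \in l & glab p k = O1) /\
                     (exists2 p, p \in l & glab p k = O2)].
Proof.
have base F' c0' d' vs' : (forall k, ~ F' k) -> V < vs' -> c0' < d' ->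
    exists u w l, [/\ V < u /\ w < vs', forall k, F' k -> a k w < d',
      chain (gstep F') (gconst c0' u A) (rcons l (gconst d' w B)),
      forall p, p \in l -> ggood F' p &
      forall k, F' k -> (exists2 p, p \in l & glab p k = O1) /\
                        (exists2 p, p \in l & glab p k = O2)].
  move=> nF Vvs c0d.
  have [u [u1 u2]] := midpointQ Vvs; have [w [w1 w2]] := midpointQ u2.
  exists u, w, [::]; split.
  - by [].
  - by move=> k /nF.
  - by split=> //; split=> //; exists A, B => k /nF.
  - by [].
  - by move=> k /nF.
elim: n F c0 d vs ys => [|n IH] F c0 d vs ys FK sz Fys Vvs c0d Fc0 Fd.
  by apply: base => // k /Fys; move: sz; rewrite leqn0 => /nilP->.
have [[k0 Fk0]|nF] := pselect (exists k, F k); last first.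
  by apply: base => // k Fk; apply: nF; exists k.
have [yN [[kN FkN kNE] ymax]] : exists yN, (exists2 k, F k & a k V = yN) /\
    forall k, F k -> a k V <= yN.
  have [|M MV Mmax] := @seq_has_max
      [seq x <- ys | `[< exists2 k, F k & a k V = x >]] (a k0 V).
    by rewrite mem_filter Fys // andbT; apply/asboolP; exists k0.
  exists M; split; first by move: MV; rewrite mem_filter => /andP[/asboolP].
  move=> k Fk; apply: Mmax; rewrite mem_filter Fys // andbT.
  by apply/asboolP; exists k.
have c0N : c0 < yN by rewrite -kNE; exact: Fc0.
(* [sp] separates the last group from the others at height [V], and [w] is so low that the other
   groups stay to the left of [sp] up to height [w]. They have reached label [B] before the last
   group changes its label. *)
have [sp [sp1 sp2 sp3]] := pickA_below V c0N.
have [w0 [w01 w02 w03]] := pickB_above sp Vvs.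
have [w [w1 w2 w3]] := pickB_above d w01.
have [u' [u1 u2]] := midpointQ w1.
have yNd : yN < d by rewrite -kNE; exact: Fd.
(* The zigzag of the last group is chosen backwards. [c'] is so close to [yN] that the group lies to
   its right at height [u'], which gives the positive label [O2]; [uN] is so close to [V] that the
   group lies to the left of [c] at height [uN], which gives the negative label [O1]. *)
have [c' [c1 c2 c3]] := pickA_above u' yNd.
have [c [c4 c5]] := midpointQ c1.
have [uN [uN1 uN2 uN3]] := pickB_above c u1.
pose F1 : set X := [set k | F k /\ a k V < yN].
have F1K : F1 `<=` K by move=> k [/FK].
have F1F : F1 `<=` F by move=> k [].
have [|||||||u0 [wv [l [[l1 l2] l3 l4 l5 l6]]]] :=
  IH F1 c0 sp uN [seq x <- ys | x != yN] => //.
- rewrite size_filter -ltnS; apply: leq_trans sz.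
  rewrite -(count_predC (fun x => x != yN) ys) -addn1 leq_add2l -has_count.
  by apply/hasP; exists yN; rewrite /= ?negbK // -kNE; exact: Fys.
- by move=> k [Fk kV]; rewrite mem_filter Fys // lt_eqF.
- by move=> k [/Fc0].
- by move=> k [Fk kV]; apply: sp3 => //; exact: FK.
have notF1 k : F k -> ~ F1 k -> a k V = yN.
  move=> Fk nF1; apply/eqP; rewrite eq_le ymax // leNgt.
  by apply/negP => kV; apply: nF1.
have F1w k : F1 k -> a k w < sp.
  move=> [Fk kV]; apply: lt_trans (_ : a k w0 < sp); first by rewrite a_lt.
  by apply: w03; [exact: FK|apply: sp3 => //; exact: FK].
have lw : wv < w by rewrite (lt_trans l2) // (lt_trans uN2).
have Vwv : V < wv.
  by have [_ /= h _] := gstep_between l4; exact: lt_trans l1 h.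
pose lab z := fun k => if `[< F1 k >] then B else z.
have lab1 z k : F1 k -> lab z k = B by move=> h; rewrite /lab asboolT.
have labN z k : ~ F1 k -> lab z k = z by move=> h; rewrite /lab asboolF.
pose q0 := GPoint sp wv (lab A).
pose q1 := GPoint c uN (lab O1).
pose q2 := GPoint c' u' (lab O2).
have [||||f [f1 f2 f3 f4 f5]] := @chain_extend_labels F F1 (gconst c0 u0 A) q0
    (gconst c0 u0 A) (gconst sp wv B) l F1F _ _ _ _ l4 l5 => //.
- by split=> //; split=> // k F1k; rewrite /q0 /= lab1.
- move=> k Fk nF1; rewrite /q0 /= labN //; split=> //; left => /=.
  by rewrite ltW // (lt_trans sp2) // -(notF1 _ Fk nF1) a_lt.
- by apply: goodA => k Fk; rewrite (lt_trans (Fc0 _ Fk)) // a_lt.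
exists u0, w, (rcons (rcons (rcons (map f l) q0) q1) q2); split.
- by split=> //; exact: lt_trans w02.
- by move=> k Fk; apply: w3; [exact: FK|exact: Fd].
- apply/chain_rcons; rewrite last_rcons; split; last first.
    split=> //=; exists O2, B => k Fk.
    have [F1k|nF1] := pselect (F1 k).
      left; rewrite lab1 //; split=> //; right => /=.
      by rewrite ltW // (lt_trans (F1w _ F1k)) // (lt_trans sp2) // (lt_trans c4).
    by right; rewrite labN // O2B sO2 sB.
  apply/chain_rcons; rewrite last_rcons; split; last first.
    split=> //=; exists O1, O2 => k Fk.
    have [F1k|nF1] := pselect (F1 k).
      left; rewrite !lab1 //; split=> //; right => /=.
      rewrite ltW // (lt_trans _ (lt_trans (F1w _ F1k) _)) ?a_lt //.
      exact: lt_trans sp2 c4.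
    by right; rewrite !labN // O12 sO1 sO2.
  apply/chain_rcons; rewrite last_rcons; split=> //.
  split=> //=; first exact: lt_trans sp2 c4.
  exists A, O1 => k Fk.
  have [F1k|nF1] := pselect (F1 k).
    left; rewrite !lab1 //; split=> //; right => /=.
    rewrite ltW // (lt_trans _ (F1w _ F1k)) // a_lt.
    exact: lt_trans uN2 u2.
  by right; rewrite !labN // AO1 sA sO1.
- move=> p; rewrite !(inE, mem_rcons) => /or4P[/eqP->|/eqP->|/eqP->|]; last first.
  + by move=> /mapP[p' p'l ->]; exact: f2.
  + move=> k Fk; rewrite /gsign /q0 /=; have [F1k|nF1] := pselect (F1 k).
      by rewrite lab1 // sB l3.
    by rewrite labN // sA (lt_trans sp2) // -(notF1 _ Fk nF1) a_lt.
  + move=> k Fk; rewrite /gsign /q1 /=; have [F1k|nF1] := pselect (F1 k).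
      rewrite lab1 // sB; split=> //.
      rewrite (lt_trans _ (lt_trans (F1w _ F1k) _)) ?a_lt //.
        exact: lt_trans uN2 u2.
      exact: lt_trans sp2 c4.
    rewrite labN // sO1; split=> //; apply: uN3; first exact: FK.
    by rewrite (notF1 _ Fk nF1).
  + move=> k Fk; rewrite /gsign /q2 /=; have [F1k|nF1] := pselect (F1 k).
      rewrite lab1 // sB; split=> //.
      rewrite (lt_trans _ (lt_trans (F1w _ F1k) _)) ?a_lt //.
      exact: lt_trans sp2 c1.
    rewrite labN // sO2; split=> //; apply: c3; first exact: FK.
    by rewrite -(notF1 _ Fk nF1) a_lt.
- move=> k Fk; have [F1k|nF1] := pselect (F1 k).
    have [[p pl pO] [p' p'l p'O]] := l6 k F1k; split.
      exists (f p); last by rewrite f5.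
      by rewrite !(inE, mem_rcons) map_f ?orbT.
    exists (f p'); last by rewrite f5.
    by rewrite !(inE, mem_rcons) map_f ?orbT.
  split; [exists q1|exists q2]; rewrite ?mem_rcons ?inE ?eqxx ?orbT ?labN //.
  + by rewrite mem_rcons inE eqxx !orbT.
  + by rewrite /q1 /= labN.
  + by rewrite /q2 /= labN.
Qed.

Lemma down_visit :
  exists l, [/\ chain (gstep E) (gconst y v A) (rcons l (gconst y' v' B)),
    forall p, p \in l -> ggood E p &
    forall k, E k -> (exists2 p, p \in l & glab p k = O1) /\
                     (exists2 p, p \in l & glab p k = O2)].
Proof.
have [V [vV Vv]] := midpointQ vv.
have [m [ym my]] := midpointQ yy.
have [c0 [c01 c02 c03]] := pickA_above V ym.
have [d [d1 d2 d3]] := pickA_below V my.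
have loV k : E k -> c0 < a k V.
  move=> Ek; apply: c03; first exact: EK.
  by apply: lt_trans (lo Ek) _; rewrite a_lt.
have hiV k : E k -> a k V < d.
  move=> Ek; apply: d3; first exact: EK.
  by apply: lt_trans (hi Ek); rewrite a_lt.
have /finite_seqP[ys ysE] := finA V.
have [|||||||u [w [l [[l1 l2] l3 l4 l5 l6]]]] :=
  @down_visit_groups V (size ys) E c0 d v' ys => //.
- move=> k Ek; have : [set a k V | k in K] (a k V) by exists k => //; exact: EK.
  by rewrite ysE.
- exact: lt_trans c02 d1.
have [||||||||l' [m1 m2 m3 m4 m5]] := @down_bracket c0 u d w l => //.
- exact: lt_trans vV l1.
- by move=> k Ek; rewrite (lt_trans (loV _ Ek)) // a_lt.
exists l'; split=> // k Ek; have [[p pl pO] [q ql qO]] := l6 k Ek.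
by split; [exists p|exists q]; rewrite ?m3.
Qed.

End downward_crossing.

End staircase.

(** * Refinement of a single step of a staircase *)

Lemma finite_avoid (S : set rat) (u m : rat) : finite_set S -> u < m ->
  exists c, [/\ u < c, c < m & ~ S c].
Proof.
move=> fS um; have [c [h1 h2 h3]] := finite_pick_below fS um.
have [c' [h4 h5]] := midpointQ h2; exists c'; split=> //.
  exact: lt_trans h4.
by move=> /h3/(_ h5); rewrite ltNge ltW.
Qed.

(** Reflection in the diagonal: g becomes its inverse, [a] and [b] are exchanged and all signs are
    reversed. It turns upward crossings into downward ones. *)
Definition gswap X (t : gpoint X) := GPoint (gy t) (gx t) (glab t).

Section fillable.
Variables (X : Type) (a : X -> rat -> rat) (s : rat -> bool) (P : set rat).

Definition filling K (t t' : gpoint X) l :=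
  chain (gstep a s K) t (rcons l t') /\ forall p, p \in l -> ggood a s P K p.

(** The clauses are the requests of the back-and-forth: g is defined at [Y], g takes the value [V],
    and the orbital named [O] occurs for every [k] whose label jumps over it. *)
Definition fillable K (t t' : gpoint X) :=
  [/\ forall Y, gx t < Y < gx t' ->
        exists2 l, filling K t t' l & exists2 p, p \in l & gx p = Y,
      forall V, gy t < V < gy t' ->
        exists2 l, filling K t t' l & exists2 p, p \in l & gy p = V &
      forall O, P O ->
        exists2 l, filling K t t' l & forall k, K k -> glab t k < O ->
          O < glab t' k -> exists2 p, p \in l & glab p k = O].

End fillable.

Section transpose.
Variables (X : Type) (a b : X -> rat -> rat) (s : rat -> bool) (P : set rat).
Hypothesis a_lt : forall k x y, (a k x < a k y) = (x < y).
Hypothesis ab : forall k x, a k (b k x) = x.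
Let s' := fun x => ~~ s x.

Let invlt k x y : (b k x < y) = (x < a k y).
Proof. by rewrite -(a_lt k) ab. Qed.

Let ltinv k x y : (x < b k y) = (a k x < y).
Proof. by rewrite -(a_lt k) ab. Qed.

Lemma gstep_swap K t t' :
  gstep b s' K t t' -> gstep a s K (gswap t) (gswap t').
Proof.
move=> [h1 h2 [A [B AB]]]; split=> //; exists A, B => k Kk.
case: (AB k Kk) => [[e lk]|[-> -> lt ss]]; [left|right]; split=> //=.
  by case: lk => lk; [right|left]; rewrite /= leNgt ?ltinv -?ltinv -?invlt -leNgt.
by apply: contra ss; rewrite /s' => /eqP->.
Qed.

Lemma ggood_swap K t : ggood b s' P K t <-> ggood a s P K (gswap t).
Proof.
by split=> h k Kk; have [h1 h2] := h k Kk; split=> //; move: h2;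
  rewrite /gsign /= /s'; case: (s _); rewrite /= ?invlt ?ltinv.
Qed.

Lemma fillable_swap K t t' :
  fillable b s' P K t t' -> fillable a s P K (gswap t) (gswap t').
Proof.
have sw l : filling b s' P K t t' l ->
    filling a s P K (gswap t) (gswap t') (map (@gswap X) l).
  move=> [ch gl]; split; last by move=> _ /mapP[p pl ->]; apply/ggood_swap/gl.
  elim: l t ch {gl} => [|q l IH] u /= [h1 h2]; split; rewrite //.
  - exact: gstep_swap.
  - exact: gstep_swap.
  - exact: IH.
move=> [h1 h2 h3]; split=> [Y /h2|V /h1|O /h3] [l fl req].
- exists (map (@gswap X) l); first exact: sw.
  by have [p pl <-] := req; exists (gswap p) => //; exact: map_f.
- exists (map (@gswap X) l); first exact: sw.
  by have [p pl <-] := req; exists (gswap p) => //; exact: map_f.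
- exists (map (@gswap X) l); first exact: sw.
  move=> k Kk k1 k2; have [p pl e] := req k Kk k1 k2.
  by exists (gswap p) => //; exact: map_f.
Qed.

End transpose.

Section down_fillable.
Variables (X : Type) (a b : X -> rat -> rat) (s : rat -> bool) (P : set rat).
Hypothesis a_lt : forall k x y, (a k x < a k y) = (x < y).
Hypothesis ab : forall k x, a k (b k x) = x.
Hypothesis s_alt : forall x y, P x -> P y -> x < y -> s x = s y ->
  exists z, [/\ P z, x < z, z < y & s z != s x].
Variable K : set X.
Hypothesis finA : forall x, finite_set [set a k x | k in K].
Hypothesis finB : forall x, finite_set [set b k x | k in K].

Lemma down_fillable E A B y v y' v' : E `<=` K -> P A -> P B -> A < B ->
  s A -> s B = false -> y < y' -> v < v' ->
  ggood a s P E (gconst X y v A) -> ggood a s P E (gconst X y' v' B) ->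
  fillable a s P E (gconst X y v A) (gconst X y' v' B).
Proof.
move=> EK PA PB AB sA sB yy vv g1 g2.
have lo k : E k -> y < a k v.
  by move=> /g1[_]; rewrite /gsign /= sA.
have hi k : E k -> a k v' < y'.
  by move=> /g2[_]; rewrite /gsign /= sB.
split=> /=.
- move=> Y yY.
  have [V [V1 V2 V3]] := finite_avoid (finB Y) vv.
  have [||l [l1 l2 l3 _]] :=
    down_insert a_lt ab finA finB EK PA PB AB sA sB lo hi yY (V := V).
  - by rewrite V1.
  - move=> k Ek; apply/eqP => e; apply: V3; exists k; first exact: EK.
    by apply/eqP; rewrite eq_le !leNgt -(a_lt k V) -(a_lt k _ V) ab e ltxx.
  by exists l.
- move=> V vV.
  have [Y [Y1 Y2 Y3]] := finite_avoid (finA V) yy.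
  have [||l [l1 l2 _ l3]] :=
    down_insert a_lt ab finA finB EK PA PB AB sA sB lo hi (Y := Y) _ vV.
  - by rewrite Y1.
  - by move=> k Ek; apply/eqP => e; apply: Y3; exists k => //; exact: EK.
  by exists l.
- move=> O PO; have [/andP[AO OB]|nO] := boolP ((A < O) && (O < B)); last first.
    have [V [V1 V2]] := midpointQ vv.
    have [Y [Y1 Y2 Y3]] := finite_avoid (finA V) yy.
    have [|||l [l1 l2 _ l3]] :=
      down_insert a_lt ab finA finB EK PA PB AB sA sB lo hi (Y := Y) (V := V).
    - by rewrite Y1.
    - by rewrite V1.
    - by move=> k Ek; apply/eqP => e; apply: Y3; exists k => //; exact: EK.
    by exists l => // k _ h1 h2; rewrite h1 h2 in nO.
  (* [down_visit] passes through a negative label and then a positive one. [O] takes the place that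
     suits its sign, and alternation supplies the partner, between [A] and [O] or between [O] and
     [B]. *)
  have [sO|sO] := boolP (s O).
    have [|Q1 [PQ1 h1 h2]] := s_alt PA PO AO; first by rewrite sA sO.
    rewrite sA eqb_id => sQ1.
    have [l [l1 l2 l3]] := down_visit a_lt ab finA finB EK PA PB sA sB yy vv
      lo hi PQ1 PO h1 h2 OB (negbTE sQ1) sO.
    by exists l => // k Ek _ _; have [_] := l3 k Ek.
  have [|Q2 [PQ2 h1 h2]] := s_alt PO PB OB; first by rewrite sB (negbTE sO).
  rewrite (negbTE sO) eqbF_neg negbK => sQ2.
  have [l [l1 l2 l3]] := down_visit a_lt ab finA finB EK PA PB sA sB yy vv
    lo hi PO PQ2 AO h1 h2 (negbTE sO) sQ2.
  by exists l => // k Ek _ _; have [] := l3 k Ek.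
Qed.

End down_fillable.

Section filling_theory.
Variables (X : Type) (a b : X -> rat -> rat) (s : rat -> bool) (P : set rat).
Hypothesis a_lt : forall k x y, (a k x < a k y) = (x < y).
Hypothesis ab : forall k x, a k (b k x) = x.
Hypothesis s_alt : forall x y, P x -> P y -> x < y -> s x = s y ->
  exists z, [/\ P z, x < z, z < y & s z != s x].
Variable K : set X.
Hypothesis finA : forall x, finite_set [set a k x | k in K].
Hypothesis finB : forall x, finite_set [set b k x | k in K].
Implicit Types t : gpoint X.

Let b_lt k x y : (b k x < b k y) = (x < y).
Proof. by rewrite -(a_lt k) !ab. Qed.

Let ba k x : b k (a k x) = x.
Proof. by apply/eqP; rewrite eq_le !leNgt -(a_lt k x) -(a_lt k _ x) ab ltxx. Qed.

Lemma crossing_fillable E A B y v y' v' : E `<=` K -> P A -> P B -> A < B ->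
  s A != s B -> y < y' -> v < v' ->
  ggood a s P E (gconst X y v A) -> ggood a s P E (gconst X y' v' B) ->
  fillable a s P E (gconst X y v A) (gconst X y' v' B).
Proof.
move=> EK PA PB AB sAB yy vv g1 g2.
have [sA|sA] := boolP (s A).
  apply: (down_fillable a_lt ab s_alt finA finB) => //.
  by move: sAB; rewrite sA; case: (s B).
have sB : s B by move: sAB; rewrite (negbTE sA); case: (s B).
apply: (@fillable_swap X a b s P a_lt ab E (gconst X v y A) (gconst X v' y' B)).
apply: (down_fillable b_lt ba _ finB finA) => //.
- move=> x z Px Pz xz /negb_inj e; have [w [h1 h2 h3 h4]] := s_alt Px Pz xz e.
  by exists w; split=> //; apply: contra h4 => /eqP/negb_inj->.
- by rewrite sB.
- exact/(ggood_swap s P a_lt ab E (gconst X v y A)).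
- exact/(ggood_swap s P a_lt ab E (gconst X v' y' B)).
Qed.

Local Notation gstep := (gstep a s K).
Local Notation ggood := (ggood a s P K).

(** Indices linked over the step keep their labels whatever is inserted. The remaining ones, [E],
    all pass from [A] to [B], so [crossing_fillable] handles them with constant labels at the ends,
    and [chain_extend_labels] carries the result back to [K]. *)
Lemma gstep_fillable t t' : gstep t t' -> ggood t -> ggood t' ->
  fillable a s P K t t'.
Proof.
move=> [xx yy [A [B AB]]] gt gt'.
pose E : set X := [set k | K k /\ ~ (glab t k = glab t' k /\ linked a k t t')].
have EK : E `<=` K by move=> k [].
have ABE k : E k -> [/\ glab t k = A, glab t' k = B, A < B & s A != s B].
  by move=> [Kk nk]; case: (AB k Kk).
have notE k : K k -> ~ E k -> glab t k = glab t' k /\ linked a k t t'.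
  by move=> Kk nE; apply: contrapT => h; apply: nE.
pose t0 := gconst X (gx t) (gy t) A; pose t0' := gconst X (gx t') (gy t') B.
have ext l : filling a s P E t0 t0' l -> exists f : gpoint X -> gpoint X,
    [/\ filling a s P K t t' (map f l), forall p, gx (f p) = gx p,
      forall p, gy (f p) = gy p & forall p k, E k -> glab (f p) k = glab p k].
  move=> [ch gl].
  have [||f [f1 f2 f3 f4 f5]] :=
    chain_extend_labels a_lt EK _ _ notE gt ch gl (t0 := t0) (t0' := t0').
  - by do 2!split=> //; move=> k /ABE[].
  - by do 2!split=> //; move=> k /ABE[].
  by exists f; split=> //; split=> // _ /mapP[p pl ->]; exact: f2.
have [[k0 Ek0]|nE] := pselect (exists k, E k); last first.
  have {}nE k : ~ E k by move=> Ek; apply: nE; exists k.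
  have one Y V : gx t < Y < gx t' -> gy t < V < gy t' ->
      filling a s P E t0 t0' [:: gconst X Y V A].
    move=> /andP[h1 h2] /andP[h3 h4]; split; last by move=> p _ k /nE.
    by do 2!(split; first by split=> //; exists A, B => k /nE).
  have [Y0 [Y01 Y02]] := midpointQ xx; have [V0 [V01 V02]] := midpointQ yy.
  have Y0P : gx t < Y0 < gx t' by rewrite Y01.
  have V0P : gy t < V0 < gy t' by rewrite V01.
  split.
  + move=> Y YP; have [f [f1 f2 _ _]] := ext _ (one _ _ YP V0P).
    exists (map f [:: gconst X Y V0 A]) => //.
    by exists (f (gconst X Y V0 A)); rewrite ?mem_head // f2.
  + move=> V VP; have [f [f1 _ f2 _]] := ext _ (one _ _ Y0P VP).
    exists (map f [:: gconst X Y0 V A]) => //.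
    by exists (f (gconst X Y0 V A)); rewrite ?mem_head // f2.
  + move=> O PO; exists [::]; first by split=> //; split=> //; split=> //; exists A, B.
    move=> k Kk; have [|-> _] := notE k Kk; first exact: nE.
    by move=> h1 h2; have := lt_trans h1 h2; rewrite ltxx.
have [eA eB ltAB sAB] := ABE _ Ek0.
have PA : P A by have [h _] := gt k0 (EK _ Ek0); rewrite -eA.
have PB : P B by have [h _] := gt' k0 (EK _ Ek0); rewrite -eB.
have [||h1 h2 h3] := @crossing_fillable E A B (gx t) (gy t) (gx t') (gy t')
  EK PA PB ltAB sAB xx yy.
- move=> k Ek; split=> //; have [_] := gt k (EK _ Ek).
  by have [e _ _ _] := ABE _ Ek; rewrite /gsign /= e.
- move=> k Ek; split=> //; have [_] := gt' k (EK _ Ek).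
  by have [_ e _ _] := ABE _ Ek; rewrite /gsign /= e.
split.
+ move=> Y /h1[l /ext[f [f1 f2 _ _]] [p pl pY]]; exists (map f l) => //.
  by exists (f p); rewrite ?f2 //; exact: map_f.
+ move=> V /h2[l /ext[f [f1 _ f2 _]] [p pl pV]]; exists (map f l) => //.
  by exists (f p); rewrite ?f2 //; exact: map_f.
+ move=> O PO; have [l /ext[f [f1 _ _ f2]] lO] := h3 O PO.
  exists (map f l) => // k Kk k1 k2.
  have Ek : E k by split=> // -[e _]; have := lt_trans k1 k2; rewrite e ltxx.
  have [e e' _ _] := ABE _ Ek; rewrite e in k1; rewrite e' in k2.
  have [p pl pO] := lO k Ek k1 k2.
  by exists (f p); rewrite ?f2 //; exact: map_f.
Qed.

Definition allgood t l := forall p, p \in t :: l -> ggood p.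

Lemma fill_cat t r t1 l : filling a s P K t t1 r -> chain gstep t1 l ->
  allgood t (t1 :: l) ->
  [/\ chain gstep t (rcons r t1 ++ l), allgood t (rcons r t1 ++ l),
      last t (rcons r t1 ++ l) = last t1 l,
      {subset t1 :: l <= rcons r t1 ++ l} &
      {subset r <= rcons r t1 ++ l}].
Proof.
move=> [ch gr] chl gl; split.
- by apply/chain_cat; rewrite last_rcons.
- move=> p; rewrite inE mem_cat mem_rcons inE.
  move=> /predU1P[->|/orP[/predU1P[->|/gr//]|pl]]; apply: gl; rewrite !inE ?eqxx ?orbT //.
  by rewrite pl !orbT.
- by rewrite last_cat last_rcons.
- by move=> p; rewrite mem_cat mem_rcons !inE => /orP[->|->]; rewrite ?orbT.
- by move=> p pr; rewrite mem_cat mem_rcons !inE pr orbT.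
Qed.

Lemma fill_gx t l Y : chain gstep t l -> allgood t l ->
  gx t < Y < gx (last t l) ->
  exists l', [/\ chain gstep t l', allgood t l', last t l' = last t l,
    {subset l <= l'} & exists2 p, p \in l' & gx p = Y].
Proof.
elim: l t => [|t1 l IH] t /=; first by move=> _ _ /andP[/lt_trans h /h]; rewrite ltxx.
move=> [st ch] gl /andP[h1 h2].
have gt : ggood t by apply: gl; exact: mem_head.
have gl1 : allgood t1 l by move=> p pl; apply: gl; rewrite inE pl orbT.
have gt1 : ggood t1 by apply: gl1; exact: mem_head.
have [Yt|Yt|Yt] := ltgtP Y (gx t1).
- have [/(_ Y)] := gstep_fillable st gt gt1; rewrite h1 Yt => /(_ isT)[r fr [p pr pY]] _ _.
  have [k1 k2 k3 k4 k5] := fill_cat fr ch gl.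
  by exists (rcons r t1 ++ l); split=> //; exists p => //; exact: k5.
- have [|l' [k1 k2 k3 k4 [p pl pY]]] := IH t1 ch gl1; first by rewrite Yt.
  exists (t1 :: l'); split=> //.
  + by move=> q; rewrite inE => /predU1P[->//|]; exact: k2.
  + by move=> q; rewrite !inE => /predU1P[->|/k4->]; rewrite ?eqxx ?orbT.
  + by exists p => //; rewrite inE pl orbT.
- by exists (t1 :: l); split=> //; exists t1 => //; exact: mem_head.
Qed.

Lemma fill_gy t l V : chain gstep t l -> allgood t l ->
  gy t < V < gy (last t l) ->
  exists l', [/\ chain gstep t l', allgood t l', last t l' = last t l,
    {subset l <= l'} & exists2 p, p \in l' & gy p = V].
Proof.
elim: l t => [|t1 l IH] t /=; first by move=> _ _ /andP[/lt_trans h /h]; rewrite ltxx.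
move=> [st ch] gl /andP[h1 h2].
have gt : ggood t by apply: gl; exact: mem_head.
have gl1 : allgood t1 l by move=> p pl; apply: gl; rewrite inE pl orbT.
have gt1 : ggood t1 by apply: gl1; exact: mem_head.
have [Yt|Yt|Yt] := ltgtP V (gy t1).
- have [_ /(_ V)] := gstep_fillable st gt gt1; rewrite h1 Yt => /(_ isT)[r fr [p pr pY]] _.
  have [k1 k2 k3 k4 k5] := fill_cat fr ch gl.
  by exists (rcons r t1 ++ l); split=> //; exists p => //; exact: k5.
- have [|l' [k1 k2 k3 k4 [p pl pY]]] := IH t1 ch gl1; first by rewrite Yt.
  exists (t1 :: l'); split=> //.
  + by move=> q; rewrite inE => /predU1P[->//|]; exact: k2.
  + by move=> q; rewrite !inE => /predU1P[->|/k4->]; rewrite ?eqxx ?orbT.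
  + by exists p => //; rewrite inE pl orbT.
- by exists (t1 :: l); split=> //; exists t1 => //; exact: mem_head.
Qed.

(** The step on which the label passes over [O] depends on [k], so every step of the chain is
    refined; a label [O] met at an end of a step needs no new point. *)
Lemma fill_label t l O : P O -> chain gstep t l -> allgood t l ->
  exists l', [/\ chain gstep t l', allgood t l', last t l' = last t l,
    {subset l <= l'} & forall k, K k -> glab t k <= O <= glab (last t l) k ->
      exists2 p, p \in t :: l' & glab p k = O].
Proof.
move=> PO; elim: l t => [|t1 l IH] t /=.
  move=> _ gl; exists [::]; split=> // k Kk; rewrite -eq_le => /eqP e.
  by exists t => //; exact: mem_head.
move=> [st ch] gl.
have gt : ggood t by apply: gl; exact: mem_head.
have gl1 : allgood t1 l by move=> p pl; apply: gl; rewrite inE pl orbT.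
have gt1 : ggood t1 by apply: gl1; exact: mem_head.
have [l' [k1 k2 k3 k4 k5]] := IH t1 ch gl1.
have [_ _ /(_ O PO)[r fr rO]] := gstep_fillable st gt gt1.
have gl2 : allgood t (t1 :: l').
  by move=> q; rewrite inE => /predU1P[->//|]; exact: k2.
have [m1 m2 m3 m4 m5] := fill_cat fr k1 gl2.
exists (rcons r t1 ++ l'); split=> //; first by rewrite m3.
  by move=> q; rewrite inE => qt; apply: m4; rewrite inE; case/predU1P: qt => [->|/k4->]; rewrite ?eqxx ?orbT.
move=> k Kk /andP[h1 h2].
have [h3|h3] := leP (glab t1 k) O.
  have [|p pl pO] := k5 k Kk; first by rewrite h3.
  by exists p => //; rewrite inE m4 ?orbT.
move: h1; rewrite le_eqVlt => /predU1P[e|h1].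
  by exists t => //; exact: mem_head.
have [p pr pO] := rO k Kk h1 h3.
by exists p => //; rewrite inE m5 ?orbT.
Qed.

End filling_theory.

(** * Construction on a region *)

Section region.
Variables (X : Type) (a b : X -> rat -> rat) (s : rat -> bool).
Variables (P I : set rat).
Hypothesis a_lt : forall k x y, (a k x < a k y) = (x < y).
Hypothesis ab : forall k x, a k (b k x) = x.
Hypothesis s_alt : forall x y, P x -> P y -> x < y -> s x = s y ->
  exists z, [/\ P z, x < z, z < y & s z != s x].
Variable K : set X.
Hypothesis finA : forall x, finite_set [set a k x | k in K].
Hypothesis finB : forall x, finite_set [set b k x | k in K].
Hypothesis I_convex : forall x y z, I x -> I y -> x <= z <= y -> I z.
Hypothesis I_up : forall x, I x -> exists2 y, I y & x < y.
Hypothesis I_down : forall x, I x -> exists2 y, I y & y < x.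
Hypothesis I_a : forall k x, K k -> I x -> I (a k x).
Hypothesis I_b : forall k x, K k -> I x -> I (b k x).
Implicit Types (t : gpoint X) (l : seq (gpoint X)).

Local Notation gstep := (gstep a s K).
Local Notation ggood := (ggood a s P K).
Local Notation allgood := (allgood a s P K).

Let invlt k x y : (b k x < y) = (x < a k y).
Proof. by rewrite -(a_lt k) ab. Qed.

Let ltinv k x y : (x < b k y) = (a k x < y).
Proof. by rewrite -(a_lt k) ab. Qed.

Lemma finite_upper (S : set rat) x : finite_set S -> S `<=` I -> I x ->
  exists z, [/\ I z, x < z & forall w, S w -> w < z].
Proof.
move=> /finite_seqP[ys ->]; elim: ys x => [|y ys IH] x sI Ix.
  by have [z Iz xz] := I_up Ix; exists z.
have [|z [Iz xz h]] := IH x _ Ix; first by move=> w wy; apply: sI; rewrite /= inE wy orbT.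
have [z' Iz' zz'] : exists2 z', I z' & Num.max z y < z'.
  apply: I_up; rewrite /Num.max; case: ifP => // _.
  by apply: sI; rewrite /= mem_head.
move: zz'; rewrite gt_max => /andP[zz' yz']; exists z'; split=> //.
  exact: lt_trans zz'.
move=> w /=; rewrite inE => /predU1P[->//|/h/lt_trans]; exact.
Qed.

Lemma finite_lower (S : set rat) x : finite_set S -> S `<=` I -> I x ->
  exists z, [/\ I z, z < x & forall w, S w -> z < w].
Proof.
move=> /finite_seqP[ys ->]; elim: ys x => [|y ys IH] x sI Ix.
  by have [z Iz xz] := I_down Ix; exists z.
have [|z [Iz xz h]] := IH x _ Ix; first by move=> w wy; apply: sI; rewrite /= inE wy orbT.
have [z' Iz' zz'] : exists2 z', I z' & z' < Num.min z y.
  apply: I_down; rewrite /Num.min; case: ifP => // _.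
  by apply: sI; rewrite /= mem_head.
move: zz'; rewrite lt_min => /andP[zz' yz']; exists z'; split=> //.
  exact: lt_trans xz.
by move=> w /=; rewrite inE => /predU1P[->//|/h]; exact: lt_trans.
Qed.

(** The images and preimages of one point under [K] are finitely many points of [I], and [I] has no
    last point; so the sign demanded by [c] can be secured for all [k] together. *)
Lemma far_right c y v : P c -> I y -> I v ->
  exists y' v', [/\ I y', I v', y < y', v < v' & ggood (gconst X y' v' c)].
Proof.
move=> Pc Iy Iv.
suff [y' [v' [h1 h2 h3 h4 h5]]] : exists y' v', [/\ I y', I v', y < y', v < v' &
    forall k, K k -> if s c then y' < a k v' else a k v' < y'].
  by exists y', v'; split=> // k Kk; split=> //; exact: h5.
have [sc|sc] := boolP (s c).
  have [y' Iy' yy'] := I_up Iy.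
  have [|v' [Iv' vv' h]] := finite_upper (finB y') _ Iv.
    by move=> _ [k Kk <-]; exact: I_b.
  by exists y', v'; split=> // k Kk; rewrite -invlt; apply: h; exists k.
have [v' Iv' vv'] := I_up Iv.
have [|y' [Iy' yy' h]] := finite_upper (finA v') _ Iy.
  by move=> _ [k Kk <-]; exact: I_a.
by exists y', v'; split=> // k Kk; apply: h; exists k.
Qed.

Lemma far_left c y v : P c -> I y -> I v ->
  exists y' v', [/\ I y', I v', y' < y, v' < v & ggood (gconst X y' v' c)].
Proof.
move=> Pc Iy Iv.
suff [y' [v' [h1 h2 h3 h4 h5]]] : exists y' v', [/\ I y', I v', y' < y, v' < v &
    forall k, K k -> if s c then y' < a k v' else a k v' < y'].
  by exists y', v'; split=> // k Kk; split=> //; exact: h5.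
have [sc|sc] := boolP (s c).
  have [v' Iv' vv'] := I_down Iv.
  have [|y' [Iy' yy' h]] := finite_lower (finA v') _ Iy.
    by move=> _ [k Kk <-]; exact: I_a.
  by exists y', v'; split=> // k Kk; apply: h; exists k.
have [y' Iy' yy'] := I_down Iy.
have [|v' [Iv' vv' h]] := finite_lower (finB y') _ Iv.
  by move=> _ [k Kk <-]; exact: I_b.
by exists y', v'; split=> // k Kk; rewrite -ltinv; apply: h; exists k.
Qed.

(** Constant labels at the ends allow a chain to be continued by a step on which all of [K] changes
    label together. *)
Definition endpoint t := exists x z c, [/\ t = gconst X x z c, I x, I z & P c].

Let I_max x y : I x -> I y -> I (Num.max x y).
Proof. by rewrite /Num.max; case: ifP. Qed.

Let I_min x y : I x -> I y -> I (Num.min x y).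
Proof. by rewrite /Num.min; case: ifP. Qed.

Let cross x z A x' z' B : x < x' -> z < z' -> A < B -> s A != s B ->
  gstep (gconst X x z A) (gconst X x' z' B).
Proof. by move=> h1 h2 h3 h4; split=> //; exists A, B => k Kk; right. Qed.

Lemma extend_right t Y V O : endpoint t -> ggood t -> I Y -> I V -> P O ->
  exists l, [/\ chain gstep t l, allgood t l, endpoint (last t l),
    Y < gx (last t l) /\ V < gy (last t l) &
    forall k, K k -> O <= glab (last t l) k].
Proof.
move=> [x [z [A [-> Ix Iz PA]]]] gt IY IV PO.
have [OA|AO] := leP O A.
  have [x' [z' [Ix' Iz' h1 h2 g']]] := far_right PA (I_max Ix IY) (I_max Iz IV).
  move: h1 h2; rewrite !gt_max => /andP[xx' Yx'] /andP[zz' Vz'].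
  have [x1 [z1 [_ m1 m2 m3]]] :=
    link_mid a_lt ab finA finB (@subset_refl _ K) PA xx' zz' gt g'.
  exists [:: gconst X x1 z1 A; gconst X x' z' A]; split=> //=.
  - by move=> p; rewrite !inE => /or3P[] /eqP->.
  - by exists x', z', A.
have [sAO|/negPn/eqP sAO] := boolP (s A != s O).
  have [x' [z' [Ix' Iz' h1 h2 g']]] := far_right PO (I_max Ix IY) (I_max Iz IV).
  move: h1 h2; rewrite !gt_max => /andP[xx' Yx'] /andP[zz' Vz'].
  exists [:: gconst X x' z' O]; split=> //=.
  - by split=> //; exact: cross.
  - by move=> p; rewrite !inE => /orP[] /eqP->.
  - by exists x', z', O.
(* A label can only change to one of the opposite sign, so a label [C] of the other sign is visited
   on the way from [A] to [O]. *)
have [C [PC AC CO sC]] := s_alt PA PO AO sAO.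
have [x1 [z1 [Ix1 Iz1 h1 h2 g1]]] := far_right PC Ix Iz.
have [x' [z' [Ix' Iz' h3 h4 g']]] := far_right PO (I_max Ix1 IY) (I_max Iz1 IV).
move: h3 h4; rewrite !gt_max => /andP[xx' Yx'] /andP[zz' Vz'].
exists [:: gconst X x1 z1 C; gconst X x' z' O]; split=> //=.
- by split; [|split=> //]; apply: cross => //; rewrite -?sAO // eq_sym.
- by move=> p; rewrite !inE => /or3P[] /eqP->.
- by exists x', z', O.
Qed.

Lemma extend_left t Y V O : endpoint t -> ggood t -> I Y -> I V -> P O ->
  exists t0 l, [/\ chain gstep t0 (rcons l t), allgood t0 (rcons l t),
    endpoint t0, gx t0 < Y /\ gy t0 < V & forall k, K k -> glab t0 k <= O].
Proof.
move=> [x [z [A [-> Ix Iz PA]]]] gt IY IV PO.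
have [AO|OA] := leP A O.
  have [x' [z' [Ix' Iz' h1 h2 g']]] := far_left PA (I_min Ix IY) (I_min Iz IV).
  move: h1 h2; rewrite !lt_min => /andP[xx' Yx'] /andP[zz' Vz'].
  have [x1 [z1 [_ m1 m2 m3]]] :=
    link_mid a_lt ab finA finB (@subset_refl _ K) PA xx' zz' g' gt.
  exists (gconst X x' z' A), [:: gconst X x1 z1 A]; split=> //=.
  - by move=> p; rewrite !inE => /or3P[] /eqP->.
  - by exists x', z', A.
have [sAO|/negPn/eqP sAO] := boolP (s O != s A).
  have [x' [z' [Ix' Iz' h1 h2 g']]] := far_left PO (I_min Ix IY) (I_min Iz IV).
  move: h1 h2; rewrite !lt_min => /andP[xx' Yx'] /andP[zz' Vz'].
  exists (gconst X x' z' O), [::]; split=> //=.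
  - by split=> //; exact: cross.
  - by move=> p; rewrite !inE => /orP[] /eqP->.
  - by exists x', z', O.
have [C [PC OC CA sC]] := s_alt PO PA OA sAO.
have [x1 [z1 [Ix1 Iz1 h1 h2 g1]]] := far_left PC Ix Iz.
have [x' [z' [Ix' Iz' h3 h4 g']]] := far_left PO (I_min Ix1 IY) (I_min Iz1 IV).
move: h3 h4; rewrite !lt_min => /andP[xx' Yx'] /andP[zz' Vz'].
exists (gconst X x' z' O), [:: gconst X x1 z1 C]; split=> //=.
- by split; [|split=> //]; apply: cross => //; rewrite -?sAO // eq_sym.
- by move=> p; rewrite !inE => /or3P[] /eqP->.
- by exists x', z', O.
Qed.

Definition condition (c : gpoint X * seq (gpoint X)) :=
  [/\ endpoint c.1, endpoint (last c.1 c.2), chain gstep c.1 c.2 &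
      allgood c.1 c.2].

Definition cpts (c : gpoint X * seq (gpoint X)) := c.1 :: c.2.

(** One round of the back-and-forth. The chain is prolonged on both sides until [Y], [V] and, for
    all [k], the label [O] lie within its span; then the requests are met by refinement. *)
Lemma condition_extend c Y V O : condition c -> I Y -> I V -> P O ->
  exists2 c', condition c' & [/\ {subset cpts c <= cpts c'},
    exists2 p, p \in cpts c' & gx p = Y,
    exists2 p, p \in cpts c' & gy p = V &
    forall k, K k -> exists2 p, p \in cpts c' & glab p k = O].
Proof.
case: c => t l [/= et el ch gl] IY IV PO.
have [t0 [l0 [ch0 g0 e0 [h1 h2] h3]]] :=
  extend_left et (gl _ (mem_head _ _)) IY IV PO.
have gll : ggood (last t l) by apply: gl; exact: mem_last.
have [l1 [ch1 g1 e1 [h4 h5] h6]] := extend_right el gll IY IV PO.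
pose m := rcons l0 t ++ l ++ l1.
have mE : last t0 m = last (last t l) l1 by rewrite /m !last_cat last_rcons.
have chm : chain gstep t0 m.
  by apply/chain_cat; split=> //; rewrite last_rcons; apply/chain_cat.
have gm : allgood t0 m.
  move=> p; rewrite inE !mem_cat => /predU1P[->|/or3P[pl|pl|pl]].
  - by apply: g0; exact: mem_head.
  - by apply: g0; rewrite inE pl orbT.
  - by apply: gl; rewrite inE pl orbT.
  - by apply: g1; rewrite inE pl orbT.
have subm : {subset t :: l <= t0 :: m}.
  by move=> p; rewrite !inE !mem_cat mem_rcons inE => /orP[/eqP->|->]; rewrite ?eqxx ?orbT.
have [|m1 [c1 g1' e1' s1 [p1 p1m p1Y]]] := fill_gx a_lt ab s_alt finA finB chm gm (Y := Y).
  by rewrite mE h1.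
have [|m2 [c2 g2 e2 s2 [p2 p2m p2V]]] := fill_gy a_lt ab s_alt finA finB c1 g1' (V := V).
  by rewrite e1' mE h2.
have [m3 [c3 g3 e3 s3 hO]] := fill_label a_lt ab s_alt finA finB PO c2 g2.
have sub3 q : q \in t0 :: m -> q \in t0 :: m3.
  by rewrite !inE => /predU1P[->|/s1/s2/s3->]; rewrite ?eqxx ?orbT.
exists (t0, m3); first by split=> //=; rewrite e3 e2 e1' mE.
split.
- by move=> p pc; apply: sub3; exact: subm.
- by exists p1 => //; rewrite inE; rewrite s3 ?orbT // s2.
- by exists p2 => //; rewrite inE; rewrite s3 ?orbT.
- by move=> k Kk; apply: hO => //; rewrite h3 //= e2 e1' mE h6.
Qed.

Definition glt t t' := [/\ gx t < gx t', gy t < gy t' &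
  forall k, K k -> glab t k <= glab t' k].

Lemma chain_head_lt t l q : chain gstep t l -> q \in l -> glt t q.
Proof.
have step_lt u w : gstep u w -> glt u w.
  by move=> [h1 h2 [A [B AB]]]; split=> // k /AB[[->//]|[-> -> /ltW]].
elim: l t => [//|x l IH] t [/step_lt[h1 h2 h3] ch].
rewrite inE => /predU1P[->//|/(IH _ ch)[k1 k2 k3]].
split; [exact: lt_trans k1|exact: lt_trans k2|].
by move=> k Kk; apply: le_trans (h3 k Kk) (k3 k Kk).
Qed.

Lemma chain_compare t l p q : chain gstep t l -> p \in t :: l -> q \in t :: l ->
  [\/ p = q, glt p q | glt q p].
Proof.
elim: l t => [|x l IH] t ch.
  by rewrite !mem_seq1 => /eqP-> /eqP->; apply: Or31.
rewrite inE => /predU1P[->|px]; rewrite inE => /predU1P[->|qx].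
- by apply: Or31.
- by apply: Or32; exact: chain_head_lt ch qx.
- by apply: Or33; exact: chain_head_lt ch px.
- by apply: IH px qx; have [] := ch.
Qed.

(** Labels increase along a chain, so between two points with the same label no step changes it and
    every step is linked; transitivity joins the points. [R] stands for lying in one orbital and is
    abstract because g does not exist at this stage. *)
Lemma chain_reach (R : rat -> rat -> Prop) k t l p q : K k ->
  (forall x y z, R x y -> R y z -> R x z) ->
  (forall u w, u \in t :: l -> w \in t :: l -> gx u < gx w ->
     linked a k u w -> R (gx u) (gx w)) ->
  chain gstep t l -> p \in t :: l -> q \in t :: l -> gx p < gx q ->
  glab p k = glab q k -> R (gx p) (gx q).
Proof.
move=> Kk Rt; elim: l t p => [|x l IH] t p HR ch.
  by rewrite !mem_seq1 => /eqP-> /eqP->; rewrite ltxx.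
have HR' u w : u \in x :: l -> w \in x :: l -> gx u < gx w ->
    linked a k u w -> R (gx u) (gx w).
  by move=> ul wl; apply: HR; rewrite inE ?ul ?wl orbT.
rewrite inE => /predU1P[->|px]; rewrite inE => /predU1P[->|qx].
- by rewrite ltxx.
- move=> tq eq_lab; have [[tx ty [A [B /(_ k Kk) AB]]] chx] := ch.
  move: (qx); rewrite inE => xql.
  have mono : glab x k <= glab q k.
    case/predU1P: xql => [->//|/(chain_head_lt chx)[_ _]]; exact.
  case: AB => [[e lk]|[e e' ltAB _]]; last first.
    by move: mono; rewrite -eq_lab e e' leNgt ltAB.
  have Rtx : R (gx t) (gx x).
    by apply: HR => //; rewrite !inE eqxx ?orbT.
  case/predU1P: xql => [->//|/(chain_head_lt chx)[xq _ _]].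
  apply: Rt Rtx _; apply: (IH x x) => //; first exact: mem_head.
  by rewrite -e.
- move=> /lt_trans h; have [tp _ _] := chain_head_lt ch px.
  by have := h _ tp; rewrite ltxx.
- by apply: (IH x p) => //; have [] := ch.
Qed.

Variable O0 x0 : rat.
Hypotheses (PO0 : P O0) (Ix0 : I x0).

Theorem region_construction : exists (g : rat -> rat) (lab : X -> rat -> rat),
  [/\ forall y, I y -> I (g y),
      forall y y', I y -> I y' -> y < y' -> g y < g y',
      forall v, I v -> exists2 y, I y & g y = v &
      forall k, K k ->
        [/\ forall y, I y -> P (lab k y) /\
              if s (lab k y) then y < a k (g y) else a k (g y) < y,
            forall y y', I y -> I y' -> y < y' -> lab k y <= lab k y',
            forall O, P O -> exists2 y, I y & lab k y = O &
            forall R : rat -> rat -> Prop,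
              (forall x y z, R x y -> R y z -> R x z) ->
              (forall y y', I y -> I y' -> y < y' ->
                 y' <= a k (g y) \/ a k (g y') <= y -> R y y') ->
              forall y y', I y -> I y' -> y < y' ->
                lab k y = lab k y' -> R y y']].
Proof.
pose C := {c | condition c}.
have [c0] : exists c : C, True.
  have [y [v [Iy Iv _ _ gyv]]] := far_right PO0 Ix0 Ix0.
  have cc : condition (gconst X y v O0, [::]).
    by split=> //=; [exists y, v, O0|exists y, v, O0|move=> p; rewrite inE => /eqP->].
  by exists (exist _ _ cc).
move=> _.
(* Numbers that do not name a point of [I] or a label in [P] are redirected to [x0] or [O0], so that
   every round has admissible requests. *)
pose q n := odflt x0 (unpickle n : option rat).
pose qI n := if `[< I (q n) >] then q n else x0.
pose qP n := if `[< P (q n) >] then q n else O0.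
have IqI n : I (qI n) by rewrite /qI; case: asboolP.
have PqP n : P (qP n) by rewrite /qP; case: asboolP.
have qIK x : I x -> exists n, qI n = x.
  by move=> Ix; exists (pickle x); rewrite /qI /q pickleK /= asboolT.
have qPK x : P x -> exists n, qP n = x.
  by move=> Ix; exists (pickle x); rewrite /qP /q pickleK /= asboolT.
have /choice[F FP] : forall nc : nat * C, exists c' : C,
    [/\ {subset cpts (sval nc.2) <= cpts (sval c')},
    exists2 p, p \in cpts (sval c') & gx p = qI nc.1,
    exists2 p, p \in cpts (sval c') & gy p = qI nc.1 &
    forall k, K k -> exists2 p, p \in cpts (sval c') & glab p k = qP nc.1].
  move=> [n [c cc]].
  have [c' cc' h] := condition_extend cc (IqI n) (IqI n) (PqP n).
  by exists (exist _ c' cc').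
pose cs := fix cs n := if n is m.+1 then F (m, cs m) else c0.
pose pts n := cpts (sval (cs n)).
have ptsS n m : (n <= m)%N -> {subset pts n <= pts m}.
  move=> /subnKC<-; elim: (m - n)%N => [|d IH]; first by rewrite addn0.
  by move=> p /IH; rewrite addnS; have [h _ _ _] := FP ((n + d)%N, cs (n + d)%N); exact: h.
have ch n : chain gstep (sval (cs n)).1 (sval (cs n)).2 by have [] := svalP (cs n).
have gd n p : p \in pts n -> ggood p.
  by have [_ _ _ h] := svalP (cs n); exact: h.
have com n m p p' : p \in pts n -> p' \in pts m ->
    exists N, p \in pts N /\ p' \in pts N.
  move=> pn pm; exists (maxn n m).
  by split; [apply: (ptsS n)|apply: (ptsS m)]; rewrite ?leq_maxl ?leq_maxr.
have ptsI n p : p \in pts n -> I (gx p) /\ I (gy p).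
  have [[x [z [c [eh Ix Iz _]]]] [x' [z' [c' [el Ix' Iz' _]]]] chn _] := svalP (cs n).
  rewrite /pts /cpts; move: (sval (cs n)) eh el chn => -[t l] /= eh el chn.
  rewrite inE => /predU1P[->|pl]; first by rewrite eh.
  have [h1 h2 _] := chain_head_lt chn pl.
  have [h3 h4] : gx p <= gx (last t l) /\ gy p <= gy (last t l).
    have := mem_last t l => lin; have pin : p \in t :: l by rewrite inE pl orbT.
    have [->//|[/ltW ? /ltW ?]//|[h3 _ _]] := chain_compare chn pin lin.
    exfalso; move: h3; clear -chn pl; elim: l t chn pl => [//|w l IH] t /= [_ chn].
    rewrite inE => /predU1P[->|]; last exact: IH.
    case: l chn {IH} => [|w' l] chn; first by rewrite ltxx.
    have [h _ _] := chain_head_lt chn (mem_last w' l).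
    by move=> /(lt_trans h); rewrite ltxx.
  rewrite eh /= in h1 h2; rewrite el /= in h3 h4.
  by split; [apply: (I_convex Ix Ix')|apply: (I_convex Iz Iz')]; rewrite ltW.
have /choice[T TP] y : exists t, I y -> (exists n, t \in pts n) /\ gx t = y.
  have [Iy|] := pselect (I y); last by exists (gconst X 0 0 0).
  have [n <-] := qIK y Iy.
  have [_ [p pn pY] _ _] := FP (n, cs n).
  by exists p => _; split=> //; exists n.+1.
have TK n p : p \in pts n -> T (gx p) = p.
  move=> pn; have [Ip _] := ptsI _ _ pn; have [[m Tm] e] := TP _ Ip.
  have [N [pN TN]] := com _ _ _ _ pn Tm.
  by have [->|[h _ _]|[h _ _]] := chain_compare (ch N) TN pN => //;
    move: h; rewrite e ltxx.
have Tlt y y' : I y -> I y' -> y < y' -> glt (T y) (T y').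
  move=> Iy Iy' yy'; have [[m Tm] e] := TP _ Iy; have [[m' Tm'] e'] := TP _ Iy'.
  have [N [pN TN]] := com _ _ _ _ Tm Tm'.
  have [h|//|[h _ _]] := chain_compare (ch N) pN TN.
    by move: yy'; rewrite -e -e' h ltxx.
  by have := lt_trans yy'; rewrite -e -e' => /(_ _ h); rewrite ltxx.
exists (fun y => gy (T y)), (fun k y => glab (T y) k); split.
- by move=> y Iy; have [[m Tm] _] := TP _ Iy; have [] := ptsI _ _ Tm.
- by move=> y y' Iy Iy' /(Tlt _ _ Iy Iy')[].
- move=> v Iv; have [n <-] := qIK v Iv.
  have [_ _ [p pn pV] _] := FP (n, cs n).
  have pn1 : p \in pts n.+1 by [].
  by exists (gx p); [have [] := ptsI _ _ pn1|rewrite (TK _ _ pn1)].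
move=> k Kk; split.
- move=> y Iy; have [[m Tm] e] := TP _ Iy; have [h1 h2] := gd _ _ Tm k Kk.
  by split=> //; move: h2; rewrite /gsign e.
- by move=> y y' Iy Iy' /(Tlt _ _ Iy Iy')[_ _ /(_ k Kk)].
- move=> O /qPK[n <-]; have [_ _ _ /(_ k Kk)[p pn pO]] := FP (n, cs n).
  have pn1 : p \in pts n.+1 by [].
  by exists (gx p); [have [] := ptsI _ _ pn1|rewrite (TK _ _ pn1)].
- move=> R Rt HR y y' Iy Iy' yy' e.
  have [[m Tm] Te] := TP _ Iy; have [[m' Tm'] Te'] := TP _ Iy'.
  have [N [pN TN]] := com _ _ _ _ Tm Tm'.
  rewrite -Te -Te'; apply: (chain_reach Kk Rt _ (ch N) pN TN) => //; last first.
    by rewrite Te Te'.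
  move=> u w uN wN uw lk; have [Iu _] := ptsI _ _ uN; have [Iw _] := ptsI _ _ wN.
  by apply: HR => //; rewrite (TK _ _ uN) (TK _ _ wN).
Qed.

End region.

(** * Gluing over the gaps between fixed points *)

Section gaps.
Variable f : autQ.

(* For a non-fixed point x this is the maximal convex set without fixed points
   of f around x; for a fixed point it is {x}. *)
Definition gapQ (x : rat) : set rat :=
  [set y | forall z, f z = z -> (z < x) = (z < y) /\ (x < z) = (y < z)].

Lemma gapQ_refl x : gapQ x x. Proof. by []. Qed.

Lemma gapQ_sym x y : gapQ x y -> gapQ y x.
Proof. by move=> h z /h[-> ->]. Qed.

Lemma gapQ_trans x y z : gapQ x y -> gapQ y z -> gapQ x z.
Proof. by move=> h1 h2 w fw; have [-> ->] := h1 w fw; exact: h2. Qed.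

Lemma gapQ_eq x y : gapQ x y -> gapQ x = gapQ y.
Proof.
move=> xy; apply/seteqP; split=> z; last exact: gapQ_trans.
by apply: gapQ_trans; exact: gapQ_sym.
Qed.

Lemma gapQ_fixed x y : f x = x -> gapQ x y -> y = x.
Proof.
move=> fx /(_ x fx); rewrite ltxx => -[h1 h2].
by apply/eqP; rewrite eq_le !leNgt -h1 -h2.
Qed.

Lemma gapQ_not_fixed x y : f x <> x -> gapQ x y -> f y <> y.
Proof. by move=> nx /gapQ_sym yx fy; have e := gapQ_fixed fy yx; rewrite e in nx. Qed.

Lemma gapQ_aut (k : autQ) x :
  (forall z, f z = z -> k z = z) -> gapQ x (k x).
Proof. by move=> kf z /kf kz; rewrite -{2 4}kz !autQ_lt. Qed.

Lemma gapQ_autV (k : autQ) x :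
  (forall z, f z = z -> k z = z) -> gapQ x ((k^-1)%g x).
Proof.
by move=> kf; apply: gapQ_sym; rewrite -{2}(autQ_invr k x); exact: gapQ_aut.
Qed.

Lemma gapQ_convex x y z w : gapQ x y -> gapQ x z -> y <= w <= z -> gapQ x w.
Proof.
move=> xy xz /andP[yw wz] u fu.
have [h1 h2] := xy u fu; have [h3 h4] := xz u fu; split.
  apply/idP/idP => [|h]; first by rewrite h1 => /lt_le_trans; exact.
  by rewrite h3; exact: lt_le_trans h wz.
apply/idP/idP => [|h]; first by rewrite h4; exact: le_lt_trans.
by rewrite h2; exact: le_lt_trans yw h.
Qed.

Lemma gapQ_orbital x y : orbital f x y -> gapQ x y.
Proof.
have e z n : f z = z -> expgz f n z = z.
  by move=> fz; apply: (orbital_fix fz); exact: orbital_expgz.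
move=> /orbitalP[m [n h]]; apply: gapQ_convex h.
  by apply: (@gapQ_aut (expgz f m)) => z /e.
by apply: (@gapQ_aut (expgz f n)) => z /e.
Qed.

Lemma not_gapQ x y : x < y -> ~ gapQ x y ->
  exists2 z, f z = z & x <= z <= y.
Proof.
move=> xy ngap; apply: contrapT => h; apply: ngap => z fz.
have nb : ~ (x <= z <= y) by move=> xzy; apply: h; exists z.
have [zx|zx|zx] := ltgtP z x.
- by rewrite (lt_trans zx xy) (lt_gtF (lt_trans zx xy)).
- have [zy|zy|zy] := ltgtP z y; last by exfalso; apply: nb; rewrite ltW // zy lexx.
    by exfalso; apply: nb; rewrite !ltW.
  by [].
- by exfalso; apply: nb; rewrite zx lexx ltW.
Qed.

(* A map that moves each point inside its gap respects any fixed point lying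
   between two arguments. *)
Lemma gapQ_sep x y x' y' : x < y -> ~ gapQ x y -> gapQ x x' -> gapQ y y' ->
  x' < y'.
Proof.
move=> xy ngap xx' yy'; have [z fz /andP[xz zy]] := not_gapQ xy ngap.
have [h1 h2] := xx' z fz; have [h3 h4] := yy' z fz.
have x'z : x' <= z by rewrite leNgt -h1 -leNgt.
have zy' : z <= y' by rewrite leNgt -h4 -leNgt.
rewrite lt_neqAle (le_trans x'z zy') andbT; apply/eqP => e; apply: ngap.
by apply: gapQ_trans xx' _; rewrite e; exact: gapQ_sym.
Qed.

End gaps.

Section common_conjugate.
Variables (f : autQ) (K : set autQ).
Hypothesis alt_f : alternatingQ f.
Hypothesis fin_f : finitely_many_fixed_points f.
Hypothesis finA : forall x, finite_set [set k x | k in K].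
Hypothesis finB : forall x, finite_set [set (k^-1)%g x | k in K].
Hypothesis K_fix : forall k x, K k -> f x = x -> k x = x.

Let s x := x < f x.
Let labels (I : set rat) : set rat := [set z | I z /\ repQ f z = z].

Definition region_solution (I : set rat) (gl : (rat -> rat) * (autQ -> rat -> rat)) :=
  [/\ forall y, I y -> I (gl.1 y),
      forall y y', I y -> I y' -> y < y' -> gl.1 y < gl.1 y',
      forall v, I v -> exists2 y, I y & gl.1 y = v &
      forall k, K k ->
        [/\ forall y, I y -> labels I (gl.2 k y) /\
              if s (gl.2 k y) then y < k (gl.1 y) else k (gl.1 y) < y,
            forall y y', I y -> I y' -> y < y' -> gl.2 k y <= gl.2 k y',
            forall O, labels I O -> exists2 y, I y & gl.2 k y = O &
            forall R : rat -> rat -> Prop,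
              (forall x y z, R x y -> R y z -> R x z) ->
              (forall y y', I y -> I y' -> y < y' ->
                 y' <= k (gl.1 y) \/ k (gl.1 y') <= y -> R y y') ->
              forall y y', I y -> I y' -> y < y' ->
                gl.2 k y = gl.2 k y' -> R y y']].

(** Here the finiteness of the fixed points enters: a non-fixed point has none of them nearby, hence
    its gap has neither a first nor a last point, as the construction on a region requires. *)
Let nearby y : f y <> y -> (exists2 c, gapQ f y c & y < c) /\
  (exists2 c, gapQ f y c & c < y).
Proof.
move=> ny; split.
  have [|c [h1 h2 h3]] := @finite_pick_above (fixed_points f) y (y + 1) fin_f.
    lra.
  exists c => // z fz; have [yz|zy|e] := ltgtP y z; last by rewrite e in ny.
    have cz := h3 z fz yz; rewrite (lt_gtF cz) cz.
    by split=> //; apply/esym/negbTE; rewrite -leNgt ltW.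
  by rewrite (lt_trans zy h1) (lt_gtF (lt_trans zy h1)).
have [|c [h1 h2 h3]] := @finite_pick_below (fixed_points f) (y - 1) y fin_f.
  lra.
exists c => // z fz; have [yz|zy|e] := ltgtP y z; last by rewrite e in ny.
  by rewrite (lt_trans h2 yz) (lt_gtF (lt_trans h2 yz)).
by have zc := h3 z fz zy; rewrite (lt_gtF zc) zc.
Qed.

Let sg_s x : f x <> x -> sgQ f x = if s x then 1 else -1.
Proof.
move=> nx; rewrite /s; case: ltgtP => [h|h|h].
- by apply/eqP; rewrite sgQ1.
- by apply/eqP; rewrite sgQN1.
- by rewrite -h in nx.
Qed.

Lemma region_solution_exists x0 : f x0 <> x0 ->
  exists gl, region_solution (gapQ f x0) gl.
Proof.
move=> nx0; set I := gapQ f x0.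
have nI x : I x -> f x <> x by exact: gapQ_not_fixed.
have Irep x : I x -> labels I (repQ f x).
  move=> Ix; split; last exact: repQK.
  by apply: gapQ_trans Ix _; apply: gapQ_orbital; exact: repQ_orbital.
have [] := @region_construction autQ (fun k => k) (fun k => (k^-1)%g) s (labels I) I
  _ _ _ K finA finB _ _ _ _ _ (repQ f x0) x0.
- by move=> k x y; exact: autQ_lt.
- by move=> k x; exact: autQ_invr.
- move=> x y [Ix rx] [Iy ry] xy e.
  have nxy : ~ orbital f x y by move=> /repQ_eq; rewrite rx ry => E; rewrite E ltxx in xy.
  have [||z [/andP[h1 h2] h3]] := alt_f xy nxy.
  + by rewrite !sg_s ?e //; exact: nI.
  + by rewrite sg_s; [case: ifP; lra|exact: nI].
  have Iz : I z by apply: gapQ_convex Ix Iy _; rewrite !ltW.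
  exists (repQ f z); split; first exact: Irep.
  + apply: (orbital_ltW (f := f) _ h1 (orbital_refl _ _) (repQ_orbital _ _)).
    by move=> /sgQ_orbital E; exact: h3.
  + apply: (orbital_ltW (f := f) _ h2 (repQ_orbital _ _) (orbital_refl _ _)).
    move=> /sgQ_orbital E; apply: h3; rewrite E !sg_s ?e //; exact: nI.
  + apply/eqP => E; apply: h3; rewrite (sgQ_orbital (repQ_orbital f z)).
    rewrite !sg_s ?E //; apply: nI => //; exact: (Irep _ Iz).1.
- by move=> x y z; exact: gapQ_convex.
- move=> x Ix; have [[c xc ltc] _] := nearby (nI _ Ix).
  by exists c => //; exact: gapQ_trans Ix xc.
- move=> x Ix; have [_ [c xc ltc]] := nearby (nI _ Ix).
  by exists c => //; exact: gapQ_trans Ix xc.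
- by move=> k x Kk Ix; apply: gapQ_trans Ix _; apply: gapQ_aut => z; exact: K_fix.
- by move=> k x Kk Ix; apply: gapQ_trans Ix _; apply: gapQ_autV => z; exact: K_fix.
- by apply: Irep; exact: gapQ_refl.
- exact: gapQ_refl.
by move=> g [lab h]; exists (g, lab).
Qed.

Theorem common_conjugate :
  exists g : autQ, forall k, K k -> exists h : autQ, (g * k)%g = (f ^ h)%g.
Proof.
(* The solution is chosen for the gap as a set, so that all points of one gap share it. *)
have /choice[GL GLP] : forall I : set rat, exists gl,
    forall x0, f x0 <> x0 -> I = gapQ f x0 -> region_solution I gl.
  move=> I; have [[x0 [nx0 ->]]|h] := pselect (exists x0, f x0 <> x0 /\ I = gapQ f x0).
    by have [gl h] := region_solution_exists nx0; exists gl.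
  by exists (id, fun=> id) => x0 nx0 e; exfalso; apply: h; exists x0.
have sol x : f x <> x -> region_solution (gapQ f x) (GL (gapQ f x)).
  by move=> nx; exact: GLP nx erefl.
pose G x := if f x == x then x else (GL (gapQ f x)).1 x.
have G_fix x : f x = x -> G x = x by move=> fx; rewrite /G fx eqxx.
have G_nfix x : f x <> x -> G x = (GL (gapQ f x)).1 x.
  by move=> /eqP/negbTE fx; rewrite /G fx.
have G_gap x : gapQ f x (G x).
  have [fx|nx] := pselect (f x = x); first by rewrite G_fix.
  by rewrite G_nfix //; have [h _ _ _] := sol x nx; apply: h; exact: gapQ_refl.
have G_homo : {homo G : x y / x < y}.
  move=> x y xy; have [gxy|ngxy] := pselect (gapQ f x y); last first.
    exact: gapQ_sep xy ngxy (G_gap x) (G_gap y).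
  have nx : f x <> x.
    by move=> fx; move: xy; rewrite (gapQ_fixed fx gxy) ltxx.
  rewrite !G_nfix //; last exact: gapQ_not_fixed gxy.
  by rewrite -(gapQ_eq gxy); have [_ h _ _] := sol x nx; apply: h.
have G_surj v : exists y, G y = v.
  have [fv|nv] := pselect (f v = v); first by exists v; exact: G_fix.
  have [_ _ h _] := sol v nv; have [y vy yv] := h v (@gapQ_refl f v).
  by exists y; rewrite G_nfix -?(gapQ_eq vy) //; exact: gapQ_not_fixed vy.
have [g gE] := autQ_of_incr_surj G_homo G_surj.
exists g => k Kk.
have kfix z : f z = z -> k z = z by exact: K_fix.
(* The solution labels the arguments of [g], and [g * k] applies [g] at [k x]; hence the label of
   [x] is read at [k x]. *)
pose psi x := if f x == x then x else (GL (gapQ f x)).2 k (k x).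
have psi_fix x : f x = x -> psi x = x by move=> fx; rewrite /psi fx eqxx.
have psi_nfix x : f x <> x -> psi x = (GL (gapQ f x)).2 k (k x).
  by move=> /eqP/negbTE fx; rewrite /psi fx.
have psi_lab x : f x <> x -> labels (gapQ f x) (psi x) /\
    if s (psi x) then k x < k (g (k x)) else k (g (k x)) < k x.
  move=> nx; rewrite psi_nfix //; have [_ _ _ /(_ k Kk)[h _ _ _]] := sol x nx.
  have xk : gapQ f x (k x) by exact: gapQ_aut.
  have := h (k x) xk; rewrite !gE G_nfix -?(gapQ_eq xk) //.
  exact: gapQ_not_fixed xk.
have psi_gap x : gapQ f x (psi x).
  have [fx|nx] := pselect (f x = x); first by rewrite psi_fix.
  by have [[]] := psi_lab x nx.
have [] := @conjugate_of_labelling (g * k)%g f psi alt_f.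
- move=> x y; rewrite le_eqVlt => /predU1P[->//|xy].
  have [gxy|ngxy] := pselect (gapQ f x y); last first.
    by apply: ltW; exact: gapQ_sep xy ngxy (psi_gap x) (psi_gap y).
  have nx : f x <> x.
    by move=> fx; move: xy; rewrite (gapQ_fixed fx gxy) ltxx.
  rewrite !psi_nfix //; last exact: gapQ_not_fixed gxy.
  rewrite -(gapQ_eq gxy); have [_ _ _ /(_ k Kk)[_ h _ _]] := sol x nx.
  apply: h; rewrite ?autQ_lt //; first exact: gapQ_aut.
  by apply: gapQ_trans gxy _; exact: gapQ_aut.
- move=> x; have [fx|nx] := pselect (f x = x); last by have [[]] := psi_lab x nx.
  rewrite psi_fix //; apply: (orbital_fix fx); exact: repQ_orbital.
- move=> x; have [fx|nx] := pselect (f x = x).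
    rewrite psi_fix //; transitivity (0 : rat); apply/eqP; last first.
      by rewrite eq_sym sgQ0 fx.
    by rewrite sgQ0 autQ_mulE kfix // gE G_fix.
  have npsi : f (psi x) <> psi x by exact: gapQ_not_fixed (psi_gap x).
  have [_] := psi_lab x nx; rewrite (sg_s npsi) !autQ_lt; case: ifP => _ h; apply/eqP.
    by rewrite sgQ1 autQ_mulE.
  by rewrite sgQN1 autQ_mulE.
- move=> z; have [fz|nz] := pselect (f z = z).
    exists z; rewrite psi_fix //; apply/esym/(orbital_fix fz); exact: repQ_orbital.
  have [_ _ _ /(_ k Kk)[_ _ h _]] := sol z nz.
  have [|y zy yz] := h (repQ f z).
    by split; [apply: gapQ_orbital; exact: repQ_orbital|exact: repQK].
  have yk : gapQ f z ((k^-1)%g y) by apply: gapQ_trans zy _; exact: gapQ_autV.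
  exists ((k^-1)%g y); rewrite psi_nfix; last exact: gapQ_not_fixed yk.
  by rewrite -(gapQ_eq yk) autQ_invr.
- have main x y : x < y -> psi x = psi y -> orbital (g * k)%g x y.
    move=> xy e; have gxy : gapQ f x y.
      by apply: gapQ_trans (psi_gap x) _; rewrite e; apply: gapQ_sym.
    have nx : f x <> x.
      by move=> fx; move: xy; rewrite (gapQ_fixed fx gxy) ltxx.
    have ny : f y <> y by exact: gapQ_not_fixed gxy.
    move: e; rewrite !psi_nfix // -(gapQ_eq gxy) => e.
    have [_ _ _ /(_ k Kk)[_ _ _ h]] := sol x nx.
    (* The abstract relation becomes: the preimages under [k] lie in one orbital of [g * k]. A link
       places one of the two preimages between the other and its image under [g * k]. *)
    have := h (fun u w => orbital (g * k)%g ((k^-1)%g u) ((k^-1)%g w)) _ _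
      (k x) (k y) _ _ _ e.
    rewrite !autQ_invl; apply.
    + by move=> u v w; exact: orbital_trans.
    + move=> u w xu xw uw.
      have gu v : gapQ f x v -> (GL (gapQ f x)).1 v = (g * k)%g ((k^-1)%g v).
        move=> xv; rewrite autQ_mulE autQ_invr gE G_nfix -?(gapQ_eq xv) //.
        exact: gapQ_not_fixed xv.
      rewrite !gu // => -[hl|hl].
        apply: (orbital_convex (orbital_step _ _)).
        by rewrite autQ_le ltW //= autQ_invle.
      apply: orbital_sym; apply: orbital_trans (orbital_step _ _) _.
      apply: (orbital_convex (orbital_sym (orbital_step _ _))).
      by rewrite autQ_leinv hl autQ_le ltW.
    + exact: gapQ_aut.
    + by apply: gapQ_trans gxy _; exact: gapQ_aut.
    + by rewrite autQ_lt.
  move=> x y e; have [xy|yx|->] := ltgtP x y; [exact: main| |exact: orbital_refl].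
  by apply: orbital_sym; exact: main.
by move=> h hE; exists h.
Qed.

End common_conjugate.

(** * Compactness and tightness *)

Section autQ_topology.

Lemma nbhs_finite_agree (f : autQ) (S : set rat) : finite_set S ->
  nbhs f [set g : autQ | forall x, S x -> g x = f x].
Proof.
move=> /finite_seqP[l ->]; elim: l => [|x l IH].
  by apply: filterS filterT => g _ x.
apply: filterS (filterI (autQ_nbhs1 f x) IH) => g [gx gl] y /=.
by rewrite inE => /predU1P[->//|]; exact: gl.
Qed.

Lemma open_agree (f : autQ) (S : set rat) : finite_set S ->
  open [set g : autQ | forall x, S x -> g x = f x].
Proof.
move=> fS; rewrite openE => g gf; rewrite /interior.
by apply: filterS (nbhs_finite_agree g fS) => h hg x Sx; rewrite hg // gf.
Qed.

Lemma open_eval (x y : rat) : open [set g : autQ | g x = y].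
Proof.
rewrite openE => g gx; rewrite /interior.
by apply: filterS (autQ_nbhs1 g x) => h /= ->.
Qed.

Lemma compact_finite_eval (K : set autQ) x : compact K ->
  finite_set [set k x | k in K].
Proof.
rewrite compact_cover => /(_ rat setT (fun y => [set g : autQ | g x = y])).
case=> [y _|k _|D _ KD]; [exact: open_eval|by exists (k x)|].
apply: sub_finite_set (finite_fset D).
by move=> _ [k Kk <-]; have [y yD /= ->] := KD k Kk.
Qed.

Lemma compact_finite_evalV (K : set autQ) x : compact K ->
  finite_set [set (k^-1)%g x | k in K].
Proof.
rewrite compact_cover => /(_ rat setT (fun y => [set g : autQ | g y = x])).
case=> [y _|k _|D _ KD]; [exact: open_eval| |].
  by exists ((k^-1)%g x) => //=; rewrite autQ_invr.
apply: sub_finite_set (finite_fset D).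
by move=> _ [k Kk <-]; have [y yD /= <-] := KD k Kk; rewrite autQ_invl.
Qed.

End autQ_topology.

(** * Translating families with finite value sets into a conjugacy class *)

Definition classQ (f : autQ) : set autQ := [set (f ^ g)%g | g in setT].

Lemma translate_into_class (f h0 : autQ) (K : set autQ) :
  alternatingQ f -> finitely_many_fixed_points f ->
  (forall x, finite_set [set k x | k in K]) ->
  (forall x, finite_set [set (k^-1)%g x | k in K]) ->
  (forall k x, K k -> f x = x -> k x = h0 x) ->
  exists g, translate g K 1%g `<=` classQ f.
Proof.
move=> alt_f fin_f finA finB Kh.
pose K' := [set (h0^-1 * k)%g | k in K].
have [x|x|k x [k0 Kk0 <-] fx|g gP] := @common_conjugate f K' alt_f fin_f.
- apply: sub_finite_set (finite_image (h0^-1)%g (finA x)).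
  by move=> _ [_ [k Kk <-] <-]; exists (k x) => //; exists k.
- apply: sub_finite_set (finB (h0 x)).
  move=> _ [_ [k Kk <-] <-]; exists k => //.
  by rewrite invgM invgK.
- by rewrite autQ_mulE (Kh _ _ Kk0 fx) autQ_invl.
exists (g * h0^-1)%g => _ [k Kk <-]; rewrite mulg1 -mulgA.
have [|h ->] := gP (h0^-1 * k)%g; first by exists k.
by exists h.
Qed.

Lemma class_compact_biter (f : autQ) :
  alternatingQ f -> finitely_many_fixed_points f -> compact_biter (classQ f).
Proof.
move=> alt_f fin_f K cK [h0 Kh0].
pose U := [set k : autQ | forall x, fixed_points f x -> k x = h0 x].
have [x|x|k x [Uk _] fx|g gP] := @translate_into_class f h0 (U `&` K) alt_f fin_f.
- apply: sub_finite_set (compact_finite_eval x cK).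
  by move=> _ [k [_ Kk] <-]; exists k.
- apply: sub_finite_set (compact_finite_evalV x cK).
  by move=> _ [k [_ Kk] <-]; exists k.
- exact: Uk.
exists U, g, 1%g; split=> //; first exact: open_agree.
by exists h0.
Qed.

Lemma class_compact_catcher (f : autQ) :
  alternatingQ f -> fixed_points f = set0 -> compact_catcher (classQ f).
Proof.
move=> alt_f fix_f K cK.
have [|x|x|k x _ fx|g gP] := @translate_into_class f 1%g K alt_f.
- by rewrite /finitely_many_fixed_points fix_f.
- exact: compact_finite_eval.
- exact: compact_finite_evalV.
- by have : fixed_points f x by []; rewrite fix_f.
by exists g, 1%g.
Qed.

(** * Countable operations on measurable sets and Borel sets of automorphisms *)

Section countable_measurability.
Context (d : measure_display) (T : measurableType d).
Implicit Types (A B : set T).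

Lemma measurable_cstprop (Q : Prop) : measurable [set _ : T | Q].
Proof.
have [q|q] := pselect Q.
  by rewrite (_ : [set _ | _] = setT); [exact: measurableT|apply/seteqP; split].
by rewrite (_ : [set _ | _] = set0); [exact: measurable0|apply/seteqP; split].
Qed.

Lemma measurable_existsC (I : countType) (A : I -> set T) :
  (forall i, measurable (A i)) -> measurable [set x | exists i, A i x].
Proof.
move=> mA; rewrite (_ : [set x | _] = \bigcup_i A i); last first.
  by apply/seteqP; split=> x [i]; [exists i|move=> _ ?; exists i].
by apply: countable_bigcupT_measurable => //; exact: countableP.
Qed.

Lemma measurable_notC A : measurable A -> measurable [set x | ~ A x].
Proof. exact: measurableC. Qed.

Lemma measurable_forallC (I : countType) (A : I -> set T) :
  (forall i, measurable (A i)) -> measurable [set x | forall i, A i x].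
Proof.
move=> mA.
rewrite (_ : [set x | _] = [set x | ~ exists i, (~` A i) x]).
  by apply: measurable_notC; apply: measurable_existsC => i; exact: measurableC.
apply/seteqP; split=> x /= h; first by case=> i; apply; exact: h.
by move=> i; apply: contrapT => nA; apply: h; exists i.
Qed.

Lemma measurable_implyC A B : measurable A -> measurable B ->
  measurable [set x | A x -> B x].
Proof.
move=> mA mB; rewrite (_ : [set x | _] = ~` A `|` B).
  by apply: measurableU => //; exact: measurableC.
apply/seteqP; split=> x /= h; last by case: h.
by have [Ax|nAx] := pselect (A x); [right; exact: h|left].
Qed.

Lemma negligible_countable (R : realFieldType) (mu : {measure set T -> \bar R})
    (I : countType) (A : I -> set T) :
  (forall i, mu.-negligible (A i)) -> mu.-negligible [set x | exists i, A i x].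
Proof.
move=> nA.
pose F n := if unpickle n is Some i then A i else set0.
apply: (@negligibleS _ _ _ _ (\bigcup_n F n)).
  by move=> x [i Aix]; exists (pickle i) => //; rewrite /F pickleK.
apply: negligible_bigcup => n; rewrite /F; case: (unpickle n) => [i|]; first exact: nA.
exact: negligible_set0.
Qed.

End countable_measurability.

Notation borelQ := (g_sigma_algebraType (@open autQ)).

Lemma measurable_open (A : set autQ) : open A -> measurable (A : set borelQ).
Proof. by move=> oA; apply: sub_sigma_algebra. Qed.

Lemma continuous_borel (phi : autQ -> autQ) : continuous phi ->
  measurable_fun setT (phi : borelQ -> borelQ).
Proof.
move=> cphi; apply: (@measurability _ _ borelQ borelQ setT phi (@open autQ)) => //.
move=> _ [A oA <-]; rewrite setTI; apply: measurable_open.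
by move/continuousP: cphi; exact.
Qed.

Lemma translateE (g h : autQ) (B : set autQ) :
  translate g B h = (fun x => (g^-1 * x * h^-1)%g) @^-1` B.
Proof.
apply/seteqP; split=> [_ [x Bx <-]|x Bx] /=.
  by rewrite !mulgA mulVg mul1g mulgK.
exists (g^-1 * x * h^-1)%g => //.
by rewrite !mulgA mulgV mul1g mulgVK.
Qed.

Lemma measurable_translate (g h : autQ) (B : set autQ) :
  measurable (B : set borelQ) -> measurable (translate g B h : set borelQ).
Proof.
move=> mB; rewrite translateE -[X in measurable X]setTI.
have c : continuous (fun x : autQ => (g^-1 * x * h^-1)%g : autQ).
  move=> x; have FF := @nbhs_filter autQ x; apply: autQ_cvg => y /=.
  apply: filterS (autQ_nbhs1 x ((h^-1)%g y)) => z /= e.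
  by rewrite /= e.
exact: (continuous_borel c).
Qed.

Lemma measurable_eval (x y : rat) :
  measurable ([set g : autQ | g x = y] : set borelQ).
Proof. by apply: measurable_open; exact: open_eval. Qed.

Lemma measurable_eval_pred (Q : pred rat) x :
  measurable ([set g : autQ | Q (g x)] : set borelQ).
Proof.
rewrite (_ : [set g | _] = \bigcup_(y : rat) ([set g : autQ | g x = y] `&` [set g | Q y])).
  apply: bigcupT_measurable_rat => y; apply: measurableI; first exact: measurable_eval.
  exact: measurable_cstprop.
apply/seteqP; split=> g; first by move=> Qg; exists (g x).
by move=> [y _ [/= -> ]].
Qed.

Lemma measurable_evalV_pred (Q : pred rat) x :
  measurable ([set g : autQ | Q ((g^-1)%g x)] : set borelQ).
Proof.
rewrite -[X in measurable X]setTI.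
exact: (continuous_borel autQ_inv_continuous measurableT (measurable_eval_pred Q x)).
Qed.

Lemma measurable_evals (xs ys : seq rat) :
  measurable ([set g : autQ | map g xs = ys] : set borelQ).
Proof.
elim: xs ys => [|x xs IH] [|y ys].
- by rewrite /=; exact: measurable_cstprop.
- by rewrite /=; exact: measurable_cstprop.
- by rewrite (_ : [set _ | _] = set0); [exact: measurable0|apply/seteqP; split].
rewrite (_ : [set _ | _] =
    [set g : autQ | g x = y] `&` [set g : autQ | map g xs = ys]).
  by apply: measurableI; [exact: measurable_eval|exact: IH].
by apply/seteqP; split=> g /=; [case|case=> -> ->].
Qed.

(** * Tightness of Borel probability measures *)

Section tightness.
Variables (R : realType) (mu : probability borelQ R).

Local Open Scope ereal_scope.

(** Of compactness only the finiteness of the value sets of [k] and of its inverse is kept, which is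
    all that [translate_into_class] asks for. *)
Lemma tight_autQ : exists K : set borelQ,
  [/\ measurable K, mu K != 0,
      forall x, finite_set [set (k : autQ) x | k in K] &
      forall x, finite_set [set ((k : autQ)^-1)%g x | k in K]].
Proof.
pose q n : rat := odflt 0%R (unpickle n).
pose A n m : set borelQ := [set k : autQ | (m <= pickle (k (q n)))%N] `|`
  [set k : autQ | (m <= pickle ((k^-1)%g (q n)))%N].
have mA n m : measurable (A n m).
  apply: measurableU; first exact: (measurable_eval_pred (fun y => (m <= pickle y)%N)).
  exact: (measurable_evalV_pred (fun y => (m <= pickle y)%N)).
have capA n : \bigcap_m A n m = set0.
  rewrite -subset0 => k kA.
  have [] := kA (maxn (pickle ((k : autQ) (q n))) (pickle (((k : autQ)^-1)%g (q n)))).+1 I.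
  - by rewrite /= leqNgt ltnS leq_maxl.
  - by rewrite /= leqNgt ltnS leq_maxr.
have small n (e : R) : (0 < e)%R -> exists m, mu (A n m) <= e%:E.
  move=> e0.
  have cv : mu (A n m) @[m --> \oo] --> 0.
    rewrite -(measure0 mu) -(capA n); apply: nonincreasing_cvg_mu => //.
    - by rewrite (le_lt_trans (probability_le1 _ _)) ?ltry.
    - by rewrite capA.
    - move=> i j ij; rewrite subsetEset => k [] /= h; [left|right];
        exact: leq_trans ij h.
  have fc : fine (mu (A n m)) @[m --> \oo] --> (0 : R)%R by exact: fine_cvg.
  have [N _ /(_ N (leqnn N))] := (cvgrPdist_le _ _).1 fc e e0.
  rewrite /= sub0r normrN => h; exists N.
  rewrite -[mu _]fineK ?fin_num_measure // lee_fin; exact: le_trans (ler_norm _) h.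
(* The allowances (1/2) / 2^(n+1) sum to 1/2, so the complement of [Bad] keeps at least half of the
   mass. *)
have /choice[m mP] n : exists m, mu (A n m) <= ((1/2)%R / (2 ^ n.+1)%:R)%:E.
  by apply: small; rewrite divr_gt0 // ltr0n expn_gt0.
pose Bad := \bigcup_n A n (m n).
have mBad : measurable Bad by apply: bigcupT_measurable => n; exact: mA.
have Bad_le : mu Bad <= (1/2)%:E.
  apply: le_trans (epsilon_trick0 predT (_ : (0 <= 1/2)%R)); last by [].
  apply: le_trans (measure_sigma_subadditive mu _ mBad (@subset_refl _ _)) _.
    by move=> n; exact: mA.
  by apply: lee_nneseries => n _ //; exact: mP.
have notBad k n : (~` Bad) k -> (pickle ((k : autQ) (q n)) < m n)%N /\
    (pickle (((k : autQ)^-1)%g (q n)) < m n)%N.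
  by move=> nk; split; rewrite ltnNge; apply/negP => h; apply: nk; exists n => //;
    [left|right].
have qP x : q (pickle x) = x by rewrite /q pickleK.
exists (~` Bad); split.
- exact: measurableC.
- rewrite probability_setC //; apply/eqP => e.
  move: Bad_le; rewrite -[mu Bad]fineK ?fin_num_measure // lee_fin.
  move: e; rewrite -[mu Bad]fineK ?fin_num_measure // -EFinB => -[]; lra.
- move=> x; apply: sub_finite_set (finite_pickle_lt (m (pickle x))).
  by move=> _ [k /(notBad k (pickle x))[+ _] <-]; rewrite qP.
- move=> x; apply: sub_finite_set (finite_pickle_lt (m (pickle x))).
  by move=> _ [k /(notBad k (pickle x))[_ +] <-]; rewrite qP.
Qed.

End tightness.

(** [K] is cut into countably many pieces by the values at the fixed points of [f], and one piece
    has positive measure. A translate of this piece lies in the class, so some translate of any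
    Borel set containing the class has positive measure. *)
Lemma class_not_haar_null (R : realType) (f : autQ) :
  alternatingQ f -> finitely_many_fixed_points f -> ~ haar_null R (classQ f).
Proof.
move=> alt_f fin_f [B [bB [mu muB]] fB].
have [K [mK K0 finA finB]] := tight_autQ mu.
have /finite_seqP[qs qsE] := fin_f.
pose L (s : seq rat) : set borelQ := [set k : autQ | map k qs = s].
have mL s : measurable (L s) by exact: measurable_evals.
have [s KLs] : exists s, mu (K `&` L s) != 0%E.
  apply: contrapT => /forallNP h; move/negP: K0; apply; apply/eqP.
  apply: (measure_negligible mK).
  pose sq n : seq rat := odflt [::] (unpickle n).
  apply: (@negligibleS _ _ _ mu (\bigcup_n (K `&` L (sq n)))).
    move=> k Kk; exists (pickle (map (k : autQ) qs)) => //; split=> //.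
    by rewrite /sq pickleK.
  apply: negligible_bigcup => n; exists (K `&` L (sq n)); split=> //.
    exact: measurableI.
  by have /negP/negPn/eqP := h (sq n).
have [[h0 [Kh0 Lh0]]|nh] := pselect (exists k, (K `&` L s) k); last first.
  move/eqP: KLs; apply; rewrite (_ : K `&` L s = set0) ?measure0 //.
  by rewrite -subset0 => k kK; apply: nh; exists k.
have [x|x|k x [_ Lk] fx|g gP] := @translate_into_class f h0 (K `&` L s) alt_f fin_f.
- by apply: sub_finite_set (finA x) => _ [k [Kk _] <-]; exists k.
- by apply: sub_finite_set (finB x) => _ [k [Kk _] <-]; exists k.
- have xq : x \in qs by have : fixed_points f x by []; rewrite qsE.
  have e : map (k : autQ) qs = map (h0 : autQ) qs by rewrite [LHS]Lk [RHS]Lh0.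
  have := congr1 (nth 0 ^~ (index x qs)) e.
  by rewrite !(nth_map 0) ?index_mem // nth_index.
move/eqP: KLs; apply.
apply: (@subset_measure0 _ _ _ mu _ (translate (g^-1)%g B 1%g)).
- exact: measurableI.
- exact: measurable_translate.
- move=> k kKL; rewrite translateE /= invgK invg1 mulg1; apply: fB.
  by have := gP (g * k)%g; apply; exists k => //; rewrite mulg1.
- exact: muB.
Qed.

(** * Bands of bi-Lipschitz functions *)

Section bands.
Implicit Types (F U G : rat -> rat) (D : seq rat).

(** The upper constant lets values be approximated on a grid; the lower one leaves room for a
    perturbation of smaller slope without losing monotonicity. The class is closed under minima,
    maxima and convex combinations. *)
Definition bilip F := exists l L : rat, [/\ 0 < l, 0 < L &
  forall x y, x <= y -> l * (y - x) <= F y - F x <= L * (y - x)].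

(** Strict inequality at every rational would not prevent the functions from coming together at an
    irrational point; hence the bound is uniform on each interval that avoids [D]. *)
Definition gapped D F U := forall a b, (forall d, d \in D -> ~~ (a <= d <= b)) ->
  exists2 e, 0 < e & forall z, a <= z <= b -> F z + e <= U z.

Definition band D F U := [/\ bilip F, bilip U,
  forall d, d \in D -> F d = U d & gapped D F U].

Lemma bilip_lt F x y : bilip F -> x < y -> F x < F y.
Proof.
move=> [l [L [l0 L0 h]]] xy; have /andP[h1 _] := h _ _ (ltW xy).
by rewrite -subr_gt0; apply: lt_le_trans h1; rewrite mulr_gt0 // subr_gt0.
Qed.

Lemma bilip_ltE F x y : bilip F -> (F x < F y) = (x < y).
Proof.
move=> bF; have [xy|yx|->] := ltgtP x y; last by rewrite ltxx.
- exact: bilip_lt.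
- by apply: lt_gtF; exact: bilip_lt.
Qed.

Lemma bilip_min F G : bilip F -> bilip G -> bilip (fun z => Num.min (F z) (G z)).
Proof.
move=> [l [L [l0 L0 h]]] [l' [L' [l0' L0' h']]].
exists (Num.min l l'), (Num.max L L'); split.
- by rewrite lt_min l0.
- by rewrite lt_max L0.
move=> x y xy; have /andP[h1 h2] := h _ _ xy; have /andP[h3 h4] := h' _ _ xy.
have yx : 0 <= y - x by rewrite subr_ge0.
have a1 : Num.min l l' * (y - x) <= l * (y - x) by rewrite ler_wpM2r // ge_min lexx.
have a2 : Num.min l l' * (y - x) <= l' * (y - x).
  by rewrite ler_wpM2r // ge_min lexx orbT.
have a3 : L * (y - x) <= Num.max L L' * (y - x) by rewrite ler_wpM2r // le_max lexx.
have a4 : L' * (y - x) <= Num.max L L' * (y - x).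
  by rewrite ler_wpM2r // le_max lexx orbT.
by apply/andP; split; (have [?|?] := ltP (F x) (G x));
  (have [?|?] := ltP (F y) (G y)); lra.
Qed.

Lemma bilip_opp F : bilip F -> bilip (fun z => - F (- z)).
Proof.
move=> [l [L [l0 L0 h]]]; exists l, L; split=> // x y xy.
have /andP[h1 h2] := h (- y) (- x) ltac:(by rewrite lerN2).
by apply/andP; split; lra.
Qed.

Lemma bilip_max F G : bilip F -> bilip G -> bilip (fun z => Num.max (F z) (G z)).
Proof.
move=> /bilip_opp bF /bilip_opp bG; have := bilip_opp (bilip_min bF bG).
suff -> : (fun z => - Num.min (- F (- - z)) (- G (- - z))) =
  (fun z => Num.max (F z) (G z)) by [].
by apply/funext => z; rewrite opprK oppr_min !opprK.
Qed.

Lemma bilip_comb F G c : 0 <= c -> c <= 1 -> bilip F -> bilip G ->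
  bilip (fun z => F z + c * (G z - F z)).
Proof.
move=> c0 c1 [l [L [l0 L0 h]]] [l' [L' [l0' L0' h']]].
exists (Num.min l l'), (Num.max L L'); split.
- by rewrite lt_min l0.
- by rewrite lt_max L0.
move=> x y xy; have /andP[h1 h2] := h _ _ xy; have /andP[h3 h4] := h' _ _ xy.
have yx : 0 <= y - x by rewrite subr_ge0.
have a1 : Num.min l l' * (y - x) <= l * (y - x) by rewrite ler_wpM2r // ge_min lexx.
have a2 : Num.min l l' * (y - x) <= l' * (y - x).
  by rewrite ler_wpM2r // ge_min lexx orbT.
have a3 : L * (y - x) <= Num.max L L' * (y - x) by rewrite ler_wpM2r // le_max lexx.
have a4 : L' * (y - x) <= Num.max L L' * (y - x).
  by rewrite ler_wpM2r // le_max lexx orbT.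
set A := Num.min _ _ * _ in a1 a2 *; set B := Num.max _ _ * _ in a3 a4 *.
have -> : F y + c * (G y - F y) - (F x + c * (G x - F x)) =
  (1 - c) * (F y - F x) + c * (G y - G x) by ring.
have b1 : 0 <= (1 - c) * (F y - F x - A) by rewrite mulr_ge0 //; lra.
have b2 : 0 <= c * (G y - G x - A) by rewrite mulr_ge0 //; lra.
have b3 : 0 <= (1 - c) * (B - (F y - F x)) by rewrite mulr_ge0 //; lra.
have b4 : 0 <= c * (B - (G y - G x)) by rewrite mulr_ge0 //; lra.
by apply/andP; split; lra.
Qed.

Lemma band_le D F U z : band D F U -> F z <= U z.
Proof.
move=> [_ _ eqD sep]; have [zD|zD] := boolP (z \in D); first by rewrite eqD.
have [|e e0 h] := sep z z.
  move=> d dD; apply/negP; rewrite -eq_le => /eqP zd.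
  by rewrite zd dD in zD.
by have := h z; rewrite lexx => /(_ isT); lra.
Qed.

Lemma band_comb D F U c d : 0 <= c -> c < d -> d <= 1 -> band D F U ->
  band D (fun z => F z + c * (U z - F z)) (fun z => F z + d * (U z - F z)).
Proof.
move=> c0 cd d1 [bF bU eqD sep]; split.
- by apply: bilip_comb => //; lra.
- by apply: bilip_comb => //; lra.
- by move=> z /eqD->; rewrite subrr !mulr0.
move=> a b /sep[e e0 h]; exists ((d - c) * e).
  by rewrite mulr_gt0 // subr_gt0.
move=> z /h ez.
have : (d - c) * e <= (d - c) * (U z - F z) by rewrite ler_wpM2l; lra.
lra.
Qed.

Lemma band_freeze D F U y : band D F U ->
  exists2 U', (forall z, U' z <= U z) & band (y :: D) F U'.
Proof.
move=> bnd; have FU := fun z => band_le z bnd.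
have [bF bU eqD sep] := bnd; have [l [L [l0 L0 h]]] := bF.
(* The cone makes the new upper bound meet [F] at [y] and leaves a gap proportional to the distance
   from [y]; its slope, half the lower constant of [F], keeps [T] increasing. *)
pose T z := F z + l / 2 * `|z - y|.
have FT z : F z <= T z by rewrite lerDl mulr_ge0 //; lra.
have bT : bilip T.
  exists (l / 2), (L + l / 2); split; [lra|lra|] => u v uv.
  have /andP[h1 h2] := h _ _ uv.
  have n1 : `|v - y| <= `|u - y| + (v - u).
    by case: (ger0P (v - y)); case: (ger0P (u - y)); lra.
  have n2 : `|u - y| <= `|v - y| + (v - u).
    by case: (ger0P (v - y)); case: (ger0P (u - y)); lra.
  have m1 : 0 <= l * (`|u - y| + (v - u) - `|v - y|) by rewrite mulr_ge0 //; lra.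
  have m2 : 0 <= l * (`|v - y| + (v - u) - `|u - y|) by rewrite mulr_ge0 //; lra.
  by rewrite /T; apply/andP; split; lra.
exists (fun z => Num.min (U z) (T z)); first by move=> z; rewrite ge_min lexx.
split=> //; first exact: bilip_min.
- move=> d; rewrite inE => /predU1P[->|dD].
    by rewrite /T subrr normr0 mulr0 addr0 min_r.
  by rewrite -(eqD d dD) min_l.
move=> a b nD.
have [|e e0 he] := sep a b; first by move=> d dD; apply: nD; rewrite inE dD orbT.
have [ba|ab] := ltP b a.
  by exists 1 => // z /andP[az zb]; have := lt_le_trans ba (le_trans az zb); rewrite ltxx.
have [dl dl0 hdl] : exists2 dl, 0 < dl & forall z, a <= z <= b -> dl <= `|z - y|.
  have := nD y (mem_head _ _); rewrite negb_and -!ltNge => /orP[ya|by_].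
    exists (a - y); first by lra.
    by move=> z /andP[az zb]; apply: le_trans (ler_norm _); lra.
  exists (y - b); first by lra.
  by move=> z /andP[az zb]; rewrite distrC; apply: le_trans (ler_norm _); lra.
exists (Num.min e (l / 2 * dl)).
  by rewrite lt_min e0 mulr_gt0 //; lra.
move=> z abz; rewrite le_min; apply/andP; split.
  apply: le_trans (he z abz); by rewrite lerD2l ge_min lexx.
rewrite lerD2l ge_min; apply/orP; right.
by rewrite ler_wpM2l //; [lra|exact: hdl].
Qed.

Lemma bilip_approx F v e : bilip F -> 0 < e ->
  exists w1 w2, [/\ w1 < w2, F w1 <= v, v < F w2 & F w2 - F w1 < e].
Proof.
move=> [l [L [l0 L0 h]]] e0.
(* By the lower constant, F w0 <= F 0 - |F 0 - v| <= v. From there a grid of step e / (2 L) raises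
   [F] by at most e / 2 at a time; the first grid point where [F] exceeds [v] is taken with its
   predecessor. *)
pose w0 := - (`|F 0 - v| / l).
have w00 : w0 <= 0 by rewrite oppr_le0 divr_ge0 // ltW.
have Fw0 : F w0 <= v.
  have /andP[+ _] := h _ _ w00; rewrite sub0r opprK mulrC divfK ?gt_eqF //.
  have := ler_norm (F 0 - v); lra.
pose s := e / (2 * L).
have s0 : 0 < s by rewrite divr_gt0 //; lra.
have ex : exists n : nat, v < F (w0 + s * n%:R).
  have c0 : 0 <= `|v - F w0| / (l * s).
    by apply: divr_ge0 => //; rewrite ltW // mulr_gt0.
  have hn := archi_boundP c0; exists (Num.bound (`|v - F w0| / (l * s))).
  set m := Num.bound _ in hn *.
  have sm : 0 <= s * m%:R by rewrite mulr_ge0 // ltW.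
  have /andP[+ _] := h w0 (w0 + s * m%:R) ltac:(by rewrite lerDl).
  rewrite [w0 + _]addrC addrK.
  have ls : 0 < l * s by exact: mulr_gt0.
  move: hn; rewrite (ltr_pdivrMr _ _ ls) => hn.
  have := ler_norm (v - F w0); lra.
have [n hn nmin] := ex_minnP ex.
case: n hn nmin => [|n] hn nmin; first by move: hn; rewrite mulr0 addr0 ltNge Fw0.
exists (w0 + s * n%:R), (w0 + s * n.+1%:R); split=> //.
- by rewrite ltrD2l ltr_pM2l // ltr_nat.
- rewrite leNgt; apply/negP => /nmin; by rewrite ltnn.
have /andP[_] := h (w0 + s * n%:R) (w0 + s * n.+1%:R)
  ltac:(by rewrite lerD2l ler_pM2l // ler_nat).
have -> : w0 + s * n.+1%:R - (w0 + s * n%:R) = s by rewrite -natr1; ring.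
have -> : L * s = e / 2 by rewrite /s; field; lra.
lra.
Qed.

(** [F] need not take the value [v] at a rational. A rational [w] is found where [v] lies between
    [F] and the middle line [M]; [F] is raised to pass through (w, v) but not above [M], so that
    half of the gap to [U] remains, and the band is then frozen at [w]. *)
Lemma band_range D F U v : band D F U ->
  exists F' U' D', [/\ forall z, F z <= F' z, forall z, U' z <= U z,
    band D' F' U', {subset D <= D'} &
    exists w, [/\ w \in D', F' w = v & {subset D' <= w :: D}]].
Proof.
move=> bnd; have FU := fun z => band_le z bnd.
have [[d dD Fd]|nv] := pselect (exists2 d, d \in D & F d = v).
  exists F, U, D; split=> //; exists d; split=> // z zD.
  by rewrite inE zD orbT.
have [bF bU eqD sep] := bnd.
have [e0 e00 he0] : exists2 e, 0 < e & forall d, d \in D -> e <= `|F d - v|.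
  elim: (D) nv => [|d D' IH] nv; first by exists 1.
  have [|e e0 he] := IH.
    by move=> [d' d'D Fd']; apply: nv; exists d' => //; rewrite inE d'D orbT.
  exists (Num.min e `|F d - v|).
    rewrite lt_min e0 normr_gt0 subr_eq0; apply/eqP => Fd.
    by apply: nv; exists d => //; exact: mem_head.
  move=> d'; rewrite inE => /predU1P[->|/he h]; rewrite ge_min ?lexx ?orbT //.
  by rewrite h.
have [w1 [w2 [w12 Fw1 Fw2 Fw]]] := bilip_approx v bF e00.
(* On [w1, w2] the values of [F] are closer to [v] than its values at points of [D], so this
   interval avoids [D] and has a gap [e]. A point of it with F w > v - e / 2 satisfies v <= M w. *)
have [|e e_gt0 he] := sep w1 w2.
  move=> d dD; apply/negP => /andP[dw1 dw2].
  have a1 : F w1 <= F d by rewrite leNgt bilip_ltE // -leNgt.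
  have a2 : F d <= F w2 by rewrite leNgt bilip_ltE // -leNgt.
  have := he0 d dD; rewrite leNgt => /negP; apply.
  by rewrite ltr_norml; apply/andP; split; lra.
have e2 : 0 < e / 2 by lra.
have [u1 [u2 [u12 Fu1 Fu2 Fu]]] := bilip_approx v bF e2.
pose w := Num.max u1 w1.
have Fwv : F w <= v by rewrite /w /Num.max; case: ifP.
have Fwe : v - e / 2 < F w.
  have : F u1 <= F w by rewrite leNgt bilip_ltE // -leNgt /w le_max lexx.
  lra.
have ww : w1 <= w <= w2.
  apply/andP; split; first by rewrite /w le_max lexx orbT.
  by rewrite ltW // -(bilip_ltE _ _ bF) (le_lt_trans Fwv).
pose M z := F z + 1 / 2 * (U z - F z).
have FM z : F z <= M z by rewrite /M; have := FU z; lra.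
have Mw : v <= M w by have := he w ww; rewrite /M; lra.
have [|||_ _ eqM sepM] := band_comb (c := 1 / 2) (d := 1) _ _ _ bnd; [lra|lra|lra|].
pose P z := Num.max (F z) (Num.min (M z) (v + (z - w))).
have PM z : P z <= M z by rewrite /P ge_max FM ge_min lexx.
have FP z : F z <= P z by rewrite /P le_max lexx.
have Pw : P w = v by rewrite /P subrr addr0 min_r // max_r.
have bM : bilip M by apply: bilip_comb => //; lra.
have bP : bilip P.
  apply: bilip_max => //; apply: bilip_min => //.
  by exists 1, 1; split=> // x y xy; apply/andP; split; lra.
have bndP : band D P U.
  split=> //.
  - move=> d dD; apply/eqP; rewrite eq_le -{2}(eqD d dD) FP andbT.
    by apply: le_trans (PM d) _; rewrite /M (eqD d dD); lra.
  - move=> a b /sepM[e' e'0 h']; exists e' => // z /h'.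
    by have := PM z; rewrite /M; lra.
have [U' U'U bU'] := band_freeze w bndP.
exists P, U', (w :: D); split=> //.
  by move=> z zD; rewrite inE zD orbT.
by exists w; split=> //; exact: mem_head.
Qed.

End bands.

(** * The binary tree of bands and the increasing family of automorphisms *)

Record node := Node {
  nF : rat -> rat ;
  nU : rat -> rat ;
  nD : seq rat }.

(* [nF] and [nU] bound the automorphisms below the node, and [nD] is the set of
   points whose image is already decided. *)
Definition node_good m t := [/\ band (nD t) (nF t) (nU t),
  forall d, d \in nD t -> (pickle d < m)%N \/ (pickle (nF t d) < m)%N &
  forall x : rat, (pickle x < m)%N ->
    x \in nD t /\ exists2 w, w \in nD t & nF t w = x].

Definition node_sub t' t := (forall z, nF t z <= nF t' z /\ nU t' z <= nU t z) /\
  {subset nD t <= nD t'}.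

Lemma node_sub_trans t1 t2 t3 : node_sub t1 t2 -> node_sub t2 t3 -> node_sub t1 t3.
Proof.
move=> [h1 s1] [h2 s2]; split; last by move=> z /s2/s1.
move=> z; have [a1 a2] := h1 z; have [b1 b2] := h2 z.
by split; [exact: le_trans a1|exact: le_trans b2].
Qed.

Lemma node_sub_refl t : node_sub t t.
Proof. by split. Qed.

Lemma node_sub_eq m t t' d : node_good m t -> band (nD t') (nF t') (nU t') ->
  node_sub t' t -> d \in nD t -> nF t' d = nF t d.
Proof.
move=> [[_ _ e _] _ _] bt' [h _] dD; have [h1 h2] := h d.
by apply/eqP; rewrite eq_le h1 andbT (e d dD) (le_trans _ h2) // (band_le _ bt').
Qed.

(** A rational of index [m] is decided both as an argument and as a value. At most two points are
    added, each of index [m] itself or with an image of index [m]; this bookkeeping later bounds the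
    coincidences. *)
Lemma node_refine m t : node_good m t ->
  exists2 t', node_good m.+1 t' & node_sub t' t.
Proof.
move=> gt; have [bt Dt ct] := gt.
have [[x xm]|nx] := pselect (exists x : rat, pickle x = m); last first.
  exists t; last exact: node_sub_refl.
  split=> //; first by move=> d /Dt[] h; [left|right]; exact: ltn_trans h _.
  move=> y; rewrite ltnS leq_eqVlt => /predU1P[e|]; last exact: ct.
  by exfalso; apply: nx; exists y.
have [U1 U1U b1] := band_freeze x bt.
have [F' [U' [D' [FF UU b' sD [w [wD Fw Dw]]]]]] := band_range x b1.
pose t' := Node F' U' D'.
have st' : node_sub t' t.
  split=> [z|z zD]; first by split; [exact: FF|exact: le_trans (UU z) (U1U z)].
  by apply: sD; rewrite inE zD orbT.
have eqF d : d \in nD t -> F' d = nF t d.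
  by move=> dD; rewrite -(node_sub_eq gt (b' : band (nD t') (nF t') (nU t')) st' dD).
exists t' => //; split=> //=.
- move=> d /Dw; rewrite inE => /predU1P[->|]; first by right; rewrite Fw xm.
  rewrite inE => /predU1P[->|dD]; first by left; rewrite xm.
  by rewrite eqF //; case: (Dt d dD) => h; [left|right]; exact: ltn_trans h _.
- move=> y; rewrite ltnS leq_eqVlt => /predU1P[e|ym].
    have -> : y = x by apply: (pcan_inj pickleK); rewrite e xm.
    by split; [apply: sD; exact: mem_head|exists w].
  have [yD [w' w'D e]] := ct y ym; split; first exact: st'.2.
  by exists w'; [exact: st'.2|rewrite eqF].
Qed.

(** The children start from the lower and the upper third of the band. The omitted middle third
    separates everything below one child from everything below the other, except at points already
    decided. *)
Lemma node_split m t : node_good m t -> exists t0 t1,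
  [/\ node_good m.+1 t0 /\ node_good m.+1 t1, node_sub t0 t, node_sub t1 t &
      gapped (nD t) (nU t0) (nF t1)].
Proof.
move=> [bt Dt ct]; have FU := fun z => band_le z bt.
have [_ _ eqD _] := bt.
pose W c z := nF t z + c * (nU t z - nF t z).
have gW c d : 0 <= c -> c < d -> d <= 1 ->
    node_good m (Node (W c) (W d) (nD t)) /\ node_sub (Node (W c) (W d) (nD t)) t.
  move=> c0 cd d1.
  have WD e x : x \in nD t -> W e x = nF t x.
    by move=> xD; rewrite /W eqD // subrr mulr0 addr0.
  split; first split=> /=.
  - exact: band_comb.
  - by move=> x xD; rewrite WD //; exact: Dt.
  - by move=> x /ct[xD [w wD e]]; split=> //; exists w => //; rewrite WD.
  - split=> // z; rewrite /W /=.
    have h1 : 0 <= c * (nU t z - nF t z) by rewrite mulr_ge0 // subr_ge0.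
    have h2 : 0 <= (1 - d) * (nU t z - nF t z) by rewrite mulr_ge0 ?subr_ge0.
    by split; lra.
have [||| g0 s0] := gW 0 (1 / 3); [lra|lra|lra|].
have [||| g1 s1] := gW (2 / 3) 1; [lra|lra|lra|].
have [||| _ _ _ sep] := band_comb (c := 1 / 3) (d := 2 / 3) _ _ _ bt; [lra|lra|lra|].
have [t0 gt0 st0] := node_refine g0; have [t1 gt1 st1] := node_refine g1.
exists t0, t1; split=> //; [exact: node_sub_trans st0 s0|exact: node_sub_trans st1 s1|].
move=> a b /sep[e e0 h]; exists e => // z /h hz.
have [_ h1] := st0.1 z; have [h2 _] := st1.1 z.
by move: h1 h2; rewrite /= /W; lra.
Qed.

(** Along a branch of the tree every rational is eventually decided as an argument and as a value,
    so a branch determines an automorphism. Branches that part at level [n] can share a value only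
    at points decided before, and those have a small index on one side. *)
Lemma monotone_family : exists Phi : (nat -> bool) -> autQ,
  [/\ forall (be be' : nat -> bool) (x : rat),
        (forall i, (i <= pickle x)%N -> be i = be' i) -> Phi be x = Phi be' x,
      forall (be be' : nat -> bool) n, (forall i, (i < n)%N -> be i = be' i) ->
        be n = false -> be' n = true ->
        exists D, gapped D (Phi be) (Phi be') &
      forall (be be' : nat -> bool) (x y : rat) n, (forall i, (i < n)%N -> be i = be' i) ->
        be n = false -> be' n = true -> Phi be x = y -> Phi be' x = y ->
        (pickle x < n)%N \/ (pickle y < n)%N].
Proof.
have /choice[St StP] : forall mt : nat * node, exists tt : node * node,
    node_good mt.1 mt.2 -> [/\ node_good mt.1.+1 tt.1 /\ node_good mt.1.+1 tt.2,
      node_sub tt.1 mt.2, node_sub tt.2 mt.2 &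
      gapped (nD mt.2) (nU tt.1) (nF tt.2)].
  move=> [m t]; have [gt|ngt] := pselect (node_good m t); last by exists (t, t).
  by have [t0 [t1 h]] := node_split gt; exists (t0, t1).
pose root := Node id (fun z => z + 1) [::].
pose nd := fix nd (be : nat -> bool) n := if n is m.+1 then
  let tt := St (m, nd be m) in if be m then tt.2 else tt.1 else root.
have good be n : node_good n (nd be n).
  elim: n => [|n IH]; last first.
    by have [[g1 g2] _ _ _] := StP (n, nd be n) IH; rewrite /=; case: (be n).
  split=> //=; split=> //.
  - by exists 1, 1; split=> // x y xy; apply/andP; split; lra.
  - by exists 1, 1; split=> // x y xy; apply/andP; split; lra.
  - by move=> a b _; exists 1.
have bandn be n : band (nD (nd be n)) (nF (nd be n)) (nU (nd be n)).
  by have [] := good be n.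
have sub1 be n : node_sub (nd be n.+1) (nd be n).
  by have [_ s1 s2 _] := StP (n, nd be n) (good be n); rewrite /=; case: (be n).
have sub be n m : (n <= m)%N -> node_sub (nd be m) (nd be n).
  move=> /subnKC<-; elim: (m - n)%N => [|d IH]; first by rewrite addn0; exact: node_sub_refl.
  by rewrite addnS; apply: node_sub_trans (sub1 _ _) IH.
(* At level pickle x + 1 the point [x] is certainly decided, and later nodes do not change its
   value. *)
pose ph be x := nF (nd be (pickle x).+1) x.
have inD be n x : (pickle x < n)%N -> x \in nD (nd be n).
  by have [_ _ h] := good be n; move=> /h[].
have phE be n x : x \in nD (nd be n) -> ph be x = nF (nd be n) x.
  move=> xD; have xD' := inD be (pickle x).+1 x (ltnSn _).
  rewrite /ph; have [h|h] := leqP (pickle x).+1 n.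
    by rewrite (node_sub_eq (good _ _) (bandn _ _) (sub _ _ _ h) xD').
  by rewrite (node_sub_eq (good _ _) (bandn _ _) (sub _ _ _ (ltnW h)) xD).
have ph_btw be n x : nF (nd be n) x <= ph be x <= nU (nd be n) x.
  pose N := maxn n (pickle x).+1.
  have xD : x \in nD (nd be N) by apply: inD; rewrite leq_maxr.
  have [h _] := sub be n N (leq_maxl _ _); have [h1 h2] := h x.
  rewrite (phE be N x xD) h1 /=; apply: le_trans h2.
  exact: band_le (bandn be N).
have ph_homo be : {homo ph be : x y / x < y}.
  move=> x y xy; pose N := maxn (pickle x).+1 (pickle y).+1.
  rewrite (phE be N x) ?inD ?leq_maxl // (phE be N y) ?inD ?leq_maxr //.
  by have [bF _ _ _] := bandn be N; exact: bilip_lt.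
have ph_surj be y : exists x, ph be x = y.
  have [_ _ /(_ y (ltnSn _))[_ [w wD e]]] := good be (pickle y).+1.
  by exists w; rewrite (phE be (pickle y).+1).
have /choice[Phi PhiE] be := autQ_of_incr_surj (ph_homo be) (ph_surj be).
have nd_eq be be' n : (forall i, (i < n)%N -> be i = be' i) -> nd be n = nd be' n.
  elim: n => [//|n IH] h /=; rewrite IH; last by move=> i /ltnW/h.
  by rewrite (h n).
have sep be be' n : (forall i, (i < n)%N -> be i = be' i) -> be n = false -> be' n = true ->
    gapped (nD (nd be n)) (Phi be) (Phi be').
  move=> h b0 b1 u v nD'.
  have [_ _ _ sp] := StP (n, nd be n) (good be n).
  have [e e0 he] := sp u v nD'; exists e => // z uz; have := he z uz.
  have /andP[_ h1] := ph_btw be n.+1 z; have /andP[h2 _] := ph_btw be' n.+1 z.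
  move: h1 h2; rewrite /= -(nd_eq _ _ _ h) b0 b1 !PhiE; lra.
exists Phi; split.
- move=> be be' x h; rewrite !PhiE /ph (nd_eq be be') // => i; exact: h.
- by move=> be be' n h b0 b1; exists (nD (nd be n)); exact: sep.
- move=> be be' x y n h b0 b1 ex ey; have sp := sep _ _ _ h b0 b1.
  have [xD|xD] := boolP (x \in nD (nd be n)).
    have [_ /(_ x xD) hx _] := good be n.
    by rewrite -(phE be n x xD) -PhiE ex in hx.
  have [|e e0 he] := sp x x; last first.
    by have := he x; rewrite lexx ex ey => /(_ isT); lra.
  move=> d dD; apply/negP; rewrite -eq_le => /eqP zd.
  by rewrite zd dD in xD.
Qed.

(** If the orbit of [x] under [h'] stayed below [y], its steps h' z - z would become arbitrarily
    small near its supremum, which may be irrational. But [h] is above the identity and [h'] above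
    [h] by a gap, uniform near the supremum once the points of [D] are kept away from it. *)
Lemma no_common_touch (h h' g' : rat -> rat) (D : seq rat) (x y : rat) :
  {mono h' : u v / u < v} -> cancel g' h' -> gapped D h h' -> x < y ->
  (forall z, x <= z <= y -> z < h z) -> (forall z, x <= z <= y -> z < h' z) ->
  (forall n, iter n h' x < y) -> False.
Proof.
move=> h'm gK sep xy hz h'z orb.
pose u n := iter n h' x.
have ux n : x <= u n.
  elim: n => [|n IH]; first exact: lexx.
  by apply: (le_trans IH); apply: ltW; apply: h'z; rewrite IH ltW //; exact: orb.
have uxy n : x <= u n <= y by rewrite ux ltW //; exact: orb.
have uS n : u n < u n.+1 by exact: h'z.
have umono : {homo u : m n / (m <= n)%N >-> m <= n}.
  by apply: homo_leq; [exact: lexx|exact: le_trans|move=> n; exact: ltW].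
(* Points of [D] above the whole orbit are kept to the right of [b]: if such a [d] is at most [y],
   then [g' d] is smaller than [d] and still bounds the orbit, because [h'] maps the orbit into
   itself. The other points of [D] are overtaken after [N] steps. *)
have [b [ub b_y bD]] : exists b, [/\ forall n, u n <= b, b <= y &
    forall d, d \in D -> (forall n, u n < d) -> b < d].
  elim: (D) => [|d D' [b [ub b_y bD]]]; first by exists y; split=> // n; exact: ltW (orb n).
  have [[dlt dy]|nd] := pselect ((forall n, u n < d) /\ d <= y); last first.
    exists b; split=> // d'; rewrite inE => /predU1P[-> dlt|]; last exact: bD.
    by apply: le_lt_trans b_y _; rewrite ltNge; apply/negP => dy; apply: nd.
  have dd : g' d < d.
    rewrite -h'm gK; apply: h'z; rewrite dy andbT; apply: ltW; exact: dlt 0%N.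
  exists (Num.min b (g' d)); split.
  - move=> n; rewrite le_min ub /= leNgt -h'm gK -leNgt; apply: ltW; exact: dlt n.+1.
  - by rewrite ge_min b_y.
  - move=> d'; rewrite inE gt_min => /predU1P[-> _|d'D /bD->//]; by rewrite dd orbT.
have [N aD] : exists N, forall d, d \in D -> ~ (forall n, u n < d) -> d < u N.
  elim: (D) => [|d D' [N aD]]; first by exists 0%N.
  have [dlt|/existsNP[n nd]] := pselect (forall n, u n < d).
    by exists N => d'; rewrite inE => /predU1P[->//|]; exact: aD.
  exists (maxn N n.+1) => d'; rewrite inE => /predU1P[-> _|d'D /(aD _ d'D) h1].
    apply: lt_le_trans (_ : d < u n.+1) _; last by rewrite umono // leq_maxr.
    by apply: le_lt_trans (uS n); rewrite leNgt; apply/negP.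
  by apply: lt_le_trans h1 _; rewrite umono // leq_maxl.
have [|e e0 he] := sep (u N) b.
  move=> d dD; apply/negP => /andP[d1 d2].
  have [dlt|nd] := pselect (forall n, u n < d).
    by have := bD d dD dlt; rewrite ltNge d2.
  by have := aD d dD nd; rewrite ltNge d1.
have step n : u N + e * n%:R <= u (N + n)%N.
  elim: n => [|n IH]; first by rewrite mulr0 addr0 addn0.
  have := he (u (N + n)%N); rewrite ub umono ?leq_addr // => /(_ isT) h1.
  have h2 := hz _ (uxy (N + n)%N).
  rewrite addnS -natr1.
  have e1 : u (N + n).+1 = h' (u (N + n)%N) by [].
  lra.
have c0 : 0 <= (y - u N) / e by rewrite divr_ge0 ?subr_ge0 ?ltW //; exact: orb.
have := archi_boundP c0; set M := Num.bound _.
rewrite ltr_pdivrMr // => hM.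
have := step M; have := orb (N + M)%N; rewrite -/(u _); lra.
Qed.

(** * Borel sets and the random automorphism *)

Section borel_properties.

Lemma measurable_expgz (m : int) (x y : rat) :
  measurable ([set f : autQ | expgz f m x = y] : set borelQ).
Proof.
have pos n u v : measurable ([set f : autQ | (f ^+ n)%g u = v] : set borelQ).
  elim: n u v => [|n IH] u v; first by rewrite /=; exact: measurable_cstprop.
  rewrite (_ : [set f | _] =
      [set f | exists w, ([set f : autQ | (f ^+ n)%g u = w] `&` [set f : autQ | f w = v]) f]).
    by apply: measurable_existsC => w; apply: measurableI; [exact: IH|exact: measurable_eval].
  apply/seteqP; split=> f /=; rewrite expgS autQ_mulE; first by exists ((f ^+ n)%g u).
  by case=> w [-> ->].
case: m => n; first exact: pos.
rewrite (_ : [set f | _] = [set f : autQ | (f ^+ n.+1)%g y = x]); first exact: pos.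
apply/seteqP; split=> f /=; first by move<-; rewrite autQ_invr.
by move<-; rewrite autQ_invl.
Qed.

Lemma measurable_expgz_pred (Q : pred rat) (m : int) (x : rat) :
  measurable ([set f : autQ | Q (expgz f m x)] : set borelQ).
Proof.
rewrite (_ : [set f | _] = [set f | exists w,
    ([set f : autQ | expgz f m x = w] `&` [set _ | Q w]) f]).
  apply: measurable_existsC => w; apply: measurableI; first exact: measurable_expgz.
  exact: measurable_cstprop.
apply/seteqP; split=> f /=; first by exists (expgz f m x).
by case=> w [-> ].
Qed.

Lemma measurable_orbital (x y : rat) :
  measurable ([set f : autQ | orbital f x y] : set borelQ).
Proof.
rewrite (_ : [set f | _] = [set f | exists m : int, [set f | exists n : int,
    ([set f : autQ | expgz f m x <= y] `&` [set f : autQ | y <= expgz f n x]) f] f]).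
  apply: measurable_existsC => m; apply: measurable_existsC => n; apply: measurableI.
    exact: (measurable_expgz_pred (fun u => u <= y)).
  exact: (measurable_expgz_pred (fun u => y <= u)).
apply/seteqP; split=> f /=.
  by move=> /orbitalP[m [n /andP[h1 h2]]]; exists m, n.
by move=> [m [n [h1 h2]]]; apply/orbitalP; exists m, n; rewrite h1.
Qed.

Lemma measurable_sgQ (x c : rat) :
  measurable ([set f : autQ | sgQ f x = c] : set borelQ).
Proof.
have := measurable_eval_pred (fun u => Num.sg (u - x) == c) x.
by congr measurable; apply/seteqP; split=> f /= /eqP.
Qed.

Definition goodQ (f : autQ) := alternatingQ f /\ finitely_many_fixed_points f.

Lemma measurable_goodQ : measurable ([set f : autQ | goodQ f] : set borelQ).
Proof.
apply: measurableI; last first.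
  rewrite (_ : finitely_many_fixed_points = [set f | exists s : seq rat,
      [set f | forall x, [set f | [set f : autQ | f x = x] f ->
        [set _ : autQ | x \in s] f] f] f]); last first.
    apply/seteqP; split=> f /=.
      by move=> /finite_seqP[s sE]; exists s => x fx; have : fixed_points f x by []; rewrite sE.
    move=> [s h]; apply: (@sub_finite_set _ _ [set` s]); last exact: finite_seq.
    by move=> x fx; exact: h.
  apply: measurable_existsC => s; apply: measurable_forallC => x.
  by apply: measurable_implyC; [exact: measurable_eval|exact: measurable_cstprop].
(* Equality of two signs is expressed through all values [c], because [measurable_sgQ] concerns one
   value at a time; the nesting of sets mirrors the countable operations applied next. *)
rewrite (_ : alternatingQ = [set f | forall x : rat, [set f | forall y : rat,
    [set f | [set _ : autQ | x < y] f -> [set f |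
    [set f | ~ [set f | orbital f x y] f] f -> [set f |
    [set f | forall c : rat, [set f | [set f | sgQ f x = c] f -> [set f | sgQ f y = c] f] f] f -> [set f |
    [set f | ~ [set f | sgQ f x = 0] f] f ->
    [set f | exists z : rat, ([set _ : autQ | x < z < y] `&`
      [set f | ~ [set f | forall c : rat, [set f | [set f | sgQ f z = c] f -> [set f | sgQ f x = c] f] f] f]) f] f] f] f] f] f] f]).
  apply: measurable_forallC => x; apply: measurable_forallC => y.
  apply: measurable_implyC; first exact: measurable_cstprop.
  apply: measurable_implyC; first by apply: measurable_notC; exact: measurable_orbital.
  apply: measurable_implyC.
    apply: measurable_forallC => c.
    by apply: measurable_implyC; exact: measurable_sgQ.
  apply: measurable_implyC; first by apply: measurable_notC; exact: measurable_sgQ.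
  apply: measurable_existsC => z; apply: measurableI; first exact: measurable_cstprop.
  apply: measurable_notC; apply: measurable_forallC => c.
  by apply: measurable_implyC; exact: measurable_sgQ.
apply/seteqP; split=> f /= h x y xy nxy.
- move=> e ne; have [|z [h1 h2]] := h x y xy nxy _ ne.
    by apply/esym; exact: e.
  by exists z; split=> // E; apply: h2; apply/esym; exact: E.
- move=> e ne; have [|z [h1 h2]] := h x y xy nxy _ ne; first by move=> c <-.
  by exists z; split=> // E; apply: h2 => c <-.
Qed.

End borel_properties.

Lemma goodQ_conj (f g : autQ) : goodQ f -> goodQ (f ^ g)%g.
Proof.
by move=> [h1 h2]; split; [exact: alternatingQ_conj|exact: finite_fixed_conj].
Qed.

(** * Binary digits of reals in [0,1[ *)

Section bits.
Variable R : realType.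
Implicit Types t : R.

Definition dyadic n t := Num.truncn (2 ^+ n * t).
Definition bit n t := odd (dyadic n.+1 t).

Lemma dyadic_bounds n t : 0 <= t ->
  (dyadic n t)%:R / 2 ^+ n <= t < (dyadic n t).+1%:R / 2 ^+ n.
Proof.
move=> t0; have p : 0 < 2 ^+ n :> R by rewrite exprn_gt0.
rewrite ler_pdivrMr // ltr_pdivlMr // [t * _]mulrC.
by apply: truncn_itv; rewrite mulr_ge0 // ltW.
Qed.

Lemma dyadicS n t : 0 <= t -> dyadic n.+1 t = ((dyadic n t).*2 + bit n t)%N.
Proof.
move=> t0; have p : 0 <= 2 ^+ n * t by rewrite mulr_ge0 // exprn_ge0.
have p' : 0 <= 2 ^+ n.+1 * t by rewrite mulr_ge0 // exprn_ge0.
rewrite /bit; set j := dyadic n.+1 t; set k := dyadic n t.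
have /andP[h1 h2] := truncn_itv p; rewrite -/(dyadic n t) -/k in h1 h2.
have a1 : (k.*2 <= j)%N.
  rewrite /j /dyadic truncn_ge_nat // exprS -mulrA -muln2 natrM; lra.
have a2 : (j < k.*2.+2)%N.
  rewrite /j /dyadic truncn_lt_nat // exprS -mulrA -doubleS -muln2 natrM; lra.
by rewrite -[in LHS](odd_double_half j) addnC; congr (_ + _)%N; lia.
Qed.

Lemma dyadic0 t : 0 <= t < 1 -> dyadic 0 t = 0%N.
Proof.
move=> /andP[t0 t1]; apply/eqP; rewrite /dyadic expr0 mul1r truncn_eq //.
by rewrite t0.
Qed.

Lemma eq_dyadic n t t' : 0 <= t < 1 -> 0 <= t' < 1 ->
  (forall i, (i < n)%N -> bit i t = bit i t') -> dyadic n t = dyadic n t'.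
Proof.
move=> t01 t01'; have /andP[t0 _] := t01; have /andP[t0' _] := t01'.
elim: n => [|n IH] h; first by rewrite !dyadic0.
by rewrite !dyadicS // h // IH // => i /ltnW; exact: h.
Qed.

Lemma first_bit t t' : 0 <= t < 1 -> 0 <= t' < 1 -> t < t' ->
  exists n, [/\ forall i, (i < n)%N -> bit i t = bit i t',
    bit n t = false & bit n t' = true].
Proof.
move=> t01 t01' tt'; have /andP[t0 _] := t01; have /andP[t0' _] := t01'.
have ex : exists n, dyadic n t != dyadic n t'.
  have d0 : 0 <= (t' - t)^-1 by rewrite invr_ge0; lra.
  have := archi_boundP d0; set n := Num.bound _ => hn; exists n; apply/eqP => e.
  have /andP[h1 _] := dyadic_bounds n t0; have /andP[_ h2] := dyadic_bounds n t0'.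
  have pn : 0 < 2 ^+ n :> R by rewrite exprn_gt0.
  move: h2; rewrite -e -natr1 mulrDl mul1r => h2.
  have : t' - t < (2 ^+ n)^-1 by lra.
  rewrite -[X in X < _]invrK ltf_pV2 ?posrE ?invr_gt0; [|lra|lra].
  move=> h3; have := lt_trans h3 hn; rewrite -natrX ltr_nat.
  by rewrite ltnNge ltnW // ltn_expl.
have [n hn nmin] := ex_minnP ex.
case: n hn nmin => [|n] hn nmin; first by rewrite !dyadic0 ?eqxx in hn.
have eqd i : (i <= n)%N -> dyadic i t = dyadic i t'.
  by move=> i_n; apply/eqP; apply: contraTT i_n => /nmin; rewrite -ltnNge.
exists n; have le : (dyadic n.+1 t <= dyadic n.+1 t')%N.
  by apply: le_truncn; rewrite ler_pM2l ?exprn_gt0 // ltW.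
move: hn le; rewrite !dyadicS // (eqd n) // eqn_add2l leq_add2l.
by case: (bit n t); case: (bit n t') => // _ _; split=> // i i_n; rewrite /bit eqd.
Qed.

Lemma measurable_bit n (c : bool) :
  measurable ([set t | bit n t = c] : set (measurableTypeR R)).
Proof.
have mt : measurable ([set t | bit n t] : set (measurableTypeR R)).
  rewrite (_ : [set t | _] = [set t | exists k : nat,
      ([set` `[k.*2.+1%:R / 2 ^+ n.+1 : R, k.*2.+2%:R / 2 ^+ n.+1 [ ]) t]).
    by apply: measurable_existsC => k; exact: measurable_itv.
  have p : 0 < 2 ^+ n.+1 :> R by rewrite exprn_gt0.
  apply/seteqP; split=> t /=.
    move=> bt; exists (dyadic n.+1 t)./2.
    have e : (dyadic n.+1 t)./2.*2.+1 = dyadic n.+1 t.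
      by rewrite -[in RHS](odd_double_half (dyadic n.+1 t)) -/(bit n t) bt.
    have t0 : 0 <= t.
      rewrite leNgt; apply/negP => t0; move: bt; rewrite /bit /dyadic.
      rewrite (_ : Num.truncn _ = 0%N) //; apply/eqP; rewrite -leqn0 leqNgt truncn_gt_nat -ltNge.
      by rewrite (@lt_trans _ _ 0) // pmulr_rlt0.
    by rewrite in_itv /= e; exact: dyadic_bounds.
  move=> [k]; rewrite in_itv /= ler_pdivrMr // ltr_pdivlMr // [t * _]mulrC => h.
  by rewrite /bit /dyadic (truncn_def h) /= odd_double.
case: c => //.
rewrite (_ : [set t | _] = ~` [set t | bit n t]); first exact: measurableC.
by apply/seteqP; split=> t /=; [move->|move/negP/negbTE].
Qed.

End bits.

(** The sets that contain all automorphisms agreeing with [f] on some finite list form a filter,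
    which converges to [f] because it contains each condition on a single value. *)
Lemma nbhs_autQ_finite (f : autQ) (O : set autQ) : nbhs f O ->
  exists xs : seq rat, forall g : autQ, (forall x, x \in xs -> g x = f x) -> O g.
Proof.
pose F : set_system autQ := [set A | exists xs : seq rat,
  forall g : autQ, (forall x, x \in xs -> g x = f x) -> A g].
have FF : Filter F.
  split; first by exists [::].
  - move=> A B [xs hx] [ys hy]; exists (xs ++ ys) => g h; split.
      by apply: hx => x xx; apply: h; rewrite mem_cat xx.
    by apply: hy => x xx; apply: h; rewrite mem_cat xx orbT.
  - by move=> A B AB [xs hx]; exists xs => g /hx/AB.
have cF : F --> f.
  by apply: autQ_cvg => x; exists [:: x] => g h; apply: h; exact: mem_head.
by move=> /cF.
Qed.

(** * The random automorphism and its distribution *)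

Section random_automorphism.
Variable R : realType.

Definition Phi : (nat -> bool) -> autQ := sval (cid monotone_family).

Let PhiP := svalP (cid monotone_family).

Definition randQ (t : measurableTypeR R) : borelQ := Phi (fun n => bit n (t : R)).

Lemma measurable_randQ_eval (x y : rat) :
  measurable ([set t | (randQ t : autQ) x = y] : set (measurableTypeR R)).
Proof.
have [dep _ _] := PhiP.
(* The value at [x] depends only on the bits up to number pickle x, so the event is a countable
   union over finite bit strings. *)
rewrite (_ : [set t | _] = [set t | exists l : seq bool,
    ([set t | forall i : nat, [set t | [set _ : measurableTypeR R | (i <= pickle x)%N] t ->
       [set t | bit i (t : R) = nth false l i] t] t] `&`
     [set _ : measurableTypeR R | Phi (nth false l) x = y]) t]).
  apply: measurable_existsC => l; apply: measurableI; last exact: measurable_cstprop.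
  apply: measurable_forallC => i; apply: measurable_implyC; first exact: measurable_cstprop.
  exact: measurable_bit.
apply/seteqP; split=> t /=.
  move=> e; exists (mkseq (fun n => bit n (t : R)) (pickle x).+1).
  have h i : (i <= pickle x)%N -> bit i (t : R) =
      nth false (mkseq (fun n => bit n (t : R)) (pickle x).+1) i.
    by move=> ix; rewrite nth_mkseq.
  by split=> //; rewrite -e; apply/esym/dep.
by move=> [l [h <-]]; apply: dep.
Qed.

Lemma measurable_randQ : measurable_fun setT randQ.
Proof.
apply: (@measurability _ _ _ borelQ setT randQ (@open autQ)) => //.
move=> _ [W oW <-]; rewrite setTI.
rewrite (_ : randQ @^-1` W = [set t | exists zs : seq (rat * rat),
  ([set _ : measurableTypeR R | forall g : autQ,
     (forall z, z \in zs -> g z.1 = z.2) -> W g] `&`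
   [set t | forall z : rat * rat, [set t | [set _ : measurableTypeR R | z \in zs] t ->
     [set t | (randQ t : autQ) z.1 = z.2] t] t]) t]).
  apply: measurable_existsC => zs; apply: measurableI; first exact: measurable_cstprop.
  apply: measurable_forallC => z; apply: measurable_implyC; first exact: measurable_cstprop.
  exact: measurable_randQ_eval.
apply/seteqP; split=> t /=; last by move=> [zs [h1 h2]]; exact: h1.
move=> Wt; have [xs h] := nbhs_autQ_finite (open_nbhs_nbhs (conj oW Wt)).
exists [seq (x, (randQ t : autQ) x) | x <- xs]; split.
  move=> g hg; apply: h => x xx.
  by have := hg (x, (randQ t : autQ) x); apply; apply/mapP; exists x.
by move=> z /mapP[x _ ->].
Qed.

HB.instance Definition _ := isMeasurableFun.Build _ _ _ _ randQ measurable_randQ.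

Definition muQ : probability borelQ R := distribution (uniform_prob (@ltr01 R)) randQ.

End random_automorphism.

Lemma iter_expgz (h : autQ) n x : iter n h x = expgz h n x.
Proof. by elim: n => [//|n IH]; rewrite iterS IH -addn1 PoszD expgzS. Qed.

Lemma gapped_comp D (F U : rat -> rat) (k : autQ) : gapped D F U ->
  gapped (map (k^-1)%g D) (F \o k) (U \o k).
Proof.
move=> sep a b nD; have [|e e0 he] := sep (k a) (k b).
  move=> d dD; apply: contra (nD ((k^-1)%g d) (map_f _ dD)).
  by rewrite autQ_leinv autQ_invle.
by exists e => // z /andP[az zb]; apply: he; rewrite !autQ_le az.
Qed.

Lemma gapped_opp D (F U : rat -> rat) : gapped D F U ->
  gapped (map -%R D) (fun z => - U (- z)) (fun z => - F (- z)).
Proof.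
move=> sep a b nD; have [|e e0 he] := sep (- b) (- a).
  move=> d dD; apply: contra (nD (- d) (map_f _ dD)).
  by rewrite lerNl lerNr andbC.
exists e => // z /andP[az zb]; have := he (- z); rewrite !lerN2 az zb => /(_ isT).
lra.
Qed.

Section touching.
Variables (D : seq rat) (h h' : autQ).
Hypothesis gap : gapped D h h'.

Lemma touch_pos x y : x < y -> ~ orbital h' x y ->
  (forall z, x <= z <= y -> z < h z) -> (forall z, x <= z <= y -> z < h' z) ->
  False.
Proof.
move=> xy nxy hz h'z.
apply: (no_common_touch (autQ_mono h') (autQ_invr h') gap xy hz h'z) => n.
rewrite ltNge iter_expgz; apply/negP => yn; apply: nxy.
by apply/orbitalP; exists 0, n; rewrite expgz0 ltW.
Qed.

(** The reflection z -> -z exchanges the larger and the smaller map. Hence the orbit that cannot be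
    stuck is here that of [h], whereas in [touch_pos] it is that of [h']. *)
Lemma touch_neg x y : x < y -> ~ orbital h x y ->
  (forall z, x <= z <= y -> h z < z) -> (forall z, x <= z <= y -> h' z < z) ->
  False.
Proof.
move=> xy nxy hz h'z.
apply: (@no_common_touch (fun z => - h' (- z)) (fun z => - h (- z))
    (fun z => - (h^-1)%g (- z)) (map -%R D) (- y) (- x)).
- by move=> u v; rewrite ltrN2 autQ_lt ltrN2.
- by move=> z; rewrite opprK autQ_invr opprK.
- exact: gapped_opp.
- by rewrite ltrN2.
- by move=> z /andP[h1 h2]; rewrite ltrNr; apply: h'z; rewrite lerNr h2 lerNl.
- by move=> z /andP[h1 h2]; rewrite ltrNr; apply: hz; rewrite lerNr h2 lerNl.
move=> n; have -> : iter n (fun z => - h (- z)) (- y) = - iter n h y.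
  by elim: n => [//|n IH]; rewrite !iterS IH opprK.
rewrite ltrN2 ltNge iter_expgz; apply/negP => yn; apply: nxy.
apply: orbital_sym; apply/orbitalP; exists n, 0; rewrite expgz0 yn; exact: ltW.
Qed.

End touching.

(** * Almost every automorphism alternates and has finitely many fixed points *)

Section almost_every.
Variable R : realType.
Local Notation X := (@randQ R).

Let PhiP := svalP (cid monotone_family).

(** This is a failure of alternation with rational witnesses; as there are countably many pairs [x],
    [y], each pair can be treated separately. *)
Definition touches (h : autQ) (x y : rat) := [/\ x < y, ~ orbital h x y &
  (forall z, x <= z <= y -> z < h z) \/ (forall z, x <= z <= y -> h z < z)].

Lemma not_alternatingQ_touches (h : autQ) : ~ alternatingQ h ->
  exists x y, touches h x y.
Proof.
move=> nalt; apply: contrapT => nt; apply: nalt => x y xy nxy e ne.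
apply: contrapT => nz.
have sz z : x <= z <= y -> sgQ h z = sgQ h x.
  move=> /andP[]; rewrite le_eqVlt => /predU1P[<-//|xz].
  rewrite le_eqVlt => /predU1P[->//|zy].
  by apply: contrapT => h1; apply: nz; exists z; rewrite xz.
apply: nt; exists x, y; split=> //.
case: (sgQ_cases h x) => hx //; [left|right] => z /sz; rewrite hx => /eqP.
- by rewrite sgQ1.
- by rewrite sgQN1.
Qed.

Lemma gapped_rand (t t' : R) : 0 <= t < 1 -> 0 <= t' < 1 -> t < t' ->
  exists D, gapped D (X t : autQ) (X t' : autQ).
Proof.
move=> t01 t01' tt'; have [n [h1 h2 h3]] := first_bit t01 t01' tt'.
by have [_ h _] := PhiP; exact: h _ _ _ h1 h2 h3.
Qed.

Lemma touching_negligible (k : autQ) (x y : rat) :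
  (@lebesgue_measure R).-negligible
    [set t : R | 0 <= t < 1 /\ touches ((X t : autQ) * k)%g x y].
Proof.
pose Sp := [set t : R | [/\ 0 <= t < 1, x < y, ~ orbital ((X t : autQ) * k)%g x y &
  forall z, x <= z <= y -> z < ((X t : autQ) * k)%g z]].
pose Sn := [set t : R | [/\ 0 <= t < 1, x < y, ~ orbital ((X t : autQ) * k)%g x y &
  forall z, x <= z <= y -> ((X t : autQ) * k)%g z < z]].
have uniq (S : set R) : (forall t t', S t -> S t' -> t < t' -> False) ->
    (@lebesgue_measure R).-negligible S.
  move=> hS; have [[t St]|nS] := pselect (exists t, S t); last first.
    rewrite (_ : S = set0); first exact: negligible_set0.
    by rewrite -subset0 => t St; apply: nS; exists t.
  have sub : S `<=` [set t].
    move=> t' St'; have [lt|lt|//] := ltgtP t' t; exfalso.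
    - exact: hS St' St lt.
    - exact: hS St St' lt.
  by exists [set t]; split=> //; exact: lebesgue_measure_set1.
have gk t t' : 0 <= t < 1 -> 0 <= t' < 1 -> t < t' ->
    exists D, gapped D ((X t : autQ) * k)%g ((X t' : autQ) * k)%g.
  move=> t01 t01' tt'; have [D sep] := gapped_rand t01 t01' tt'.
  by exists (map (k^-1)%g D); exact: (gapped_comp (k := k) sep).
have sub : [set t : R | 0 <= t < 1 /\ touches ((X t : autQ) * k)%g x y] `<=` Sp `|` Sn.
  by move=> t [t01 [xy nxy [h|h]]]; [left|right].
apply: (negligibleS (mu := @lebesgue_measure R) sub).
apply: negligibleU; apply: uniq => t t' [t01 xy n1 h1] [t01' _ n2 h2] tt'.
- have [D gap] := gk _ _ t01 t01' tt'; exact: (touch_pos gap xy n2 h1 h2).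
- have [D gap] := gk _ _ t01 t01' tt'; exact: (touch_neg gap xy n1 h1 h2).
Qed.

(** Branches share a value only at points decided before they part. Two parameters in [0,1[ that
    send [x] to [y] therefore first differ at a bit of number greater than [m]; they share m + 1
    bits and lie in one dyadic interval. *)
Lemma coincidence_interval (x y : rat) m : (m <= pickle x)%N -> (m <= pickle y)%N ->
  exists J : set (measurableTypeR R), [/\ measurable J,
    (lebesgue_measure J <= (1 / (2 ^ m.+1)%:R)%:E)%E &
    forall t : R, 0 <= t < 1 -> (X t : autQ) x = y -> J t].
Proof.
move=> mx my.
have [[t0 [t01 e0]]|nt] := pselect (exists t : R, 0 <= t < 1 /\ (X t : autQ) x = y);
  last first.
  exists set0; split=> //; first by rewrite measure0 lee_fin.
  by move=> t t01 e; exfalso; apply: nt; exists t.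
have agree (t t' : R) : 0 <= t < 1 -> 0 <= t' < 1 -> t < t' ->
    (X t : autQ) x = y -> (X t' : autQ) x = y ->
    forall i, (i < m.+1)%N -> bit i t = bit i t'.
  move=> h1 h2 tt' e e' i im; have [n [a1 a2 a3]] := first_bit h1 h2 tt'.
  have [_ _ /(_ _ _ _ _ _ a1 a2 a3 e e')] := PhiP.
  have [/a1//|ni] := ltnP i n.
  have nm : (n <= m)%N by exact: leq_trans ni im.
  by case=> h; move: (leq_trans h nm); rewrite ltnNge ?mx ?my.
pose c : R := (dyadic m.+1 t0)%:R / 2 ^+ m.+1.
pose c' : R := (dyadic m.+1 t0).+1%:R / 2 ^+ m.+1.
have cc : c' - c = 1 / (2 ^ m.+1)%:R.
  by rewrite /c /c' -mulrBl -natr1 addrAC subrr add0r natrX.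
exists [set` `[c, c'[]; split; first exact: measurable_itv.
  rewrite lebesgue_measure_itv /=; case: ifP => _; last by rewrite lee_fin.
  by rewrite -EFinB cc.
move=> t t1 et; rewrite /= in_itv /=.
have e : dyadic m.+1 t0 = dyadic m.+1 t.
  have [lt|lt|->//] := ltgtP t0 t; first by apply: eq_dyadic => //; exact: agree.
  by apply/esym/eq_dyadic => //; exact: agree.
by rewrite /c /c' e; apply: dyadic_bounds; have /andP[] := t1.
Qed.

Lemma infinite_fixed_negligible (k : autQ) :
  (@lebesgue_measure R).-negligible [set t : R | 0 <= t < 1 /\
    ~ finitely_many_fixed_points ((X t : autQ) * k)%g].
Proof.
have /choice[J JP] : forall m : nat, exists J : set (measurableTypeR R),
    [/\ measurable J, (lebesgue_measure J <= (2 / (2 ^ m.+1)%:R)%:E)%E &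
    forall (t : R) (q : rat), 0 <= t < 1 -> minn (pickle q) (pickle (k q)) = m ->
      (X t : autQ) (k q) = q -> J t].
  move=> m.
  (* A fixed point q of [X t * k] is a coincidence of [X t] at (k q, q). For given [m] at most two q
     have [m] as the smaller index, one through q itself and one through [k q]; hence the factor
     2. *)
  have half (Q : rat -> Prop) : (forall q q', Q q -> Q q' -> q = q') ->
      (forall q, Q q -> (m <= pickle q)%N /\ (m <= pickle (k q))%N) ->
      exists J : set (measurableTypeR R), [/\ measurable J,
        (lebesgue_measure J <= (1 / (2 ^ m.+1)%:R)%:E)%E &
        forall (t : R) (q : rat), 0 <= t < 1 -> Q q ->
          (X t : autQ) (k q) = q -> J t].
    move=> uQ mQ; have [[q Qq]|nQ] := pselect (exists q, Q q); last first.
      exists set0; split=> //; first by rewrite measure0 lee_fin.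
      by move=> t q _ Qq; exfalso; apply: nQ; exists q.
    have [m1 m2] := mQ q Qq; have [J [J1 J2 J3]] := coincidence_interval m2 m1.
    by exists J; split=> // t q' t01 Qq'; rewrite (uQ _ _ Qq' Qq); exact: J3.
  have [||J1 [mJ1 lJ1 hJ1]] :=
    half (fun q => pickle q = m /\ (m <= pickle (k q))%N).
  - by move=> q q' [e _] [e' _]; apply: (pcan_inj pickleK); rewrite e e'.
  - by move=> q [-> ->].
  have [||J2 [mJ2 lJ2 hJ2]] :=
    half (fun q => pickle (k q) = m /\ (m <= pickle q)%N).
  - move=> q q' [e _] [e' _]; apply: (@autQ_inj k).
    by apply: (pcan_inj pickleK); rewrite e e'.
  - by move=> q [-> ->].
  exists (J1 `|` J2); split; first exact: measurableU.
    apply: le_trans (measureU2 _ mJ1 mJ2) _; apply: le_trans (leeD lJ1 lJ2) _.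
    by rewrite -EFinD lee_fin -mulrDl.
  move=> t q t01 qm e; have [h|h] := leqP (pickle q) (pickle (k q)).
    by left; apply: (hJ1 t q) => //; split; rewrite -qm (minn_idPl h).
  by right; apply: (hJ2 t q) => //; split; rewrite -qm (minn_idPr (ltnW h)) // ltnW.
have mJ m : measurable (J m) by have [] := JP m.
have cv : (\big[+%E/0%R]_(0 <= n <oo) lebesgue_measure (J n) < +oo)%E.
  apply: (@le_lt_trans _ _ (2 : R)%:E); last by rewrite ltry.
  apply: le_trans (@epsilon_trick0 R 2 predT _); last by [].
  by apply: lee_nneseries => // n _; have [] := JP n.
have lim0 := lim_sup_set_cvg0 mJ cv.
have sub : [set t : R | 0 <= t < 1 /\
    ~ finitely_many_fixed_points ((X t : autQ) * k)%g] `<=` lim_sup_set J.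
  (* If t avoids all [J m] with m >= n, every fixed point q has an index below n itself or through
     [k q], which leaves finitely many. *)
  move=> t [t01 inf] n _; apply: contrapT => h; apply: inf.
  apply: (@sub_finite_set _ _ ([set y : rat | (pickle y < n)%N] `|`
    [set (k^-1)%g y | y in [set y : rat | (pickle y < n)%N]])); last first.
    rewrite finite_setU; split; first exact: finite_pickle_lt.
    by apply: finite_image; exact: finite_pickle_lt.
  move=> q fq; have [h1|h1] := ltnP (pickle q) n; first by left.
  have [h2|h2] := ltnP (pickle (k q)) n.
    by right; exists (k q) => //; rewrite autQ_invl.
  exfalso; apply: h; exists (minn (pickle q) (pickle (k q))).
    by rewrite /= leq_min h1.
  by have [_ _ hJ] := JP (minn (pickle q) (pickle (k q))); apply: (hJ t q).
apply: (negligibleS (mu := @lebesgue_measure R) sub); exists (lim_sup_set J); split=> //.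
apply: bigcapT_measurable => n; apply: bigcup_measurable => j _; exact: mJ.
Qed.

Lemma uniform_prob_negligible (A : set (measurableTypeR R)) : measurable A ->
  (@lebesgue_measure R).-negligible [set t : R | 0 <= t < 1 /\ A t] ->
  uniform_prob (@ltr01 R) A = 0%E.
Proof.
move=> mA nA.
have mA1 : measurable (A `&` `[(0 : R), 1]%classic).
  by apply: measurableI => //; exact: measurable_itv.
have -> : uniform_prob (@ltr01 R) A =
    uniform_prob (@ltr01 R) (A `&` `[(0 : R), 1]%classic).
  rewrite /uniform_prob integral_uniform_pdf [RHS]integral_uniform_pdf.
  by rewrite -setIA setIid.
have /null_content_dominatesP := @dominates_uniform_prob R 0 1 (@ltr01 R).
apply=> //; apply: (measure_negligible mA1).
have sub : A `&` `[(0 : R), 1]%classic `<=`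
    [set t : R | 0 <= t < 1 /\ A t] `|` [set 1].
  move=> t [At /=]; rewrite in_itv /= => /andP[t0]; rewrite le_eqVlt.
  by move=> /predU1P[->|t1]; [right|left; rewrite t0].
apply: (negligibleS (mu := @lebesgue_measure R) sub); apply: negligibleU => //.
by exists [set 1]; split=> //; exact: lebesgue_measure_set1.
Qed.

Lemma almost_every_goodQ : almost_every R goodQ.
Proof.
pose B := [set f : autQ | ~ goodQ f].
have mB : measurable (B : set borelQ).
  by apply: measurable_notC; exact: measurable_goodQ.
exists B => //; split=> //; exists (muQ R) => g h.
have mT := measurable_translate g h mB.
rewrite /muQ /distribution /= /pushforward.
apply: uniform_prob_negligible.
  by rewrite -[X in measurable X]setTI; exact: measurable_randQ.
(* [g^-1 * X t * h^-1] is the conjugate by [g] of [X t * k]. As both properties are invariant under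
   conjugation, two-sided translates reduce to products on the right. *)
pose k := (h^-1 * g^-1)%g.
have trB t : (@randQ R @^-1` translate g B h) t -> ~ goodQ ((X t : autQ) * k)%g.
  rewrite translateE /preimage /= => nB gd; apply: nB.
  have -> : (g^-1 * X t * h^-1)%g = (((X t : autQ) * k) ^ g)%g.
    by rewrite conjgE /k !mulgA mulgVK.
  exact: goodQ_conj.
have sub : [set t : R | 0 <= t < 1 /\ (@randQ R @^-1` translate g B h) t] `<=`
    [set t : R | exists xy : rat * rat, [set t : R | 0 <= t < 1 /\
       touches ((X t : autQ) * k)%g xy.1 xy.2] t] `|`
    [set t : R | 0 <= t < 1 /\
       ~ finitely_many_fixed_points ((X t : autQ) * k)%g].
  move=> t [t01 /trB/not_andP[/not_alternatingQ_touches[x [y h1]]|h1]].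
    by left; exists (x, y).
  by right.
apply: (negligibleS (mu := @lebesgue_measure R) sub).
apply: negligibleU; last exact: infinite_fixed_negligible.
by apply: negligible_countable => -[x y]; exact: touching_negligible.
Qed.

End almost_every.

Lemma goodQP (f : autQ) :
  goodQ f <-> alternating_orbitals f /\ finitely_many_fixed_points f.
Proof. by split=> -[h1 h2]; split=> //; exact/alternatingQP. Qed.

Lemma classQ_goodQ (f f' : autQ) : classQ f f' -> goodQ f' ->
  forall f'', classQ f f'' -> goodQ f''.
Proof.
move=> [g _ <-] gd _ [g' _ <-]; apply: goodQ_conj.
by have := goodQ_conj (g^-1)%g gd; rewrite -conjgM mulgV conjg1.
Qed.

Theorem theorem3p2 (R : realType) :
  [/\ almost_every R (fun f : autQ =>
        alternating_orbitals f /\ finitely_many_fixed_points f),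
      forall C : set autQ, conjugacy_class C ->
        (~ haar_null R C <->
           exists f, C f /\
             (alternating_orbitals f /\ finitely_many_fixed_points f)) /\
        ((exists f, C f /\
             (alternating_orbitals f /\ finitely_many_fixed_points f)) <->
         (forall f, C f ->
             alternating_orbitals f /\ finitely_many_fixed_points f)),
      forall C : set autQ, conjugacy_class C ->
        ~ haar_null R C -> compact_biter C
    & forall C : set autQ, conjugacy_class C ->
        ~ haar_null R C -> (forall f, C f -> fixed_points f = set0) ->
        compact_catcher C].
Proof.
have ae : almost_every R (fun f : autQ =>
    alternating_orbitals f /\ finitely_many_fixed_points f).
  have [B hB sB] := almost_every_goodQ R.
  by exists B => // f nf; apply: sB => /goodQP.
(* If [f] lacks one of the properties, then by conjugation invariance its whole class consists of
   such automorphisms and lies in a Haar null set. *)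
have ex (f : autQ) : ~ haar_null R (classQ f) -> goodQ f.
  move=> nn; apply: contrapT => ng; apply: nn.
  have [B hB sB] := ae; exists B => // f' cf'; apply: sB => /goodQP gd.
  apply: ng; apply: (classQ_goodQ cf' gd).
  by exists 1%g => //; rewrite conjg1.
have ff (f : autQ) : classQ f f by exists 1%g => //; rewrite conjg1.
split=> //.
- move=> _ [f ->]; rewrite -/(classQ f); split; split.
  + by move=> /ex gf; exists f; split; [exact: ff|exact/goodQP].
  + move=> [f' [cf' /goodQP gf']].
    have [alt_f fin_f] := classQ_goodQ cf' gf' (ff f).
    exact: class_not_haar_null.
  + by move=> [f' [cf' /goodQP gf']] f'' cf''; apply/goodQP; exact: classQ_goodQ cf' gf' _ cf''.
  + by move=> h; exists f; split; [exact: ff|exact: h (ff f)].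
- by move=> _ [f ->] /ex[alt_f fin_f]; exact: class_compact_biter.
- move=> _ [f ->] /ex[alt_f fin_f] nofix; apply: class_compact_catcher => //.
  exact: nofix (ff f).
Qed.
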